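(* Let $x(\tau),y(\tau)$ ($\operatorname{Im}\tau>0$) be Burnside's functions, $y^2=x^5-x$ (see context). For $e\in\{1,-1,i,-i\}$ the integer $q$-series $$X=e\,\big(1+4q^2+8q^4+16q^6+32q^8+56q^{10}+96q^{12}+\cdots\big),\qquad Y=4\sqrt e\;q\,\big(1+6q^2+24q^4+80q^6+231q^8+606q^{10}+\cdots\big),$$ which are the developments of $X=x(\tau)$ and $Y=y(\tau)$ at the branch point $x=e$ in the coordinate $q$ given in the context, have an exact representation in the form of products: $$X=e\prod_{k=1}^\infty\big(1+q^{4k}\big)^2\big(1+q^{4k-2}\big)^4,\qquad Y=4\sqrt e\;q\prod_{k=1}^\infty\big(1+q^{4k}\big)^3\big(1+q^{2k}\big)^6 .$$
   Context: Write $\wp(z)=\wp(z|2,2\tau)$ for the Weierstrass function with half-periods $2,2\tau$ (period lattice $4\mathbb{Z}+4\tau\mathbb{Z}$), $\wp'$ being its $z$-derivative. Burnside's parametrization of the genus two curve $y^2=x^5-x$ is $$x(\tau)=\frac{\wp(1)-\wp(2)}{\wp(\tau)-\wp(2)},$$ $$y(\tau)=4i\,\frac{[\wp(\tau)-\wp(2\tau)]\,[\wp(\frac\tau2)-\wp(\tau)]\,[\wp(\frac\tau2)-\wp(\tau+2)]\,[\wp(\frac12)-\wp(2\tau+1)]\,[\wp(\frac12)-\wp(1)]}{[\wp(\frac\tau2)-\wp(1)]\,[\wp(\frac\tau2)-\wp(2\tau+1)]\,\wp'(\frac12)\,\wp'(\tau)}.$$ The coordinates $q=q(\tau)$ in which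 the series are taken are: for $e=1$, $q=e^{\frac{\pi i}{4}\frac{3\tau-2}{2\tau-1}}$ ($\tau\to\frac12+i\,0$); for $e=-1$, $q=e^{\frac{\pi i}{4}(\tau-2)}$ ($\tau\to+i\,\infty$); for $e=i$, $q=e^{\frac{\pi i}{4}\frac{\tau-2}{\tau-1}}$ ($\tau\to1+i\,0$); for $e=-i$, $q=e^{\frac{\pi i}{4}\frac{\tau-1}{\tau+1}}$ ($\tau\to-1+i\,0$). Here ''$\tau\to a+i\,0$'' means approaching the real point $a$ from the upper half-plane. The branch of the multiplier $\sqrt e$ is not specified.
   Formalization: For e = -i the printed coordinate q = exp((πi/4)(τ-1)/(τ+1)) makes the claim false; it is replaced by q = exp(-(πi/4)(τ+2)/(τ+1)), which also tends to 0 as τ → -1 + i0. *)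

(* Defs.v *)
(* Stdlib world: Stdlib's reals with Coquelicot's complex numbers. *)
From Stdlib Require Export Reals ZArith List.
From Coquelicot Require Export Coquelicot.
Export ListNotations.
Open Scope C_scope.

Definition Cexp (z : C) : C :=
  (exp (Re z) * cos (Im z), exp (Re z) * sin (Im z))%R.

(** Unconditional summation over the elements of [D]: limit of the finite
    partial sums along the directed set of finite subsets of [D] (represented
    by duplicate-free lists), ordered by inclusion. *)
Definition finite_subsets {I : Type} (D : I -> Prop) : (list I -> Prop) -> Prop :=
  fun P => exists S0 : list I, List.Forall D S0 /\
    forall S : list I, List.Forall D S -> NoDup S -> incl S0 S -> P S.

Definition list_sum_C {I : Type} (f : I -> C) (S : list I) : C :=
  fold_right (fun i s => f i + s) 0 S.

Definition is_sum_over {I : Type} (D : I -> Prop) (f : I -> C) (l : C) : Prop :=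
  filterlim (list_sum_C f) (finite_subsets D) (locally l).

Definition sum_over {I : Type} (D : I -> Prop) (f : I -> C) : C :=
  @iota C_CompleteNormedModule (is_sum_over D f).

(** Weierstrass function [wp w w' z] with half-periods [w], [w'], that is, with
    period lattice [2 w Z + 2 w' Z] (meaningful when [w], [w'] are linearly
    independent over the reals). *)
Definition lattice_point (w w' : C) (p : Z * Z) : C :=
  2 * IZR (fst p) * w + 2 * IZR (snd p) * w'.

Definition wp (w w' z : C) : C :=
  / z ^ 2 +
  sum_over (fun p : Z * Z => p <> (0%Z, 0%Z))
    (fun p => / (z - lattice_point w w' p) ^ 2 - / lattice_point w w' p ^ 2).

(** [C_derive] is the complex derivative wherever the function is complex
    differentiable ([is_C_derive_unique]), as [wp w w'] is off its lattice. *)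
Definition wp' (w w' z : C) : C := C_derive (wp w w') z.

Definition burnside_x (tau : C) : C :=
  let P := wp 2 (2 * tau) in
  (P 1 - P 2) / (P tau - P 2).

Definition burnside_y (tau : C) : C :=
  let P := wp 2 (2 * tau) in
  let P' := wp' 2 (2 * tau) in
  4 * Ci *
  ((P tau - P (2 * tau)) * (P (tau / 2) - P tau) * (P (tau / 2) - P (tau + 2)) *
   (P (1 / 2) - P (2 * tau + 1)) * (P (1 / 2) - P 1)) /
  ((P (tau / 2) - P 1) * (P (tau / 2) - P (2 * tau + 1)) *
   P' (1 / 2) * P' tau).

(** The nonzero finite branch points 1, -1, i, -i of y^2 = x^5 - x. *)
Inductive branch_point : Set := e_one | e_mone | e_i | e_mi.

Definition branch_value (b : branch_point) : C :=
  match b with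
  | e_one => 1
  | e_mone => - (1)
  | e_i => Ci
  | e_mi => - Ci
  end.

(** The coordinate is [exp (pi i / 4 * M tau)] with [M] unimodular, sending the
    cusp 1/2, oo, 1, -1 respectively to oo.  At [- i] it is the mirror image of
    the one at [i] under [tau |-> - conj tau], because
    [x (- conj tau) = conj (x tau)].  The map [(tau - 1) / (tau + 1)] sometimes
    printed there has determinant 2 and does not give an integer q-series. *)
Definition branch_moebius (b : branch_point) (tau : C) : C :=
  match b with
  | e_one => (3 * tau - 2) / (2 * tau - 1)
  | e_mone => tau - 2
  | e_i => (tau - 2) / (tau - 1)
  | e_mi => - ((tau + 2) / (tau + 1))
  end.

Definition branch_q (b : branch_point) (tau : C) : C :=
  Cexp (PI * Ci / 4 * branch_moebius b tau).

(** [partial_prod f n = f 1 * ... * f n] *)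
Fixpoint partial_prod (f : nat -> C) (n : nat) : C :=
  match n with
  | O => 1
  | S m => partial_prod f m * f (S m)
  end.

Definition is_infinite_prod (f : nat -> C) (l : C) : Prop :=
  filterlim (partial_prod f) eventually (locally l).

(* Main.v *)
Require Import Defs.
From Stdlib Require Import Reals ZArith List.
From Coquelicot Require Import Coquelicot.
From Stdlib Require Import Lra Lia Permutation ClassicalEpsilon FunctionalExtensionality.
Import ListNotations.
Open Scope C_scope.

(** Summing the Weierstrass series over the rows of the lattice, for any basis
    of it, turns a difference [wp z1 - wp z2] into a two-sided sum over [n] of
    [s (u p^n) - s (v p^n)] with [s x = x / (1 - x)^2].  For the theta product
    [th] one has [th (u a) th (u / a) / th u ^ 2] equal to the product of
    [1 - (a + 1/a - 2) s (u p^n)], so that dividing Weierstrass' three-term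
    theta relation (a consequence of the triple product) by [a + 1/a - 2] and
    letting [a] tend to 1 evaluates that sum as a quotient of theta products;
    one more limit gives [wp'].  Because the lattice sum is unconditional, the
    basis may be chosen separately at each cusp: it is the unimodular image
    under which the nome becomes [q^8].  Burnside's [x] and [y] are then
    monomials in [q] and in the products [qp (q^8) (zeta^m q^j)], [zeta] a
    primitive eighth root of unity, and the distribution relations among
    these reduce them to the stated products. *)

(** Every identity between infinite objects is the limit of a finite algebraic one: the triple
    product of a q-binomial recursion, the partial fractions of the squared cosecant of iterated
    halvings of the argument, the q-series of finite products. Limit and sum are exchanged each time
    by dominated convergence over finite subsets, [has_sum_tannery]. Eighth roots of unity arise
    from the periods: Burnside's arguments are points [(k + l * tau) / 2], which become eighths
    after division by the period [4 * mden]. At a cusp some theta products then start with a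
    constant [1 - zeta ^ m]; these constants, with the powers of [zeta] produced by
    quasi-periodicity, combine to [e] and to the square root of [e]. The integer coefficients
    involve no modular argument: they are those of the products in [q ^ 2], each one fixed by
    finitely many factors, so that the listed values are obtained by computation. *)

(** * Convergence of complex sequences *)

Definition Cconv (u : nat -> C) (l : C) : Prop :=
  is_lim_seq (fun n => Cmod (u n - l)) 0.

(** Taken componentwise so as to agree with [C_lim], through which [C_derive] is defined. *)
Definition Clim (u : nat -> C) : C :=
  (real (Lim_seq (fun n => fst (u n))), real (Lim_seq (fun n => snd (u n)))).

Lemma Cmod_sub_sym (x y : C) : Cmod (x - y) = Cmod (y - x).
Proof. rewrite <- Cmod_opp; f_equal; ring. Qed.

Lemma Cmod_sub_triangle (x y : C) : (Cmod (x - y) <= Cmod x + Cmod y)%R.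
Proof.
  replace (x - y) with (x + - y) by ring.
  rewrite <- (Cmod_opp y); apply Cmod_triangle.
Qed.

Lemma Cmod_triangle_inv (x y : C) : (Cmod x - Cmod y <= Cmod (x - y))%R.
Proof.
  generalize (Cmod_triangle (x - y) y); replace (x - y + y) with x by ring; lra.
Qed.

Lemma im_le_Cmod (z : C) : (Rabs (snd z) <= Cmod z)%R.
Proof.
  eapply Rle_trans; [apply Rmax_r | apply Rmax_Cmod].
Qed.

Lemma re_le_Cmod' (z : C) : (Rabs (fst z) <= Cmod z)%R.
Proof.
  eapply Rle_trans; [apply Rmax_l | apply Rmax_Cmod].
Qed.

Lemma Cmod_le_add (z : C) : (Cmod z <= Rabs (fst z) + Rabs (snd z))%R.
Proof.
  destruct z as [x y]; simpl.
  replace ((x, y) : C) with (RtoC x + RtoC y * Ci)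
    by (unfold Ci, RtoC, Cmult, Cplus; simpl; f_equal; ring).
  eapply Rle_trans; [apply Cmod_triangle |].
  rewrite Cmod_mult, Cmod_Ci, !Cmod_R; lra.
Qed.

Lemma is_lim_seq_squeeze0 (a b : nat -> R) :
  (forall n, 0 <= a n <= b n)%R -> is_lim_seq b 0 -> is_lim_seq a 0.
Proof.
  intros H Hb; apply (is_lim_seq_le_le (fun _ => 0%R) a b 0 H); auto.
  apply is_lim_seq_const.
Qed.

Lemma Cconv_of_bound (u : nat -> C) (l : C) (b : nat -> R) :
  (forall n, Cmod (u n - l) <= b n)%R -> is_lim_seq b 0 -> Cconv u l.
Proof.
  intros H; apply is_lim_seq_squeeze0; intros n; split; [apply Cmod_ge_0 | auto].
Qed.

Lemma Cconv_eps (u : nat -> C) (l : C) :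
  Cconv u l <->
  forall eps : R, (0 < eps)%R -> exists N, forall n, (N <= n)%nat -> (Cmod (u n - l) < eps)%R.
Proof.
  unfold Cconv; rewrite <- is_lim_seq_spec; split.
  - intros H eps He; destruct (H (mkposreal eps He)) as [N HN]; exists N; intros n Hn.
    specialize (HN n Hn); simpl in HN; rewrite Rminus_0_r, Rabs_pos_eq in HN;
      auto using Cmod_ge_0.
  - intros H eps; destruct (H eps (cond_pos eps)) as [N HN]; exists N; intros n Hn.
    rewrite Rminus_0_r, Rabs_pos_eq; auto using Cmod_ge_0.
Qed.

Lemma Cconv_const (c : C) : Cconv (fun _ => c) c.
Proof.
  apply (Cconv_of_bound _ _ (fun _ => 0%R)); [| apply is_lim_seq_const].
  intros _; replace (c - c) with (RtoC 0) by ring; rewrite Cmod_0; lra.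
Qed.

Lemma Cconv_ext (u v : nat -> C) (l : C) :
  (forall n, u n = v n) -> Cconv u l -> Cconv v l.
Proof. intros H; apply is_lim_seq_ext; intros n; now rewrite H. Qed.

Lemma Cconv_incr (u : nat -> C) (l : C) :
  Cconv (fun n => u (S n)) l <-> Cconv u l.
Proof.
  unfold Cconv; rewrite (is_lim_seq_incr_1 (fun n => Cmod (u n - l))); tauto.
Qed.

Lemma Cconv_plus (u v : nat -> C) (l m : C) :
  Cconv u l -> Cconv v m -> Cconv (fun n => u n + v n) (l + m).
Proof.
  intros Hu Hv.
  apply (Cconv_of_bound _ _ (fun n => Cmod (u n - l) + Cmod (v n - m))%R).
  - intros n; replace (u n + v n - (l + m)) with ((u n - l) + (v n - m)) by ring.
    apply Cmod_triangle.
  - generalize (is_lim_seq_plus' _ _ _ _ Hu Hv); now rewrite Rplus_0_l.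
Qed.

Lemma Cconv_mult (u v : nat -> C) (l m : C) :
  Cconv u l -> Cconv v m -> Cconv (fun n => u n * v n) (l * m).
Proof.
  intros Hu Hv.
  apply (Cconv_of_bound _ _ (fun n => Cmod (u n - l) * Cmod (v n - m)
     + (Cmod (u n - l) * Cmod m + Cmod l * Cmod (v n - m)))%R).
  - intros n.
    replace (u n * v n - l * m) with
      ((u n - l) * (v n - m) + ((u n - l) * m + l * (v n - m))) by ring.
    rewrite <- !Cmod_mult.
    eapply Rle_trans; [apply Cmod_triangle |]; apply Rplus_le_compat_l, Cmod_triangle.
  - replace 0%R with (0 * 0 + (0 * Cmod m + Cmod l * 0))%R by ring.
    repeat first [ apply is_lim_seq_plus' | apply is_lim_seq_mult'
                 | apply is_lim_seq_const | assumption ].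
Qed.

Lemma Cconv_scal (c : C) (u : nat -> C) (l : C) :
  Cconv u l -> Cconv (fun n => c * u n) (c * l).
Proof. apply Cconv_mult, Cconv_const. Qed.

Lemma Cconv_opp (u : nat -> C) (l : C) : Cconv u l -> Cconv (fun n => - u n) (- l).
Proof.
  intros H; replace (- l) with (- (1) * l) by ring.
  apply (Cconv_ext (fun n => - (1) * u n)); [intros; ring | now apply Cconv_scal].
Qed.

Lemma Cconv_minus (u v : nat -> C) (l m : C) :
  Cconv u l -> Cconv v m -> Cconv (fun n => u n - v n) (l - m).
Proof. intros Hu Hv; apply Cconv_plus, Cconv_opp; auto. Qed.

Lemma Cconv_unique (u : nat -> C) (l m : C) : Cconv u l -> Cconv u m -> l = m.
Proof.
  intros Hl Hm.
  generalize (Cconv_minus _ _ _ _ Hl Hm); intros H.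
  apply (is_lim_seq_ext _ (fun _ => Cmod (l - m))) in H.
  2:{ intros n; rewrite <- (Cmod_opp (l - m)); f_equal; ring. }
  apply is_lim_seq_unique in H; rewrite Lim_seq_const in H; injection H as H.
  apply Cmod_eq_0 in H.
  replace l with (l - m + m) by ring; rewrite H; ring.
Qed.

Lemma Cconv_Clim (u : nat -> C) (l : C) : Cconv u l -> Clim u = l.
Proof.
  intros H; unfold Clim; destruct l as [x y].
  assert (Hx : is_lim_seq (fun n => fst (u n)) x).
  { apply is_lim_seq_ext with (fun n => (fst (u n) - x) + x)%R; [intros; ring |].
    generalize (fun K => is_lim_seq_plus' (fun n => fst (u n) - x)%R (fun _ => x) 0 x K (is_lim_seq_const x)).
    rewrite Rplus_0_l; intros K; apply K.
    apply is_lim_seq_abs_0; revert H; apply is_lim_seq_squeeze0; intros n; split;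
      [apply Rabs_pos |].
    apply (re_le_Cmod' (u n - (x, y))). }
  assert (Hy : is_lim_seq (fun n => snd (u n)) y).
  { apply is_lim_seq_ext with (fun n => (snd (u n) - y) + y)%R; [intros; ring |].
    generalize (fun K => is_lim_seq_plus' (fun n => snd (u n) - y)%R (fun _ => y) 0 y K (is_lim_seq_const y)).
    rewrite Rplus_0_l; intros K; apply K.
    apply is_lim_seq_abs_0; revert H; apply is_lim_seq_squeeze0; intros n; split;
      [apply Rabs_pos |].
    apply (im_le_Cmod (u n - (x, y))). }
  now rewrite (is_lim_seq_unique _ _ Hx), (is_lim_seq_unique _ _ Hy).
Qed.

Lemma Cconv_bound_le (u : nat -> C) (l : C) (M : R) :
  Cconv u l -> (forall n, Cmod (u n) <= M)%R -> (Cmod l <= M)%R.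
Proof.
  intros H HM; apply Rnot_lt_le; intros Hlt.
  destruct (proj1 (Cconv_eps u l) H (Cmod l - M)%R) as [N HN]; [lra |].
  specialize (HN N (Nat.le_refl N)); specialize (HM N).
  rewrite Cmod_sub_sym in HN; generalize (Cmod_triangle_inv l (u N)); lra.
Qed.

Lemma Cconv_inv (u : nat -> C) (l : C) :
  l <> 0 -> Cconv u l -> Cconv (fun n => / u n) (/ l).
Proof.
  intros Hl H; apply Cconv_eps; intros eps He.
  assert (Hp : (0 < Cmod l)%R) by now apply Cmod_gt_0.
  (* The first bound keeps the modulus of [u n] above half that of [l]; the second pays for the
     denominator [u n * l]. *)
  destruct (proj1 (Cconv_eps u l) H (Rmin (Cmod l / 2) (eps * (Cmod l * Cmod l / 2))))
    as [N HN].
  { apply Rmin_pos; [lra |]; apply Rmult_lt_0_compat; [lra |]; nra. }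
  exists N; intros n Hn; specialize (HN n Hn).
  assert (H1 := Rlt_le_trans _ _ _ HN (Rmin_l _ _)).
  assert (H2 := Rlt_le_trans _ _ _ HN (Rmin_r _ _)).
  assert (Hu : (Cmod l / 2 < Cmod (u n))%R).
  { generalize (Cmod_triangle_inv l (u n)); rewrite Cmod_sub_sym; lra. }
  assert (Hn0 : u n <> 0) by (apply Cmod_gt_0; lra).
  replace (/ u n - / l) with (- (u n - l) / (u n * l)) by (field; split; auto).
  rewrite Cmod_div, Cmod_opp, Cmod_mult; [| now apply Cmult_neq_0].
  apply Rmult_lt_reg_r with (Cmod (u n) * Cmod l)%R; [nra |].
  unfold Rdiv; rewrite Rmult_assoc, Rinv_l, Rmult_1_r; [| nra].
  apply (Rlt_le_trans _ _ _ H2), Rmult_le_compat_l; [lra |]; nra.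
Qed.

Lemma Cconv_div (u v : nat -> C) (l m : C) :
  m <> 0 -> Cconv u l -> Cconv v m -> Cconv (fun n => u n / v n) (l / m).
Proof. intros Hm Hu Hv; apply Cconv_mult, Cconv_inv; auto. Qed.

Lemma Cconv_pow (u : nat -> C) (l : C) (k : nat) :
  Cconv u l -> Cconv (fun n => u n ^ k) (l ^ k).
Proof.
  intros H; induction k as [| k IH]; simpl; [apply Cconv_const | now apply Cconv_mult].
Qed.

Lemma ball_C_of_Cmod (x y : C) (eps : R) : (Cmod (y - x) < eps)%R ->
  @ball C_UniformSpace x eps y.
Proof. apply C_NormedModule_mixin_compat1. Qed.

(** Balls of [C_UniformSpace] are squares, which costs a factor [sqrt 2], rounded up to [2]. *)
Lemma Cmod_of_ball_C (x y : C) (eps : posreal) : @ball C_UniformSpace x eps y ->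
  (Cmod (y - x) < 2 * eps)%R.
Proof.
  intros H; generalize (C_NormedModule_mixin_compat2 x y eps H).
  assert (Hs : (sqrt 2 < 2)%R).
  { replace 2%R with (sqrt (2 * 2)) at 2 by (rewrite sqrt_square; lra).
    apply sqrt_lt_1; lra. }
  generalize (cond_pos eps); intros; unfold minus, plus, opp in *; simpl in *.
  change (Cmod (y - x) < sqrt 2 * eps)%R in H1; nra.
Qed.

Lemma filterlim_C_eps {T : Type} (F : (T -> Prop) -> Prop) {FF : Filter F}
  (f : T -> C) (l : C) :
  filterlim f F (locally (T := C_UniformSpace) l) <->
  forall eps : R, (0 < eps)%R -> F (fun x => Cmod (f x - l) < eps)%R.
Proof.
  split.
  - intros H eps He; assert (Hh : (0 < eps / 2)%R) by lra.
    specialize (H (@ball C_UniformSpace l (eps / 2)) (locally_ball _ (mkposreal _ Hh))).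
    revert H; unfold filtermap; apply filter_imp; intros x Hx.
    apply (Cmod_of_ball_C _ _ (mkposreal _ Hh)) in Hx; simpl in Hx; lra.
  - intros H; apply filterlim_locally; intros eps.
    generalize (H eps (cond_pos eps)); apply filter_imp; intros x.
    apply ball_C_of_Cmod.
Qed.

Lemma Cconv_filterlim (u : nat -> C) (l : C) :
  filterlim u eventually (locally (T := C_UniformSpace) l) <-> Cconv u l.
Proof.
  rewrite filterlim_C_eps by apply eventually_filter; symmetry; apply Cconv_eps.
Qed.

Lemma sum_n_Cconv_is_series (a : nat -> C) (l : C) :
  Cconv (sum_n a) l <-> is_series a l.
Proof. symmetry; apply Cconv_filterlim. Qed.

(** * Unconditional sums *)

Definition rsum {I : Type} (g : I -> R) (S : list I) : R :=
  fold_right (fun i s => (g i + s)%R) 0%R S.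

Definition bounded_sums {I : Type} (g : I -> R) : Prop :=
  exists M : R, forall S, NoDup S -> (rsum g S <= M)%R.

Definition summable {I : Type} (f : I -> C) : Prop :=
  bounded_sums (fun i => Cmod (f i)).

(** The case of [is_sum_over] where the domain is the whole type, as [has_sum_is_sum_over] shows, in
    the epsilon form used in all estimates. *)
Definition has_sum {I : Type} (f : I -> C) (l : C) : Prop :=
  forall eps : R, (0 < eps)%R -> exists S0, NoDup S0 /\
    forall S, NoDup S -> incl S0 S -> (Cmod (list_sum_C f S - l) < eps)%R.

Section Lists.
Context {I : Type}.
Implicit Types (S : list I) (f : I -> C) (g : I -> R).

(** Classical, so that duplicates can be removed from lists over an arbitrary index type. *)
Definition ceq_dec (x y : I) : {x = y} + {x <> y} := excluded_middle_informative (x = y).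

Definition in_b S (i : I) : bool := if in_dec ceq_dec i S then true else false.

Lemma list_sum_C_app f S S' : list_sum_C f (S ++ S') = list_sum_C f S + list_sum_C f S'.
Proof. induction S as [| i S IH]; simpl; [ring | rewrite IH; ring]. Qed.

Lemma rsum_app g S S' : rsum g (S ++ S') = (rsum g S + rsum g S')%R.
Proof. induction S as [| i S IH]; simpl; [ring | rewrite IH; ring]. Qed.

Lemma list_sum_C_perm f S S' : Permutation S S' -> list_sum_C f S = list_sum_C f S'.
Proof. induction 1; simpl; [auto | congruence | ring | congruence]. Qed.

Lemma rsum_perm g S S' : Permutation S S' -> rsum g S = rsum g S'.
Proof. induction 1; simpl; [auto | congruence | ring | congruence]. Qed.

Lemma rsum_nonneg g S : (forall i, 0 <= g i)%R -> (0 <= rsum g S)%R.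
Proof. intros H; induction S as [| i S IH]; simpl; [lra | specialize (H i); lra]. Qed.

Lemma rsum_le g g' S : (forall i, g i <= g' i)%R -> (rsum g S <= rsum g' S)%R.
Proof. intros H; induction S as [| i S IH]; simpl; [lra | specialize (H i); lra]. Qed.

Lemma rsum_scal c g S : rsum (fun i => c * g i)%R S = (c * rsum g S)%R.
Proof. induction S as [| i S IH]; simpl; [ring | rewrite IH; ring]. Qed.

Lemma Cmod_list_sum f S : (Cmod (list_sum_C f S) <= rsum (fun i => Cmod (f i)) S)%R.
Proof.
  induction S as [| i S IH]; simpl; [rewrite Cmod_0; lra |].
  eapply Rle_trans; [apply Cmod_triangle | lra].
Qed.

Lemma incl_split S0 S : NoDup S0 -> NoDup S -> incl S0 S ->
  exists T, NoDup T /\ (forall i, In i T -> In i S /\ ~ In i S0) /\ Permutation S (S0 ++ T).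
Proof.
  intros H0 H Hi; exists (filter (fun i => negb (in_b S0 i)) S).
  assert (HT : forall i, In i (filter (fun i => negb (in_b S0 i)) S) <-> In i S /\ ~ In i S0).
  { intros i; rewrite filter_In; unfold in_b; destruct (in_dec ceq_dec i S0);
      simpl; intuition congruence. }
  split; [now apply NoDup_filter |]; split; [intros i; apply HT |].
  apply NoDup_Permutation; auto.
  - apply NoDup_app; auto; [now apply NoDup_filter |].
    intros i Hi0 HiT; apply HT in HiT; tauto.
  - intros i; rewrite in_app_iff, HT; split; [| intros [K | K]; [apply Hi | ]; tauto].
    intros Hs; destruct (in_dec ceq_dec i S0); tauto.
Qed.

Lemma list_sum_C_plus f f' S :
  list_sum_C (fun i => f i + f' i) S = list_sum_C f S + list_sum_C f' S.
Proof. induction S as [| i S IH]; simpl; [ring | rewrite IH; ring]. Qed.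

Lemma list_sum_C_scal c f S : list_sum_C (fun i => c * f i) S = c * list_sum_C f S.
Proof. induction S as [| i S IH]; simpl; [ring | rewrite IH; ring]. Qed.

Lemma bounded_sums_le g g' :
  (forall i, g i <= g' i)%R -> bounded_sums g' -> bounded_sums g.
Proof.
  intros H [M HM]; exists M; intros S HS; eapply Rle_trans; [apply rsum_le, H | auto].
Qed.

Lemma bounded_sums_scal c g :
  (0 <= c)%R -> bounded_sums g -> bounded_sums (fun i => c * g i)%R.
Proof.
  intros Hc [M HM]; exists (c * M)%R; intros S HS; rewrite rsum_scal.
  now apply Rmult_le_compat_l; auto.
Qed.

Lemma summable_le f g : (forall i, Cmod (f i) <= g i)%R -> bounded_sums g -> summable f.
Proof. apply bounded_sums_le. Qed.

(** Choose [S0] with a sum within [eps] of the supremum of all finite sums; anything disjoint from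
    it then adds less than [eps]. *)
Lemma bounded_sums_tail g (Hg : forall i, (0 <= g i)%R) : bounded_sums g ->
  forall eps, (0 < eps)%R -> exists S0, NoDup S0 /\
  forall T, NoDup T -> (forall i, In i T -> ~ In i S0) -> (rsum g T < eps)%R.
Proof.
  intros [M HM] eps He.
  destruct (completeness (fun r => exists S, NoDup S /\ r = rsum g S)) as [m [Hub Hlub]].
  - exists M; intros r [S [HS ->]]; auto.
  - exists 0%R, nil; split; [constructor | reflexivity].
  - destruct (classic (exists S, NoDup S /\ (m - eps < rsum g S)%R)) as [[S0 [H0 H1]] | Hn].
    + exists S0; split; auto; intros T HT Hd.
      assert (HN : NoDup (S0 ++ T)) by (apply NoDup_app; auto; intros i Hi Hj; apply (Hd i); auto).
      generalize (Hub _ (ex_intro _ _ (conj HN eq_refl))); rewrite rsum_app; lra.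
    + exfalso; assert (m <= m - eps)%R; [apply Hlub | lra].
      intros r [S [HS ->]]; apply Rnot_lt_le; intros Hlt; apply Hn; eauto.
Qed.

Lemma finite_subsets_filter (D : I -> Prop) : ProperFilter (finite_subsets D).
Proof.
  constructor.
  - intros P [S0 [H0 H]]; exists (nodup ceq_dec S0); apply H.
    + apply Forall_forall; intros i Hi; apply nodup_In in Hi.
      now apply (proj1 (Forall_forall D S0)).
    + apply NoDup_nodup.
    + intros i Hi; now apply nodup_In.
  - constructor.
    + exists nil; auto.
    + intros P Q [S0 [H0 H]] [S1 [H1 K]]; exists (S0 ++ S1); split.
      * now apply Forall_app.
      * intros S HS HN Hi; split; [apply H | apply K]; auto;
          intros i Hs; apply Hi, in_app_iff; auto.
    + intros P Q HPQ [S0 [H0 H]]; exists S0; split; auto.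
Qed.

Lemma common_superlist S0 S1 : exists S, NoDup S /\ incl S0 S /\ incl S1 S.
Proof.
  exists (nodup ceq_dec (S0 ++ S1)); split; [apply NoDup_nodup |].
  split; intros i Hi; apply nodup_In, in_app_iff; auto.
Qed.

Lemma has_sum_is_sum_over f l : has_sum f l <-> is_sum_over (fun _ => True) f l.
Proof.
  unfold is_sum_over; rewrite filterlim_C_eps by apply finite_subsets_filter.
  split; intros H eps He; destruct (H eps He) as [S0 [H0 HS]].
  - exists S0; split; auto; apply Forall_forall; auto.
  - exists (nodup ceq_dec S0); split; [apply NoDup_nodup |]; intros S HN Hi; apply HS; auto.
    + apply Forall_forall; auto.
    + intros i Hs; apply Hi, nodup_In; auto.
Qed.

Lemma has_sum_unique f l m : has_sum f l -> has_sum f m -> l = m.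
Proof.
  intros Hl Hm; destruct (classic (l = m)) as [| Hn]; auto; exfalso.
  assert (Hp : (0 < Cmod (l - m) / 2)%R).
  { apply Rdiv_lt_0_compat; [| lra]; apply Cmod_gt_0; intros K; apply Hn.
    replace l with (l - m + m) by ring; rewrite K; ring. }
  destruct (Hl _ Hp) as [S0 [N0 H0]]; destruct (Hm _ Hp) as [S1 [N1 H1]].
  destruct (common_superlist S0 S1) as [S [HS [K0 K1]]].
  specialize (H0 S HS K0); specialize (H1 S HS K1); set (x := list_sum_C f S) in *.
  rewrite Cmod_sub_sym in H0.
  generalize (Cmod_triangle (l - x) (x - m)).
  replace (l - x + (x - m)) with (l - m) by ring; lra.
Qed.

Lemma summable_tail f : summable f ->
  forall eps, (0 < eps)%R -> exists S0, NoDup S0 /\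
  forall S, NoDup S -> incl S0 S ->
    (Cmod (list_sum_C f S - list_sum_C f S0) < eps)%R.
Proof.
  intros H eps He.
  destruct (bounded_sums_tail _ (fun i => Cmod_ge_0 (f i)) H eps He) as [S0 [N0 H0]].
  exists S0; split; auto; intros S HN Hi.
  destruct (incl_split S0 S N0 HN Hi) as [T [NT [HT HP]]].
  rewrite (list_sum_C_perm f _ _ HP), list_sum_C_app.
  replace (_ - _) with (list_sum_C f T) by ring.
  eapply Rle_lt_trans; [apply Cmod_list_sum |]; apply H0; auto.
  intros i Ht; now apply HT.
Qed.

(** By [summable_tail] the finite sums are Cauchy along the filter of finite subsets, and [C] is
    complete. *)
Lemma summable_has_sum f : summable f -> exists l, has_sum f l.
Proof.
  intros H.
  destruct (proj1 (filterlim_locally_cauchy (U := C_CompleteNormedModule)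
    (F := finite_subsets (fun _ => True)) (FF := finite_subsets_filter _) (list_sum_C f)))
    as [l Hl].
  - intros eps.
    destruct (summable_tail f H (eps / 2)) as [S0 [N0 H0]];
      [generalize (cond_pos eps); lra |].
    exists (fun S => NoDup S /\ incl S0 S); split.
    + exists S0; split; [apply Forall_forall; auto |]; auto.
    + intros S T [NS HS] [NT HT]; apply ball_C_of_Cmod.
      generalize (H0 S NS HS) (H0 T NT HT); intros K1 K2.
      rewrite Cmod_sub_sym in K1.
      generalize (Cmod_triangle (list_sum_C f T - list_sum_C f S0)
        (list_sum_C f S0 - list_sum_C f S)).
      replace (_ + _) with (list_sum_C f T - list_sum_C f S) by ring; lra.
  - exists l; now apply has_sum_is_sum_over.
Qed.

Lemma has_sum_ext f f' l : (forall i, f i = f' i) -> has_sum f l -> has_sum f' l.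
Proof. intros H; replace f' with f; auto; now apply functional_extensionality. Qed.

Lemma has_sum_plus f f' l l' :
  has_sum f l -> has_sum f' l' -> has_sum (fun i => f i + f' i) (l + l').
Proof.
  intros H H' eps He.
  destruct (H (eps / 2)%R) as [S0 [N0 H0]]; [lra |].
  destruct (H' (eps / 2)%R) as [S1 [N1 H1]]; [lra |].
  destruct (common_superlist S0 S1) as [S2 [N2 [I0 I1]]].
  exists S2; split; auto; intros S HS Hi; rewrite list_sum_C_plus.
  replace (_ - _) with ((list_sum_C f S - l) + (list_sum_C f' S - l')) by ring.
  eapply Rle_lt_trans; [apply Cmod_triangle |].
  generalize (H0 S HS (fun i K => Hi i (I0 i K))) (H1 S HS (fun i K => Hi i (I1 i K))); lra.
Qed.

Lemma has_sum_scal c f l : has_sum f l -> has_sum (fun i => c * f i) (c * l).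
Proof.
  intros H eps He.
  destruct (H (eps / (Cmod c + 1))%R) as [S0 [N0 H0]].
  { apply Rdiv_lt_0_compat; auto; generalize (Cmod_ge_0 c); lra. }
  exists S0; split; auto; intros S HS Hi; specialize (H0 S HS Hi).
  rewrite list_sum_C_scal.
  replace (_ - _) with (c * (list_sum_C f S - l)) by ring.
  rewrite Cmod_mult; generalize (Cmod_ge_0 c) (Cmod_ge_0 (list_sum_C f S - l)); intros.
  apply Rle_lt_trans with ((Cmod c + 1) * Cmod (list_sum_C f S - l))%R; [nra |].
  apply (Rmult_lt_compat_l (Cmod c + 1)) in H0; [| lra].
  now replace ((Cmod c + 1) * (eps / (Cmod c + 1)))%R with eps in H0 by (field; lra).
Qed.

Lemma has_sum_opp f l : has_sum f l -> has_sum (fun i => - f i) (- l).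
Proof.
  intros H; replace (- l) with (- (1) * l) by ring.
  apply (has_sum_ext (fun i => - (1) * f i)); [intros; ring | now apply has_sum_scal].
Qed.

Lemma has_sum_minus f f' l l' :
  has_sum f l -> has_sum f' l' -> has_sum (fun i => f i - f' i) (l - l').
Proof. intros H H'; apply has_sum_plus, has_sum_opp; auto. Qed.

Lemma has_sum_zero : has_sum (fun _ : I => RtoC 0) 0.
Proof.
  intros eps He; exists nil; split; [constructor |]; intros S _ _.
  replace (list_sum_C _ S) with (RtoC 0); [replace (0 - 0) with (RtoC 0) by ring; now rewrite Cmod_0 |].
  induction S as [| i S IH]; simpl; [| rewrite <- IH]; ring.
Qed.

(** Adjoining [i0] turns a finite set avoiding it into an admissible one for the full sum. It
    connects the sum over nonzero lattice points in [wp] with sums over the whole lattice. *)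
Lemma has_sum_except f l i0 : has_sum f l -> is_sum_over (fun i => i <> i0) f (l - f i0).
Proof.
  intros H; apply filterlim_C_eps; [apply finite_subsets_filter |].
  intros eps He; destruct (H eps He) as [S0 [N0 H0]].
  exists (filter (fun i => negb (in_b (i0 :: nil) i)) S0).
  assert (HT : forall S i, In i (filter (fun i => negb (in_b (i0 :: nil) i)) S) <-> In i S /\ i <> i0).
  { intros S i; rewrite filter_In; unfold in_b; destruct (in_dec ceq_dec i (i0 :: nil)) as [K | K];
      simpl in *; intuition congruence. }
  split; [apply Forall_forall; intros i Hi; now apply HT in Hi |].
  intros S HS HN Hi.
  assert (HN' : NoDup (i0 :: S)).
  { constructor; auto; intros K; rewrite Forall_forall in HS; now apply (HS i0). }
  replace (list_sum_C f S - (l - f i0)) with (list_sum_C f (i0 :: S) - l) by (simpl; ring).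
  apply H0; auto; intros i Hs; destruct (ceq_dec i i0) as [-> | Hne]; [now left | right].
  apply Hi, HT; auto.
Qed.

(** Tannery's theorem. The majorant makes the contribution outside a finite set [S0] small for all
    [F n] and for [f] at once; on [S0] finitely many terms converge. The two tails cost
    [2 * (eps / 5)] each and the finite sum [eps / 5]. *)
Lemma has_sum_tannery (F : nat -> I -> C) f g (L : nat -> C) l :
  bounded_sums g -> (forall n i, Cmod (F n i) <= g i)%R ->
  (forall i, Cconv (fun n => F n i) (f i)) ->
  (forall n, has_sum (F n) (L n)) -> has_sum f l -> Cconv L l.
Proof.
  intros Hg Hb Hc HL Hl; apply Cconv_eps; intros eps He.
  assert (Hg0 : forall i, (0 <= g i)%R) by (intros i; eapply Rle_trans; [apply Cmod_ge_0 | apply (Hb O)]).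
  assert (Hbf : forall i, (Cmod (f i) <= g i)%R)
    by (intros i; apply (Cconv_bound_le _ _ _ (Hc i)); intros; apply Hb).
  destruct (bounded_sums_tail g Hg0 Hg (eps / 5)) as [S0 [N0 H0]]; [lra |].
  assert (key : forall h m, (forall i, Cmod (h i) <= g i)%R -> has_sum h m ->
    (Cmod (m - list_sum_C h S0) < 2 * (eps / 5))%R).
  { intros h m Hh Hm; destruct (Hm (eps / 5)%R) as [S1 [N1 H1]]; [lra |].
    destruct (common_superlist S0 S1) as [S [NS [I0 I1]]].
    specialize (H1 S NS I1).
    destruct (incl_split S0 S N0 NS I0) as [T [NT [HT HP]]].
    rewrite (list_sum_C_perm h _ _ HP), list_sum_C_app in H1.
    assert (HTb : (Cmod (list_sum_C h T) < eps / 5)%R).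
    { eapply Rle_lt_trans; [apply Cmod_list_sum |].
      eapply Rle_lt_trans; [apply rsum_le, Hh |]; apply H0; auto; intros i Hi; now apply HT. }
    rewrite Cmod_sub_sym in H1.
    replace (m - list_sum_C h S0) with
      ((m - (list_sum_C h S0 + list_sum_C h T)) + list_sum_C h T) by ring.
    eapply Rle_lt_trans; [apply Cmod_triangle | lra]. }
  assert (Hfin : Cconv (fun n => list_sum_C (F n) S0) (list_sum_C f S0)).
  { clear - Hc; induction S0 as [| i S IH]; simpl; [apply Cconv_const | now apply Cconv_plus]. }
  destruct (proj1 (Cconv_eps _ _) Hfin (eps / 5)%R) as [N HN]; [lra |].
  exists N; intros n Hn; specialize (HN n Hn).
  generalize (key f l Hbf Hl) (key (F n) (L n) (Hb n) (HL n)); intros K1 K2.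
  rewrite Cmod_sub_sym in K1.
  replace (L n - l) with ((L n - list_sum_C (F n) S0) +
    ((list_sum_C (F n) S0 - list_sum_C f S0) + (list_sum_C f S0 - l))) by ring.
  eapply Rle_lt_trans; [apply Cmod_triangle |].
  eapply Rle_lt_trans; [apply Rplus_le_compat_l, Cmod_triangle | lra].
Qed.

End Lists.

(** * Change of index, disjoint unions and products of index sets *)

Lemma list_sum_C_map {I J : Type} (h : J -> I) (f : I -> C) (S : list J) :
  list_sum_C f (map h S) = list_sum_C (fun j => f (h j)) S.
Proof. induction S as [| j S IH]; simpl; [auto | now rewrite IH]. Qed.

Lemma rsum_map {I J : Type} (h : J -> I) (f : I -> R) (S : list J) :
  rsum f (map h S) = rsum (fun j => f (h j)) S.
Proof. induction S as [| j S IH]; simpl; [auto | now rewrite IH]. Qed.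

Lemma NoDup_map_inj {I J : Type} (h : J -> I) (S : list J) :
  (forall x y, h x = h y -> x = y) -> NoDup S -> NoDup (map h S).
Proof. intros Hh; apply FinFun.Injective_map_NoDup; exact Hh. Qed.

Lemma has_sum_reindex {I J : Type} (h : J -> I) (k : I -> J) (f : I -> C) (l : C) :
  (forall i, h (k i) = i) -> (forall j, k (h j) = j) ->
  has_sum f l -> has_sum (fun j => f (h j)) l.
Proof.
  intros Hk Hh H eps He; destruct (H eps He) as [S0 [N0 H0]].
  assert (ik : forall x y, k x = k y -> x = y) by (intros x y E; now rewrite <- (Hk x), E).
  assert (ih : forall x y, h x = h y -> x = y) by (intros x y E; now rewrite <- (Hh x), E).
  exists (map k S0); split; [now apply NoDup_map_inj |].
  intros S HS Hi; rewrite <- list_sum_C_map; apply H0; [now apply NoDup_map_inj |].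
  intros i Hs; rewrite <- (Hk i); apply in_map, Hi, in_map, Hs.
Qed.

Lemma bounded_sums_inj {I J : Type} (h : J -> I) (g : I -> R) :
  (forall x y, h x = h y -> x = y) -> bounded_sums g -> bounded_sums (fun j => g (h j)).
Proof.
  intros Hh [M HM]; exists M; intros S HS; rewrite <- rsum_map.
  apply HM; now apply NoDup_map_inj.
Qed.

Fixpoint lefts {I J : Type} (S : list (I + J)) : list I :=
  match S with
  | nil => nil
  | inl i :: S' => i :: lefts S'
  | inr _ :: S' => lefts S'
  end.

Fixpoint rights {I J : Type} (S : list (I + J)) : list J :=
  match S with
  | nil => nil
  | inl _ :: S' => rights S'
  | inr j :: S' => j :: rights S'
  end.

Lemma In_lefts {I J : Type} (S : list (I + J)) i : In i (lefts S) <-> In (inl i) S.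
Proof.
  induction S as [| [x | x] S IH]; simpl; [tauto | |]; rewrite IH; intuition congruence.
Qed.

Lemma In_rights {I J : Type} (S : list (I + J)) j : In j (rights S) <-> In (inr j) S.
Proof.
  induction S as [| [x | x] S IH]; simpl; [tauto | |]; rewrite IH; intuition congruence.
Qed.

Lemma NoDup_lefts {I J : Type} (S : list (I + J)) : NoDup S -> NoDup (lefts S).
Proof.
  induction 1 as [| [x | x] S Hx HS IH]; simpl; auto; constructor; auto.
  now rewrite In_lefts.
Qed.

Lemma NoDup_rights {I J : Type} (S : list (I + J)) : NoDup S -> NoDup (rights S).
Proof.
  induction 1 as [| [x | x] S Hx HS IH]; simpl; auto; constructor; auto.
  now rewrite In_rights.
Qed.

Lemma list_sum_C_lefts_rights {I J : Type} (f : I + J -> C) S :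
  list_sum_C f S = list_sum_C (fun i => f (inl i)) (lefts S)
                 + list_sum_C (fun j => f (inr j)) (rights S).
Proof. induction S as [| [x | x] S IH]; simpl; [ring | |]; rewrite IH; ring. Qed.

Lemma rsum_lefts_rights {I J : Type} (f : I + J -> R) S :
  rsum f S = (rsum (fun i => f (inl i)) (lefts S) + rsum (fun j => f (inr j)) (rights S))%R.
Proof. induction S as [| [x | x] S IH]; simpl; [ring | |]; rewrite IH; ring. Qed.

Lemma has_sum_sum {I J : Type} (f : I + J -> C) (a b : C) :
  has_sum (fun i => f (inl i)) a -> has_sum (fun j => f (inr j)) b -> has_sum f (a + b).
Proof.
  intros Ha Hb eps He.
  destruct (Ha (eps / 2)%R) as [S0 [N0 H0]]; [lra |].
  destruct (Hb (eps / 2)%R) as [S1 [N1 H1]]; [lra |].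
  exists (map inl S0 ++ map inr S1); split.
  - apply NoDup_app; try apply NoDup_map_inj; auto; try congruence.
    intros x Hx Hy; apply in_map_iff in Hx; apply in_map_iff in Hy.
    destruct Hx as [u [<- _]], Hy as [v [E _]]; discriminate.
  - intros S HS Hi; rewrite list_sum_C_lefts_rights.
    assert (K0 : incl S0 (lefts S))
      by (intros i Hs; apply In_lefts, Hi, in_app_iff; left; now apply in_map).
    assert (K1 : incl S1 (rights S))
      by (intros i Hs; apply In_rights, Hi, in_app_iff; right; now apply in_map).
    specialize (H0 _ (NoDup_lefts S HS) K0); specialize (H1 _ (NoDup_rights S HS) K1).
    match goal with |- context [?x + ?y - (a + b)] =>
      replace (x + y - (a + b)) with ((x - a) + (y - b)) by ring end.
    eapply Rle_lt_trans; [apply Cmod_triangle | lra].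
Qed.

Lemma bounded_sums_sum {I J : Type} (g : I + J -> R) :
  bounded_sums (fun i => g (inl i)) -> bounded_sums (fun j => g (inr j)) -> bounded_sums g.
Proof.
  intros [M HM] [N HN]; exists (M + N)%R; intros S HS; rewrite rsum_lefts_rights.
  apply Rplus_le_compat; [apply HM, NoDup_lefts | apply HN, NoDup_rights]; auto.
Qed.

Lemma list_sum_C_prod {I J : Type} (f : I * J -> C) (S : list I) (T : list J) :
  list_sum_C f (list_prod S T) = list_sum_C (fun i => list_sum_C (fun j => f (i, j)) T) S.
Proof.
  induction S as [| i S IH]; simpl; auto.
  now rewrite list_sum_C_app, list_sum_C_map, IH.
Qed.

Lemma rsum_prod {I J : Type} (f : I * J -> R) (S : list I) (T : list J) :
  rsum f (list_prod S T) = rsum (fun i => rsum (fun j => f (i, j)) T) S.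
Proof.
  induction S as [| i S IH]; simpl; auto.
  now rewrite rsum_app, rsum_map, IH.
Qed.

Lemma NoDup_list_prod {I J : Type} (S : list I) (T : list J) :
  NoDup S -> NoDup T -> NoDup (list_prod S T).
Proof.
  intros HS HT; induction HS as [| i S Hi HS IH]; simpl; [constructor |].
  apply NoDup_app; auto; [apply NoDup_map_inj; auto; congruence |].
  intros [x y] H1 H2; apply in_map_iff in H1; destruct H1 as [z [E _]].
  injection E as -> ->; apply in_prod_iff in H2; tauto.
Qed.

Lemma has_sum_list_sum {I J : Type} (f : I -> J -> C) (F : I -> C) (S : list I) :
  (forall i, has_sum (f i) (F i)) ->
  has_sum (fun j => list_sum_C (fun i => f i j) S) (list_sum_C F S).
Proof.
  intros H; induction S as [| i S IH]; simpl; [apply has_sum_zero | now apply has_sum_plus].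
Qed.

Lemma list_sum_C_exchange {I J : Type} (f : I -> J -> C) (S : list I) (T : list J) :
  list_sum_C (fun i => list_sum_C (f i) T) S = list_sum_C (fun j => list_sum_C (fun i => f i j) S) T.
Proof.
  induction S as [| i S IH]; simpl.
  - induction T as [| j T IHT]; simpl; [| rewrite <- IHT]; ring.
  - now rewrite IH, list_sum_C_plus.
Qed.

(** For a finite set [S] of rows, choose columns [T] that nearly exhaust those rows and for which
    the rectangle [S * T] contains the set [S0] of the joint sum. The sum over the rectangle is then
    close both to the row sums and to [l]. *)
Lemma has_sum_fubini {I J : Type} (f : I * J -> C) (F : I -> C) (l : C) :
  has_sum f l -> (forall i, has_sum (fun j => f (i, j)) (F i)) -> has_sum F l.
Proof.
  intros H HF eps He.
  destruct (H (eps / 2)%R) as [S0 [N0 H0]]; [lra |].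
  exists (nodup ceq_dec (map fst S0)); split; [apply NoDup_nodup |].
  intros S HS Hi.
  destruct (has_sum_list_sum (fun i j => f (i, j)) F S HF (eps / 2)%R) as [T0 [M0 K0]]; [lra |].
  destruct (common_superlist T0 (map snd S0)) as [T [NT [I0 I1]]].
  specialize (K0 T NT I0).
  assert (HP : incl S0 (list_prod S T)).
  { intros [i j] Hs; apply in_prod_iff; split.
    - apply Hi, nodup_In; apply (in_map fst) in Hs; exact Hs.
    - apply I1; apply (in_map snd) in Hs; exact Hs. }
  specialize (H0 _ (NoDup_list_prod S T HS NT) HP).
  rewrite list_sum_C_prod, (list_sum_C_exchange (fun i j => f (i, j))) in H0.
  rewrite Cmod_sub_sym in K0.
  set (x := list_sum_C _ T) in *.
  replace (list_sum_C F S - l) with ((list_sum_C F S - x) + (x - l)) by ring.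
  eapply Rle_lt_trans; [apply Cmod_triangle | lra].
Qed.

(** A finite set of pairs lies in the rectangle of its projections, over which the sum factors. *)
Lemma bounded_sums_prod {I J : Type} (g : I -> R) (h : J -> R) :
  (forall i, 0 <= g i)%R -> (forall j, 0 <= h j)%R ->
  bounded_sums g -> bounded_sums h -> bounded_sums (fun p : I * J => g (fst p) * h (snd p))%R.
Proof.
  intros Hg Hh [M HM] [N HN]; exists (M * N)%R; intros S HS.
  set (S1 := nodup ceq_dec (map fst S)); set (S2 := nodup ceq_dec (map snd S)).
  assert (N1 : NoDup S1) by apply NoDup_nodup.
  assert (N2 : NoDup S2) by apply NoDup_nodup.
  assert (Hi : incl S (list_prod S1 S2)).
  { intros [i j] Hs; apply in_prod_iff; split; apply nodup_In;
      [apply (in_map fst) in Hs | apply (in_map snd) in Hs]; exact Hs. }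
  destruct (incl_split S _ HS (NoDup_list_prod _ _ N1 N2) Hi) as [T [NT [_ HP]]].
  apply Rle_trans with (rsum (fun p : I * J => g (fst p) * h (snd p))%R (list_prod S1 S2)).
  - rewrite (rsum_perm _ _ _ HP), rsum_app.
    generalize (rsum_nonneg (fun p : I * J => g (fst p) * h (snd p))%R T
      (fun p => Rmult_le_pos _ _ (Hg _) (Hh _))); lra.
  - rewrite rsum_prod; simpl.
    replace (rsum _ S1) with (rsum g S1 * rsum h S2)%R.
    + apply Rmult_le_compat; auto; apply rsum_nonneg; auto.
    + clear; induction S1 as [| i S' IH]; simpl; [ring |].
      rewrite <- IH, rsum_scal; ring.
Qed.

(** Absolute summability provides some joint sum; summing it by rows identifies its value. *)
Lemma has_sum_prod {I J : Type} (f : I -> C) (g : J -> C) (a b : C) :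
  summable f -> summable g -> has_sum f a -> has_sum g b ->
  has_sum (fun p : I * J => f (fst p) * g (snd p)) (a * b).
Proof.
  intros Sf Sg Hf Hg.
  destruct (summable_has_sum (fun p : I * J => f (fst p) * g (snd p))) as [l Hl].
  - apply (summable_le _ (fun p => Cmod (f (fst p)) * Cmod (g (snd p)))%R).
    + intros p; rewrite Cmod_mult; lra.
    + apply (bounded_sums_prod (fun i => Cmod (f i)) (fun j => Cmod (g j)));
        auto using Cmod_ge_0.
  - replace (a * b) with l; auto.
    apply (has_sum_unique (fun i => f i * b)).
    + apply (has_sum_fubini _ _ _ Hl); intros i; simpl; now apply has_sum_scal.
    + replace (a * b) with (b * a) by ring.
      apply (has_sum_ext (fun i => b * f i)); [intros; ring | now apply has_sum_scal].
Qed.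

Lemma list_sum_C_seq (f : nat -> C) (n : nat) : list_sum_C f (seq 0 (S n)) = sum_n f n.
Proof.
  induction n as [| n IH].
  - rewrite sum_O; simpl; ring.
  - rewrite seq_S, list_sum_C_app, IH, sum_Sn; simpl.
    unfold plus; simpl; ring.
Qed.

Lemma has_sum_Cconv (f : nat -> C) (l : C) : has_sum f l -> Cconv (sum_n f) l.
Proof.
  intros H; apply Cconv_eps; intros eps He; destruct (H eps He) as [S0 [N0 H0]].
  exists (list_max S0); intros n Hn; rewrite <- list_sum_C_seq; apply H0.
  - apply seq_NoDup.
  - intros i Hi; apply in_seq.
    generalize (proj1 (list_max_le S0 (list_max S0)) (Nat.le_refl _)).
    rewrite Forall_forall; intros K; specialize (K i Hi); lia.
Qed.

Lemma has_sum_is_series (f : nat -> C) (l : C) : has_sum f l -> is_series f l.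
Proof. intros H; apply sum_n_Cconv_is_series; now apply has_sum_Cconv. Qed.

Lemma bounded_sums_nat (g : nat -> R) (M : R) :
  (forall n, 0 <= g n)%R -> (forall n, sum_n g n <= M)%R -> bounded_sums g.
Proof.
  intros Hg HM; exists M; intros S HS.
  set (n := list_max S).
  assert (Hi : incl S (seq 0 (Datatypes.S n))).
  { intros i Hi; apply in_seq.
    generalize (proj1 (list_max_le S n) (Nat.le_refl _)).
    rewrite Forall_forall; intros K; specialize (K i Hi); lia. }
  destruct (incl_split S _ HS (seq_NoDup _ _) Hi) as [T [NT [_ HP]]].
  assert (E : rsum g (seq 0 (Datatypes.S n)) = sum_n g n).
  { clear; induction n as [| n IH].
    - rewrite sum_O; simpl; ring.
    - rewrite seq_S, rsum_app, IH, sum_Sn; simpl; unfold plus; simpl; ring. }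
  specialize (HM n); rewrite <- E, (rsum_perm _ _ _ HP), rsum_app in HM.
  generalize (rsum_nonneg g T Hg); lra.
Qed.

Lemma bounded_sums_ex_series (g : nat -> R) :
  (forall n, 0 <= g n)%R -> ex_series g -> bounded_sums g.
Proof.
  intros Hg [l Hl]; apply (bounded_sums_nat g l Hg); intros n.
  apply (is_lim_seq_incr_compare (sum_n g)); [exact Hl |].
  intros k; rewrite sum_Sn; unfold plus; simpl; specialize (Hg (S k)); lra.
Qed.

(** * Infinite products *)

(** Indexed from [0], unlike [partial_prod], to fit the exponents in [qp_factor]. *)
Fixpoint prodn (f : nat -> C) (n : nat) : C :=
  match n with
  | O => 1
  | S m => prodn f m * f m
  end.

Fixpoint rprodn (f : nat -> R) (n : nat) : R :=
  match n with
  | O => 1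
  | S m => (rprodn f m * f m)%R
  end.

Fixpoint rsumn (f : nat -> R) (n : nat) : R :=
  match n with
  | O => 0
  | S m => (rsumn f m + f m)%R
  end.

Lemma sum_n_rsumn (f : nat -> R) (n : nat) : sum_n f n = rsumn f (S n).
Proof.
  induction n as [| n IH].
  - rewrite sum_O; simpl; ring.
  - rewrite sum_Sn, IH; simpl; unfold plus; simpl; ring.
Qed.

Lemma rsumn_nonneg (f : nat -> R) n : (forall k, 0 <= f k)%R -> (0 <= rsumn f n)%R.
Proof. intros H; induction n as [| n IH]; simpl; [lra | specialize (H n); lra]. Qed.

Lemma rprodn_exp_le (f : nat -> R) n : (forall k, 0 <= f k)%R ->
  (1 <= rprodn (fun k => 1 + f k)%R n <= exp (rsumn f n))%R.
Proof.
  intros H; induction n as [| n IH]; simpl; [rewrite exp_0; lra |].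
  rewrite exp_plus; specialize (H n); generalize (exp_ineq1_le (f n)); intros.
  split; [nra |]; apply Rmult_le_compat; lra.
Qed.

Lemma Cmod_prodn (f : nat -> C) n : (Cmod (prodn f n) <= rprodn (fun k => Cmod (f k)) n)%R.
Proof.
  induction n as [| n IH]; simpl; [rewrite Cmod_1; lra |].
  rewrite Cmod_mult; apply Rmult_le_compat; auto using Cmod_ge_0; lra.
Qed.

Lemma rprodn_le (f g : nat -> R) n : (forall k, 0 <= f k <= g k)%R ->
  (0 <= rprodn f n <= rprodn g n)%R.
Proof.
  intros H; induction n as [| n IH]; simpl; [lra |].
  destruct (H n); split; [apply Rmult_le_pos; lra | apply Rmult_le_compat; lra].
Qed.

Lemma prodn_ext (f g : nat -> C) n : (forall k, f k = g k) -> prodn f n = prodn g n.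
Proof. intros H; induction n as [| n IH]; simpl; [auto | now rewrite IH, H]. Qed.

Lemma prodn_mult (f g : nat -> C) n : prodn (fun k => f k * g k) n = prodn f n * prodn g n.
Proof. induction n as [| n IH]; simpl; [ring | rewrite IH; ring]. Qed.

Lemma prodn_shift (f : nat -> C) n : prodn f (S n) = f O * prodn (fun k => f (S k)) n.
Proof.
  induction n as [| n IH]; [simpl; ring |].
  change (prodn f (S (S n))) with (prodn f (S n) * f (S n)); rewrite IH; simpl; ring.
Qed.

Lemma prodn_double (f : nat -> C) n :
  prodn f (2 * n) = prodn (fun k => f (2 * k)%nat) n * prodn (fun k => f (2 * k + 1)%nat) n.
Proof.
  induction n as [| n IH]; [simpl; ring |].
  replace (2 * S n)%nat with (S (S (2 * n))) by lia.
  change (prodn f (S (S (2 * n)))) with (prodn f (2 * n) * f (2 * n)%nat * f (S (2 * n))).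
  rewrite IH; cbn [prodn].
  replace (2 * n + 1)%nat with (S (2 * n)) by lia; ring.
Qed.

Lemma partial_prod_prodn (f : nat -> C) n : partial_prod f n = prodn (fun k => f (S k)) n.
Proof. induction n as [| n IH]; simpl; congruence. Qed.

Lemma prodn_neq_0 (f : nat -> C) n : (forall k, f k <> 0) -> prodn f n <> 0.
Proof.
  intros H; induction n as [| n IH]; simpl; [apply C1_nz | now apply Cmult_neq_0].
Qed.

Lemma one_minus_neq_0 (x : C) : x <> 1 -> 1 - x <> 0.
Proof. intros H E; apply H; replace x with (1 - (1 - x)) by ring; rewrite E; ring. Qed.

Section QPochhammer.
Variable p : C.
Hypothesis Hp : (Cmod p < 1)%R.

Definition qp_factor (x : C) (k : nat) : C := 1 - x * p ^ k.
Definition qp_partial (x : C) (n : nat) : C := prodn (qp_factor x) n.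
(** The infinite q-shifted factorial, usually written [(x; p)] with subscript infinity. *)
Definition qp (x : C) : C := Clim (qp_partial x).

Lemma rsumn_geom_le (n : nat) : (rsumn (fun k => Cmod p ^ k)%R n <= / (1 - Cmod p))%R.
Proof.
  assert (H : (rsumn (fun k => Cmod p ^ k)%R n * (1 - Cmod p) = 1 - Cmod p ^ n)%R).
  { induction n as [| n IH]; simpl; [ring |].
    rewrite Rmult_plus_distr_r, IH; ring. }
  apply Rmult_le_reg_r with (1 - Cmod p)%R; [lra |]; rewrite H, Rinv_l by lra.
  generalize (pow_le (Cmod p) n (Cmod_ge_0 p)); lra.
Qed.

Lemma rsumn_scal (c : R) (f : nat -> R) n : rsumn (fun k => c * f k)%R n = (c * rsumn f n)%R.
Proof. induction n as [| n IH]; simpl; [ring | rewrite IH; ring]. Qed.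

Definition qp_bound (r : R) : R := exp (r * / (1 - Cmod p)).

Lemma qp_bound_pos (r : R) : (0 < qp_bound r)%R.
Proof. apply exp_pos. Qed.

Lemma rprodn_qp_bound (r : R) n : (0 <= r)%R ->
  (rprodn (fun k => 1 + r * Cmod p ^ k)%R n <= qp_bound r)%R.
Proof.
  intros Hr.
  eapply Rle_trans; [apply rprodn_exp_le; intros; apply Rmult_le_pos; auto;
    apply pow_le, Cmod_ge_0 |].
  rewrite (rsumn_scal r (fun k => Cmod p ^ k)%R); unfold qp_bound.
  generalize (rsumn_geom_le n); intros H.
  destruct (Rle_lt_or_eq_dec (r * rsumn (fun k => Cmod p ^ k)%R n) (r * / (1 - Cmod p)))
    as [K | ->]; [now apply Rmult_le_compat_l | left; now apply exp_increasing | lra].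
Qed.

Lemma Cmod_qp_factor (x : C) (r : R) k : (Cmod x <= r)%R ->
  (Cmod (qp_factor x k) <= 1 + r * Cmod p ^ k)%R.
Proof.
  intros H; unfold qp_factor; eapply Rle_trans; [apply Cmod_sub_triangle |].
  rewrite Cmod_1, Cmod_mult, Cmod_pow.
  apply Rplus_le_compat_l, Rmult_le_compat_r; auto; apply pow_le, Cmod_ge_0.
Qed.

Lemma Cmod_qp_partial_rprodn (x : C) (r : R) n : (Cmod x <= r)%R ->
  (Cmod (qp_partial x n) <= rprodn (fun k => 1 + r * Cmod p ^ k)%R n)%R.
Proof.
  intros H; eapply Rle_trans; [apply Cmod_prodn |]; apply rprodn_le; intros k; split;
    [apply Cmod_ge_0 | now apply Cmod_qp_factor].
Qed.

Lemma Cmod_qp_partial (x : C) n : (Cmod (qp_partial x n) <= qp_bound (Cmod x))%R.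
Proof.
  eapply Rle_trans; [apply Cmod_qp_partial_rprodn, Rle_refl |].
  apply rprodn_qp_bound, Cmod_ge_0.
Qed.

(** Replace [x] by [y] one factor at a time: each exchange costs [Cmod (x - y) * Cmod p ^ k] times a
    product bounded by [B]. The constant is uniform in [n], so it passes to [qp] and gives the
    continuity needed in the limit where [a] tends to [1]. *)
Lemma qp_partial_lipschitz (x y : C) (r : R) n : (Cmod x <= r)%R -> (Cmod y <= r)%R ->
  (Cmod (qp_partial x n - qp_partial y n) <= Cmod (x - y) * (qp_bound r / (1 - Cmod p)))%R.
Proof.
  intros Hx Hy.
  assert (Hr : (0 <= r)%R) by (eapply Rle_trans; [apply Cmod_ge_0 | exact Hx]).
  set (B := rprodn (fun k => 1 + r * Cmod p ^ k)%R).
  assert (HB : forall n, (1 <= B n)%R).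
  { intros m; apply (rprodn_exp_le (fun k => r * Cmod p ^ k)%R).
    intros; apply Rmult_le_pos; auto; apply pow_le, Cmod_ge_0. }
  assert (H : (Cmod (qp_partial x n - qp_partial y n) <=
    Cmod (x - y) * (rsumn (fun k => Cmod p ^ k)%R n * B n))%R).
  { induction n as [| n IH].
    - unfold qp_partial; cbn [prodn rsumn].
      replace (1 - 1) with (RtoC 0) by ring; rewrite Cmod_0.
      generalize (Cmod_ge_0 (x - y)); nra.
    - unfold qp_partial in *; simpl.
      replace (prodn (qp_factor x) n * qp_factor x n - prodn (qp_factor y) n * qp_factor y n)
        with ((prodn (qp_factor x) n - prodn (qp_factor y) n) * qp_factor x n
              + prodn (qp_factor y) n * ((y - x) * p ^ n)) by (unfold qp_factor; ring).
      eapply Rle_trans; [apply Cmod_triangle |].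
      rewrite !Cmod_mult, Cmod_pow, (Cmod_sub_sym y x).
      generalize (Cmod_qp_factor x r n Hx) (Cmod_qp_partial_rprodn y r n Hy)
        (pow_le (Cmod p) n (Cmod_ge_0 p)) (HB n) (Cmod_ge_0 (x - y)) (Cmod_ge_0 (qp_factor x n))
        (Cmod_ge_0 (prodn (qp_factor y) n)) (Cmod_ge_0 (prodn (qp_factor x) n - prodn (qp_factor y) n))
        (rsumn_nonneg (fun k => Cmod p ^ k)%R n (fun k => pow_le _ k (Cmod_ge_0 p))).
      unfold qp_partial; change (rprodn (fun k => 1 + r * Cmod p ^ k)%R n) with (B n).
      set (P := (Cmod p ^ n)%R) in *; set (d := Cmod (x - y)) in *.
      set (Sn := rsumn _ n) in *; set (b := B n) in *.
      set (u := Cmod (qp_factor x n)) in *; set (v := Cmod (prodn (qp_factor y) n)) in *.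
      set (w := Cmod (prodn _ n - _)) in *.
      intros.
      apply Rle_trans with (d * (Sn * b) * (1 + r * P) + b * (d * P))%R.
      + apply Rplus_le_compat.
        * apply Rmult_le_compat; auto.
        * apply Rmult_le_compat_r; auto; now apply Rmult_le_pos.
      + change (B (S n)) with (b * (1 + r * P))%R.
        assert (0 <= d * P * (b * (r * P)))%R; [| nra].
        repeat apply Rmult_le_pos; lra. }
  eapply Rle_trans; [exact H |]; apply Rmult_le_compat_l; [apply Cmod_ge_0 |].
  rewrite Rmult_comm; unfold Rdiv; apply Rmult_le_compat.
  - specialize (HB n); lra.
  - apply rsumn_nonneg; intros; apply pow_le, Cmod_ge_0.
  - now apply rprodn_qp_bound.
  - apply rsumn_geom_le.
Qed.

(** The differences of consecutive partial products form a series dominated by a geometric one. *)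
Lemma qp_Cconv (x : C) : Cconv (qp_partial x) (qp x).
Proof.
  assert (Hs : ex_series (fun n => qp_partial x (S n) - qp_partial x n)).
  { apply (ex_series_le (K := C_AbsRing) (V := C_CompleteNormedModule) _
      (fun n => qp_bound (Cmod x) * Cmod x * Cmod p ^ n)%R).
    - intros n; change (Cmod (qp_partial x (S n) - qp_partial x n) <=
        qp_bound (Cmod x) * Cmod x * Cmod p ^ n)%R.
      replace (_ - _) with (- (qp_partial x n * (x * p ^ n)))
        by (unfold qp_partial, qp_factor; simpl; unfold qp_factor; ring).
      rewrite Cmod_opp, !Cmod_mult, Cmod_pow, Rmult_assoc.
      apply Rmult_le_compat_r; [| apply Cmod_qp_partial].
      apply Rmult_le_pos; [apply Cmod_ge_0 | apply pow_le, Cmod_ge_0].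
    - apply (ex_series_scal_l (K := R_AbsRing) (V := R_NormedModule)), ex_series_geom.
      now rewrite Rabs_pos_eq; [| apply Cmod_ge_0]. }
  destruct Hs as [l Hl]; apply sum_n_Cconv_is_series in Hl.
  assert (K : Cconv (qp_partial x) (l + 1)).
  { apply (proj1 (Cconv_incr (qp_partial x) (l + 1))).
    apply (Cconv_ext (fun n => sum_n (fun n => qp_partial x (S n) - qp_partial x n) n + 1)).
    - intros n; induction n as [| n IH].
      + rewrite sum_O; unfold qp_partial; simpl; ring.
      + rewrite sum_Sn; change (@plus C_AbelianMonoid) with Cplus.
        transitivity (sum_n (fun n => qp_partial x (S n) - qp_partial x n) n + 1
          + (qp_partial x (S (S n)) - qp_partial x (S n))); [ring |].
        rewrite IH; ring.
    - apply Cconv_plus; [exact Hl | apply Cconv_const]. }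
  unfold qp; now rewrite (Cconv_Clim _ _ K).
Qed.

Lemma qp_unique (x l : C) : Cconv (qp_partial x) l -> qp x = l.
Proof. apply Cconv_Clim. Qed.

Lemma qp_lipschitz (x y : C) (r : R) : (Cmod x <= r)%R -> (Cmod y <= r)%R ->
  (Cmod (qp x - qp y) <= Cmod (x - y) * (qp_bound r / (1 - Cmod p)))%R.
Proof.
  intros Hx Hy; apply (Cconv_bound_le (fun n => qp_partial x n - qp_partial y n)).
  - apply Cconv_minus; apply qp_Cconv.
  - intros n; now apply qp_partial_lipschitz.
Qed.

Lemma Cconv_qp (u : nat -> C) (l : C) : Cconv u l -> Cconv (fun n => qp (u n)) (qp l).
Proof.
  intros H; apply Cconv_eps; intros eps He.
  set (K := (qp_bound (Cmod l + 1) / (1 - Cmod p))%R).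
  assert (HK : (0 < K)%R).
  { apply Rdiv_lt_0_compat; [apply qp_bound_pos | lra]. }
  destruct (proj1 (Cconv_eps u l) H (Rmin 1 (eps / K))%R) as [N HN].
  { apply Rmin_pos; [lra |]; now apply Rdiv_lt_0_compat. }
  exists N; intros n Hn; specialize (HN n Hn).
  assert (H1 := Rlt_le_trans _ _ _ HN (Rmin_l _ _)).
  assert (H2 := Rlt_le_trans _ _ _ HN (Rmin_r _ _)).
  eapply Rle_lt_trans; [apply (qp_lipschitz _ _ (Cmod l + 1)%R) |].
  - generalize (Cmod_triangle_inv (u n) l); lra.
  - lra.
  - fold K; apply (Rmult_lt_compat_r K) in H2; auto.
    now replace (eps / K * K)%R with eps in H2 by (field; lra).
Qed.

Lemma qp_0 : qp 0 = 1.
Proof.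
  apply qp_unique, (Cconv_ext (fun _ => 1)); [| apply Cconv_const].
  intros n; unfold qp_partial; induction n as [| n IH]; simpl; auto.
  rewrite <- IH; unfold qp_factor; ring.
Qed.

Lemma qp_shift (x : C) : qp x = (1 - x) * qp (x * p).
Proof.
  apply qp_unique, (proj1 (Cconv_incr _ _)).
  apply (Cconv_ext (fun n => (1 - x) * qp_partial (x * p) n)); [| apply Cconv_scal, qp_Cconv].
  intros n; unfold qp_partial; rewrite prodn_shift; f_equal; [unfold qp_factor; simpl; ring |].
  apply prodn_ext; intros k; unfold qp_factor; simpl; ring.
Qed.

Lemma qp_split (x : C) (n : nat) : qp x = qp_partial x n * qp (x * p ^ n).
Proof.
  induction n as [| n IH].
  - unfold qp_partial; simpl; replace (x * 1) with x by ring; ring.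
  - rewrite IH, qp_shift; unfold qp_partial; simpl.
    replace (x * p ^ n * p) with (x * (p * p ^ n)) by ring.
    unfold qp_factor at 3; ring.
Qed.

Lemma Cmod_pow_lim0 (x : C) : is_lim_seq (fun n => Cmod (x * p ^ n)) 0.
Proof.
  apply is_lim_seq_ext with (fun n => (Cmod x * Cmod p ^ n)%R).
  { intros n; now rewrite Cmod_mult, Cmod_pow. }
  generalize (is_lim_seq_mult' (fun _ => Cmod x) (fun n => (Cmod p ^ n)%R) (Cmod x) 0
    (is_lim_seq_const _)); rewrite Rmult_0_r; intros K; apply K.
  apply is_lim_seq_geom; now rewrite Rabs_pos_eq; [| apply Cmod_ge_0].
Qed.

Lemma Cconv_pow0 (x : C) : Cconv (fun n => x * p ^ n) 0.
Proof.
  unfold Cconv; apply is_lim_seq_ext with (fun n => Cmod (x * p ^ n)); [| apply Cmod_pow_lim0].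
  intros n; f_equal; ring.
Qed.

(** Split off [N] nonzero factors; what remains is [qp (x * p ^ N)], which by continuity is within
    [1] of [qp 0 = 1]. *)
Lemma qp_neq_0 (x : C) : (forall k, x * p ^ k <> 1) -> qp x <> 0.
Proof.
  intros H.
  destruct (proj1 (Cconv_eps _ _) (Cconv_qp _ _ (Cconv_pow0 x)) 1%R) as [N HN]; [lra |].
  specialize (HN N (Nat.le_refl N)); rewrite qp_0 in HN.
  rewrite (qp_split x N); apply Cmult_neq_0.
  - apply prodn_neq_0; intros k; now apply one_minus_neq_0.
  - intros K; rewrite K in HN; replace (0 - 1) with (- (1)) in HN by ring.
    rewrite Cmod_opp, Cmod_1 in HN; lra.
Qed.

Lemma qp_neq_0_small (x : C) : (Cmod x < 1)%R -> qp x <> 0.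
Proof.
  intros H; apply qp_neq_0; intros k K.
  assert (Cmod (x * p ^ k) < 1)%R; [| rewrite K, Cmod_1 in *; lra].
  rewrite Cmod_mult, Cmod_pow.
  assert (Cmod p ^ k <= 1)%R.
  { rewrite <- (pow1 k); apply pow_incr; split; [apply Cmod_ge_0 | lra]. }
  generalize (Cmod_ge_0 x) (pow_le (Cmod p) k (Cmod_ge_0 p)); nra.
Qed.

End QPochhammer.

Lemma Cmod_pow_lt_1 (p : C) (n : nat) : (Cmod p < 1)%R -> (0 < n)%nat -> (Cmod (p ^ n) < 1)%R.
Proof.
  intros Hp Hn; rewrite Cmod_pow; apply pow_lt_1_compat; [split; [apply Cmod_ge_0 | auto] | auto].
Qed.

(** Separates even and odd powers of [p]. Together with [qp_sqr] it is the source of all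
    distribution relations below. *)
Lemma qp_base_sqr (p x : C) : (Cmod p < 1)%R ->
  qp p x = qp (p ^ 2) x * qp (p ^ 2) (x * p).
Proof.
  intros Hp; assert (Hp2 : (Cmod (p ^ 2) < 1)%R) by (apply Cmod_pow_lt_1; auto).
  apply (Cconv_unique (fun n => qp_partial p x (2 * n))).
  - apply Cconv_eps; intros eps He.
    destruct (proj1 (Cconv_eps _ _) (qp_Cconv p Hp x) eps He) as [N HN].
    exists N; intros n Hn; apply HN; lia.
  - apply (Cconv_ext (fun n => qp_partial (p ^ 2) x n * qp_partial (p ^ 2) (x * p) n)).
    + intros n; unfold qp_partial; rewrite prodn_double; f_equal; apply prodn_ext; intros k;
        unfold qp_factor.
      * now rewrite Cpow_mult_r.
      * rewrite Cpow_add_r, Cpow_mult_r; simpl; ring.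
    + apply Cconv_mult; apply qp_Cconv; auto.
Qed.

Lemma qp_sqr (p x : C) : (Cmod p < 1)%R ->
  qp (p ^ 2) (x ^ 2) = qp p x * qp p (- x).
Proof.
  intros Hp; assert (Hp2 : (Cmod (p ^ 2) < 1)%R) by (apply Cmod_pow_lt_1; auto).
  apply qp_unique.
  apply (Cconv_ext (fun n => qp_partial p x n * qp_partial p (- x) n)).
  - intros n; unfold qp_partial; rewrite <- prodn_mult; apply prodn_ext; intros k.
    unfold qp_factor; rewrite <- Cpow_mult_r, Nat.mul_comm, Cpow_mult_r; simpl; ring.
  - apply Cconv_mult; now apply qp_Cconv.
Qed.

(** * The complex exponential *)

Lemma Cexp_plus (z w : C) : Cexp (z + w) = Cexp z * Cexp w.
Proof.
  destruct z as [a b], w as [c d]; unfold Cexp, Cplus, Cmult; simpl.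
  rewrite exp_plus, cos_plus, sin_plus; f_equal; ring.
Qed.

Lemma Cexp_0 : Cexp 0 = 1.
Proof. unfold Cexp, RtoC; simpl; rewrite exp_0, cos_0, sin_0; f_equal; ring. Qed.

Lemma Cmod_Cexp (z : C) : Cmod (Cexp z) = exp (Re z).
Proof.
  unfold Cexp, Cmod; simpl.
  match goal with |- sqrt ?x = _ => replace x with (exp (Re z) * exp (Re z))%R end.
  - apply sqrt_square; left; apply exp_pos.
  - generalize (sin2_cos2 (Im z)); unfold Rsqr; intros H.
    transitivity (exp (Re z) * exp (Re z) * (sin (Im z) * sin (Im z) + cos (Im z) * cos (Im z)))%R;
      [rewrite H |]; ring.
Qed.

Lemma Cexp_neq_0 (z : C) : Cexp z <> 0.
Proof. apply Cmod_gt_0; rewrite Cmod_Cexp; apply exp_pos. Qed.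

Lemma Cexp_opp (z : C) : Cexp (- z) = / Cexp z.
Proof.
  assert (H : Cexp z * Cexp (- z) = 1)
    by (rewrite <- Cexp_plus, <- Cexp_0; f_equal; ring).
  replace (Cexp (- z)) with (Cexp z * Cexp (- z) / Cexp z) by (field; apply Cexp_neq_0).
  rewrite H; field; apply Cexp_neq_0.
Qed.

Lemma Cexp_minus (z w : C) : Cexp (z - w) = Cexp z / Cexp w.
Proof. unfold Cminus; now rewrite Cexp_plus, Cexp_opp. Qed.

Lemma Cexp_nat (z : C) (n : nat) : Cexp (INR n * z) = Cexp z ^ n.
Proof.
  induction n as [| n IH].
  - simpl; replace (0 * z) with (RtoC 0) by ring; apply Cexp_0.
  - rewrite S_INR, RtoC_plus, Cpow_S, <- IH, <- Cexp_plus; f_equal; ring.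
Qed.

Lemma Cexp_2PI : Cexp (2 * PI * Ci) = 1.
Proof.
  unfold Cexp, RtoC, Ci, Cmult; simpl.
  replace (_ - _)%R with 0%R by ring; rewrite exp_0.
  replace (_ + _)%R with (2 * PI)%R by ring; rewrite cos_2PI, sin_2PI; f_equal; ring.
Qed.

Lemma Cexp_PI : Cexp (PI * Ci) = - (1).
Proof.
  unfold Cexp, RtoC, Ci, Cmult, Copp; simpl.
  replace (_ - _)%R with 0%R by ring; rewrite exp_0.
  replace (_ + _)%R with PI by ring; rewrite cos_PI, sin_PI; f_equal; ring.
Qed.

Lemma Cexp_PI_half : Cexp (PI * Ci / 2) = Ci.
Proof.
  replace (PI * Ci / 2) with ((PI / 2)%R * Ci) by (rewrite RtoC_div by lra; field).
  unfold Cexp, RtoC, Ci, Cmult; simpl.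
  replace (_ - _)%R with 0%R by ring; rewrite exp_0.
  replace (_ + _)%R with (PI / 2)%R by ring; rewrite cos_PI2, sin_PI2; f_equal; ring.
Qed.

Lemma Cexp_2PI_Z (m : Z) (z : C) : Cexp (z + IZR m * (2 * PI * Ci)) = Cexp z.
Proof.
  rewrite Cexp_plus.
  assert (H : forall n, Cexp (INR n * (2 * PI * Ci)) = 1)
    by (intros n; rewrite Cexp_nat, Cexp_2PI; apply Cpow_1_l).
  assert (K : Cexp (IZR m * (2 * PI * Ci)) = 1); [| rewrite K; ring].
  destruct (Z_le_gt_dec 0 m) as [Hm | Hm].
  - rewrite <- (Z2Nat.id m Hm), <- INR_IZR_INZ; apply H.
  - replace (IZR m * (2 * PI * Ci)) with (- (INR (Z.to_nat (- m)) * (2 * PI * Ci))).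
    + rewrite Cexp_opp, H; field.
    + rewrite INR_IZR_INZ, Z2Nat.id by lia; rewrite opp_IZR, RtoC_opp; ring.
Qed.

Lemma is_lim_seq_diff_quotient (f : R -> R) (l : R) (t : nat -> R) :
  is_derive f 0 l -> (forall n, t n <> 0%R) -> is_lim_seq t 0 ->
  is_lim_seq (fun n => (f (t n) - f 0) / t n)%R l.
Proof.
  intros H Ht Hl; apply is_derive_Reals in H.
  apply is_lim_seq_spec; intros eps.
  destruct (H eps (cond_pos eps)) as [d Hd].
  apply is_lim_seq_spec in Hl; destruct (Hl d) as [N HN]; exists N; intros n Hn.
  specialize (Hd (t n) (Ht n)); rewrite Rplus_0_l in Hd; apply Hd.
  specialize (HN n Hn); now rewrite Rminus_0_r in HN.
Qed.

Lemma Cconv_components (u : nat -> C) (l : C) :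
  is_lim_seq (fun n => fst (u n)) (fst l) -> is_lim_seq (fun n => snd (u n)) (snd l) -> Cconv u l.
Proof.
  intros H1 H2.
  apply (Cconv_of_bound _ _ (fun n => Rabs (fst (u n) - fst l) + Rabs (snd (u n) - snd l))%R).
  - intros n; apply (Cmod_le_add (u n - l)).
  - replace 0%R with (0 + 0)%R by ring; apply is_lim_seq_plus'; apply (proj1 (is_lim_seq_abs_0 _)).
    + generalize (is_lim_seq_minus' _ _ _ _ H1 (is_lim_seq_const (fst l))).
      now rewrite Rminus_diag.
    + generalize (is_lim_seq_minus' _ _ _ _ H2 (is_lim_seq_const (snd l))).
      now rewrite Rminus_diag.
Qed.

Lemma Cdiv_R (z : C) (r : R) : r <> 0%R -> z / r = (fst z / r, snd z / r)%R.
Proof.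
  intros H; unfold Cdiv; rewrite <- RtoC_inv by auto.
  destruct z as [x y]; unfold Cmult, RtoC; simpl; f_equal; unfold Rdiv; ring.
Qed.

Lemma Cexp_R_mult (t a b : R) :
  Cexp (t * (a, b)) = (exp (t * a) * cos (t * b), exp (t * a) * sin (t * b))%R.
Proof. unfold Cexp, Cmult, RtoC; simpl; do 2 f_equal; f_equal; ring. Qed.

(** For a real parameter the complex derivative at [0] splits into two real derivatives, one for
    each component. *)
Lemma Cexp_diff_quotient (c : C) (t : nat -> R) :
  (forall n, t n <> 0%R) -> is_lim_seq t 0 ->
  Cconv (fun n => (Cexp (t n * c) - 1) / t n) c.
Proof.
  intros Ht Hl; destruct c as [a b].
  apply Cconv_components; cbn [fst snd].
  - apply is_lim_seq_ext with (fun n => ((fun x => exp (x * a) * cos (x * b))%R (t n)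
      - (fun x => exp (x * a) * cos (x * b))%R 0%R) / t n)%R.
    { intros n; rewrite Cdiv_R, Cexp_R_mult by auto; simpl.
      rewrite !Rmult_0_l, exp_0, cos_0; f_equal; ring. }
    apply (is_lim_seq_diff_quotient (fun x => exp (x * a) * cos (x * b))%R); auto.
    auto_derive; auto; rewrite !Rmult_0_l, exp_0, cos_0, sin_0; ring.
  - apply is_lim_seq_ext with (fun n => ((fun x => exp (x * a) * sin (x * b))%R (t n)
      - (fun x => exp (x * a) * sin (x * b))%R 0%R) / t n)%R.
    { intros n; rewrite Cdiv_R, Cexp_R_mult by auto; simpl.
      rewrite !Rmult_0_l, exp_0, sin_0; f_equal; ring. }
    apply (is_lim_seq_diff_quotient (fun x => exp (x * a) * sin (x * b))%R); auto.
    auto_derive; auto; rewrite !Rmult_0_l, exp_0, cos_0, sin_0; ring.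
Qed.

Lemma is_lim_seq_inv_S : is_lim_seq (fun n => / (INR n + 1))%R 0.
Proof.
  apply is_lim_seq_ext with (fun n => / INR (S n))%R; [intros; now rewrite S_INR |].
  apply (proj1 (is_lim_seq_incr_1 (fun n => / INR n)%R 0)).
  exact (is_lim_seq_inv _ _ is_lim_seq_INR ltac:(discriminate)).
Qed.

Lemma Cconv_Cexp (c : C) (t : nat -> R) :
  (forall n, t n <> 0%R) -> is_lim_seq t 0 -> Cconv (fun n => Cexp (t n * c)) 1.
Proof.
  intros Ht Hl.
  assert (Htc : Cconv (fun n => RtoC (t n)) 0).
  { unfold Cconv; apply is_lim_seq_ext with (fun n => Rabs (t n)).
    - intros n; replace (t n - 0) with (RtoC (t n)) by ring; now rewrite Cmod_R.
    - now apply (proj1 (is_lim_seq_abs_0 _)). }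
  replace (RtoC 1) with (0 * c + 1) by ring.
  apply (Cconv_ext (fun n => t n * ((Cexp (t n * c) - 1) / t n) + 1)).
  - intros n; field; intros K; apply (Ht n); now apply RtoC_inj.
  - apply Cconv_plus; [| apply Cconv_const].
    apply Cconv_mult; auto; now apply Cexp_diff_quotient.
Qed.

(** * Theta series *)

Definition tsum {I : Type} (f : I -> C) : C := @iota C_CompleteNormedModule (has_sum f).

Lemma tsum_eq {I : Type} (f : I -> C) (l : C) : has_sum f l -> tsum f = l.
Proof.
  intros H; apply (iota_unique (V := C_CompleteNormedModule)); auto.
  intros y Hy; now apply (has_sum_unique f).
Qed.

Lemma has_sum_tsum {I : Type} (f : I -> C) : summable f -> has_sum f (tsum f).
Proof. intros H; destruct (summable_has_sum f H) as [l Hl]; now rewrite (tsum_eq f l). Qed.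

Lemma has_sum_single {I : Type} (f : I -> C) (i0 : I) :
  (forall i, i <> i0 -> f i = 0) -> has_sum f (f i0).
Proof.
  intros H eps He; exists (i0 :: nil); split; [constructor; auto; constructor |].
  intros S HS Hi.
  destruct (incl_split (i0 :: nil) S) as [T [NT [HT HP]]]; auto;
    [constructor; auto; constructor |].
  rewrite (list_sum_C_perm f _ _ HP); simpl.
  replace (list_sum_C f T) with (RtoC 0).
  - replace (_ - _) with (RtoC 0) by ring; now rewrite Cmod_0.
  - assert (K : forall i, In i T -> f i = 0).
    { intros i Hi'; apply H; intros ->; apply HT in Hi'; simpl in Hi'; tauto. }
    clear - K; induction T as [| i T IH]; simpl; auto.
    rewrite K, <- IH; [ring | intros; apply K; now right | now left].
Qed.

Lemma Cconv_bounded (u : nat -> C) (l : C) :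
  Cconv u l -> exists M, (0 < M)%R /\ forall n, (Cmod (u n) <= M)%R.
Proof.
  intros H; destruct (proj1 (Cconv_eps u l) H 1%R) as [N HN]; [lra |].
  exists (rsumn (fun n => Cmod (u n)) N + (Cmod l + 1))%R.
  assert (H0 := rsumn_nonneg (fun n => Cmod (u n)) N (fun n => Cmod_ge_0 _)).
  generalize (Cmod_ge_0 l); intros Hl; split; [lra |]; intros n.
  destruct (Nat.le_gt_cases N n) as [Hn | Hn].
  - generalize (HN n Hn) (Cmod_triangle_inv (u n) l); lra.
  - assert (Cmod (u n) <= rsumn (fun n => Cmod (u n)) N)%R; [| lra].
    clear - Hn; induction N as [| N IH]; [lia |]; simpl.
    generalize (rsumn_nonneg (fun n => Cmod (u n)) N (fun n => Cmod_ge_0 _)) (Cmod_ge_0 (u N)).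
    destruct (Nat.eq_dec n N) as [-> | Hne]; [lra |].
    intros; apply Rle_trans with (rsumn (fun n => Cmod (u n)) N); [apply IH; lia | lra].
Qed.

Definition Z_to_nat_sum (z : Z) : nat + nat :=
  if Z_le_gt_dec 0 z then inl (Z.to_nat z) else inr (Z.to_nat (- z - 1)).

Definition nat_sum_to_Z (s : nat + nat) : Z :=
  match s with
  | inl n => Z.of_nat n
  | inr n => (- Z.of_nat n - 1)%Z
  end.

Lemma Z_to_nat_sum_K z : nat_sum_to_Z (Z_to_nat_sum z) = z.
Proof. unfold Z_to_nat_sum; destruct (Z_le_gt_dec 0 z); simpl; lia. Qed.

Lemma nat_sum_to_Z_K s : Z_to_nat_sum (nat_sum_to_Z s) = s.
Proof.
  unfold Z_to_nat_sum; destruct s as [n | n]; simpl.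
  - destruct (Z_le_gt_dec 0 (Z.of_nat n)); f_equal; lia.
  - destruct (Z_le_gt_dec 0 (- Z.of_nat n - 1)); f_equal; lia.
Qed.

Lemma bounded_sums_Z (g : Z -> R) :
  bounded_sums (fun n => g (Z.of_nat n)) -> bounded_sums (fun n => g (- Z.of_nat n - 1)%Z) ->
  bounded_sums g.
Proof.
  intros H1 H2.
  apply (bounded_sums_le g (fun z => g (nat_sum_to_Z (Z_to_nat_sum z)))).
  - intros z; rewrite Z_to_nat_sum_K; lra.
  - apply (bounded_sums_inj Z_to_nat_sum (fun s => g (nat_sum_to_Z s))).
    + intros x y E; now rewrite <- (Z_to_nat_sum_K x), E, Z_to_nat_sum_K.
    + now apply bounded_sums_sum.
Qed.

Lemma has_sum_Z (f : Z -> C) (a b : C) :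
  has_sum (fun n => f (Z.of_nat n)) a -> has_sum (fun n => f (- Z.of_nat n - 1)%Z) b ->
  has_sum f (a + b).
Proof.
  intros Ha Hb.
  apply (has_sum_ext (fun z => f (nat_sum_to_Z (Z_to_nat_sum z)))).
  - intros z; now rewrite Z_to_nat_sum_K.
  - apply (has_sum_reindex Z_to_nat_sum nat_sum_to_Z (fun s => f (nat_sum_to_Z s)));
      auto using Z_to_nat_sum_K, nat_sum_to_Z_K.
    now apply has_sum_sum.
Qed.

Lemma bounded_sums_geom (r : R) : (0 <= r < 1)%R -> bounded_sums (fun n => r ^ n)%R.
Proof.
  intros Hr; apply bounded_sums_ex_series; [intros; now apply pow_le |].
  apply ex_series_geom; rewrite Rabs_pos_eq; lra.
Qed.

Lemma exp_le (x y : R) : (x <= y -> exp x <= exp y)%R.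
Proof. intros [H | ->]; [left; now apply exp_increasing | lra]. Qed.

Lemma exp_neg_INR n : exp (- INR n) = (exp (-1) ^ n)%R.
Proof.
  induction n as [| n IH]; [simpl; now rewrite Ropp_0, exp_0 |].
  rewrite S_INR; simpl; rewrite <- IH, <- exp_plus; f_equal; ring.
Qed.

Lemma bounded_sums_exp_abs : bounded_sums (fun n : Z => exp (- Rabs (IZR n))).
Proof.
  assert (H : bounded_sums (fun n => exp (-1) ^ n)%R).
  { apply bounded_sums_geom; split; [left; apply exp_pos |].
    rewrite <- exp_0; apply exp_increasing; lra. }
  apply bounded_sums_Z; refine (bounded_sums_le _ _ _ H); intros n; rewrite <- exp_neg_INR;
    apply exp_le; rewrite INR_IZR_INZ.
  - rewrite Rabs_pos_eq; [lra | apply IZR_le; lia].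
  - rewrite minus_IZR, opp_IZR, Rabs_left1; [lra |].
    assert (0 <= IZR (Z.of_nat n))%R by (apply IZR_le; lia); lra.
Qed.

Definition gauss_term (T z : C) (n : Z) : C := Cexp (IZR n * IZR n * T + IZR n * z).

Lemma Re_gauss (T z : C) (n : Z) :
  Re (IZR n * IZR n * T + IZR n * z) = (IZR n * IZR n * Re T + IZR n * Re z)%R.
Proof. destruct T, z; unfold Re, Cmult, Cplus, RtoC; simpl; ring. Qed.

Lemma gauss_summable (T z : C) : (Re T < 0)%R -> summable (gauss_term T z).
Proof.
  intros HT.
  set (B := (Rabs (Re z) + 1)%R).
  (* The first exponent is the maximum over real [y] of [Re T * y ^ 2 + B * y]; the summand [1] in
     [B] leaves the decay [exp (- Rabs n)]. *)
  apply (summable_le _ (fun n => exp (B * B / (- 4 * Re T)) * exp (- Rabs (IZR n)))%R).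
  - intros n; unfold gauss_term; rewrite Cmod_Cexp, <- exp_plus, Re_gauss; apply exp_le.
    set (t := Re T) in *; set (x := IZR n).
    assert (Hx : (x * Re z <= Rabs x * Rabs (Re z))%R)
      by (rewrite <- Rabs_mult; apply Rle_abs).
    assert (Hx2 : (x * x = Rabs x * Rabs x)%R) by (rewrite <- Rabs_mult, Rabs_pos_eq; nra).
    rewrite Hx2; set (y := Rabs x) in *.
    assert (K : (B * B / (- 4 * t) = - t * (y - B / (- 2 * t)) ^ 2 - t * (- y * y) + B * y)%R)
      by (field; lra).
    assert (0 <= - t * (y - B / (- 2 * t)) ^ 2)%R by (apply Rmult_le_pos; [lra | apply pow2_ge_0]).
    rewrite K; unfold B in *; nra.
  - apply bounded_sums_scal; [left; apply exp_pos | apply bounded_sums_exp_abs].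
Qed.

Section Theta.
Variable T : C.
Hypothesis HT : (Re T < 0)%R.

Definition gauss_sum (z : C) : C := tsum (gauss_term T z).
(** Its exponents are [(n ^ 2 - n) * T + n * z]: up to an elementary factor, the companion of
    [gauss_sum] over half-integers. *)
Definition gauss_sum_E (z : C) : C := gauss_sum (z - T).

(** The normalization of the triple product, [p ^ (n * (n - 1) / 2) * x ^ n] with [p = Cexp T] and
    [x = Cexp z]; [gauss_term] has the nome [p ^ 2] in place of [p]. *)
Definition theta_term (z : C) (n : Z) : C :=
  Cexp ((IZR n * IZR n - IZR n) / 2 * T + IZR n * z).
Definition theta_sum (z : C) : C := tsum (theta_term z).

Lemma gauss_sum_has_sum z : has_sum (gauss_term T z) (gauss_sum z).
Proof. apply has_sum_tsum; now apply gauss_summable. Qed.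

Lemma theta_summable z : summable (theta_term z).
Proof.
  replace (theta_term z) with (gauss_term (T / 2) (z - T / 2)).
  - apply gauss_summable.
    replace (Re (T / 2)) with (Re T / 2)%R; [lra |].
    rewrite Cdiv_R by lra; reflexivity.
  - apply functional_extensionality; intros n.
    unfold gauss_term, theta_term; f_equal; field.
Qed.

Lemma theta_sum_has_sum z : has_sum (theta_term z) (theta_sum z).
Proof. apply has_sum_tsum, theta_summable. Qed.

(** Pairs are sorted by the parity of the sum of their entries, which is [2 * j] on the left and
    [2 * j + 1] on the right. *)
Definition parity_split (s : (Z * Z) + (Z * Z)) : Z * Z :=
  match s with
  | inl (j, l) => (j + l, j - l)%Z
  | inr (j, l) => (j + l, j + 1 - l)%Z
  end.

Definition parity_join (p : Z * Z) : (Z * Z) + (Z * Z) :=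
  let j := ((fst p + snd p) / 2)%Z in
  if Z.even (fst p + snd p) then inl (j, fst p - j)%Z else inr (j, fst p - j)%Z.

Lemma parity_split_K p : parity_split (parity_join p) = p.
Proof.
  destruct p as [m n]; unfold parity_join, parity_split; simpl.
  generalize (Z_div_mod_eq_full (m + n) 2); rewrite Zmod_even.
  destruct (Z.even (m + n)); intros; f_equal; lia.
Qed.

Lemma parity_join_K s : parity_join (parity_split s) = s.
Proof.
  destruct s as [[j l] | [j l]]; unfold parity_join, parity_split; cbn [fst snd].
  - replace (j + l + (j - l))%Z with (j * 2)%Z by ring.
    rewrite Z.even_mul, Z.div_mul, Bool.orb_true_r by lia; do 2 f_equal; lia.
  - replace (j + l + (j + 1 - l))%Z with (1 + j * 2)%Z by ring.
    rewrite Z.even_add, Z.even_mul, Z.div_add, Bool.orb_true_r by lia.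
    change (1 / 2)%Z with 0%Z; cbn [Z.even Bool.eqb]; do 2 f_equal; lia.
Qed.

(** In the coordinates [j], [l] of [parity_split] the quadratic exponent is diagonal, so the double
    series separates into a series in [x + y] and one in [x - y], once for each parity. *)
Lemma theta_sum_mult x y :
  theta_sum x * theta_sum y =
  gauss_sum_E (x + y) * gauss_sum (x - y) + Cexp y * (gauss_sum (x + y) * gauss_sum_E (x - y)).
Proof.
  assert (H := has_sum_prod _ _ _ _ (theta_summable x) (theta_summable y)
    (theta_sum_has_sum x) (theta_sum_has_sum y)).
  apply (has_sum_reindex parity_split parity_join) in H;
    auto using parity_split_K, parity_join_K.
  apply (has_sum_unique _ _ _ H), has_sum_sum.
  - assert (K := has_sum_prod _ _ _ _ (gauss_summable T (x + y - T) HT)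
      (gauss_summable T (x - y) HT) (gauss_sum_has_sum (x + y - T)) (gauss_sum_has_sum (x - y))).
    revert K; apply has_sum_ext; intros [j l]; unfold gauss_term, theta_term; simpl.
    rewrite <- !Cexp_plus; f_equal; rewrite minus_IZR, plus_IZR, RtoC_minus, RtoC_plus; field.
  - assert (K := has_sum_prod _ _ _ _ (gauss_summable T (x + y) HT)
      (gauss_summable T (x - y - T) HT) (gauss_sum_has_sum (x + y)) (gauss_sum_has_sum (x - y - T))).
    apply (has_sum_scal (Cexp y)) in K.
    revert K; apply has_sum_ext; intros [j l]; unfold gauss_term, theta_term; simpl.
    rewrite <- !Cexp_plus; f_equal.
    rewrite minus_IZR, !plus_IZR, RtoC_minus, !RtoC_plus; field.
Qed.

(* By [theta_sum_mult], both sides are combinations of the two mixed products of [gauss_sum] and [gauss_sum_E] at [2 u] and [2 v]. *)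
Lemma theta_sum_three_term (i u v a : C) : Cexp i = - (1) ->
  theta_sum (u + a + i) * theta_sum (u - a + i) * theta_sum (v + i) ^ 2
  - theta_sum (v + a + i) * theta_sum (v - a + i) * theta_sum (u + i) ^ 2 =
  theta_sum (a + i) * theta_sum (- a + i) * Cexp u
    * theta_sum (u + v + i) * theta_sum (v - u + i).
Proof.
  intros Hi.
  assert (Hi2 : forall z, Cexp (z + 2 * i) = Cexp z).
  { intros z; replace (z + 2 * i) with (z + i + i) by ring; rewrite !Cexp_plus, Hi; ring. }
  assert (Per : forall z, gauss_sum (z + 2 * i) = gauss_sum z).
  { intros z; unfold gauss_sum; f_equal.
    apply functional_extensionality; intros n; unfold gauss_term.
    replace (IZR n * IZR n * T + IZR n * (z + 2 * i)) with
      (IZR n * IZR n * T + IZR n * z + IZR n * (2 * i)) by ring.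
    rewrite Cexp_plus.
    assert (H : forall k, Cexp (INR k * (2 * i)) = 1).
    { intros k; rewrite Cexp_nat; replace (2 * i) with (0 + 2 * i) by ring.
      rewrite Hi2, Cexp_0; apply Cpow_1_l. }
    replace (Cexp (IZR n * (2 * i))) with (RtoC 1); [ring |].
    destruct (Z_le_gt_dec 0 n) as [Hn | Hn].
    - rewrite <- (Z2Nat.id n Hn), <- INR_IZR_INZ; symmetry; apply H.
    - replace (IZR n * (2 * i)) with (- (INR (Z.to_nat (- n)) * (2 * i))).
      + rewrite Cexp_opp, H; field.
      + rewrite INR_IZR_INZ, Z2Nat.id by lia; rewrite opp_IZR, RtoC_opp; ring. }
  assert (PerE : forall z, gauss_sum_E (z + 2 * i) = gauss_sum_E z).
  { intros z; unfold gauss_sum_E; rewrite <- (Per (z - T)); f_equal; ring. }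
  (* Shifting both arguments by [i] moves the Gaussian sums by their period [2 * i] or not at all;
     only the factor [Cexp y] changes sign. *)
  assert (M : forall x y, theta_sum (x + i) * theta_sum (y + i) =
    gauss_sum_E (x + y) * gauss_sum (x - y) - Cexp y * (gauss_sum (x + y) * gauss_sum_E (x - y))).
  { intros x y; rewrite theta_sum_mult.
    replace (x + i + (y + i)) with (x + y + 2 * i) by ring.
    replace (x + i - (y + i)) with (x - y) by ring.
    rewrite Per, PerE, Cexp_plus, Hi; ring. }
  rewrite <- (Cmult_assoc _ (theta_sum (u + v + i))); cbn [Cpow]; rewrite !Cmult_1_r, !M.
  replace (u + a + (u - a)) with (u + u) by ring.
  replace (v + a + (v - a)) with (v + v) by ring.
  replace (u + a - (u - a)) with (a + a) by ring.
  replace (v + a - (v - a)) with (a + a) by ring.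
  replace (u + v + (v - u)) with (v + v) by ring.
  replace (u + v - (v - u)) with (u + u) by ring.
  replace (a + - a) with (RtoC 0) by ring.
  replace (a - - a) with (a + a) by ring.
  replace (u - u) with (RtoC 0) by ring; replace (v - v) with (RtoC 0) by ring.
  rewrite !Cexp_minus, Cexp_opp.
  field; split; apply Cexp_neq_0.
Qed.

End Theta.

(** * Jacobi's triple product *)

Section TripleProduct.
Variable T : C.
Hypothesis HT : (Re T < 0)%R.
Let p : C := Cexp T.

Lemma Cmod_Cexp_lt_1 : (Cmod p < 1)%R.
Proof. unfold p; rewrite Cmod_Cexp, <- exp_0; now apply exp_increasing. Qed.

Let Hp : (Cmod p < 1)%R := Cmod_Cexp_lt_1.

Lemma qp_factor_p_neq_0 k : qp_factor p p k <> 0.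
Proof.
  unfold qp_factor; intros K.
  assert (E : p ^ S k = 1) by (rewrite Cpow_S; replace (p * p ^ k) with (1 - (1 - p * p ^ k)) by ring; rewrite K; ring).
  assert (H := Cmod_pow_lt_1 p (S k) Hp (Nat.lt_0_succ k)); rewrite E, Cmod_1 in H; lra.
Qed.

Lemma qp_partial_p_neq_0 n : qp_partial p p n <> 0.
Proof. apply prodn_neq_0, qp_factor_p_neq_0. Qed.

Lemma qp_p_neq_0 : qp p p <> 0.
Proof. now apply qp_neq_0_small. Qed.

(* Zero at negative [k], so that the recursion [inv_qfact_pred] needs no boundary case. *)
Definition inv_qfact (k : Z) : C :=
  if Z_le_gt_dec 0 k then / qp_partial p p (Z.to_nat k) else 0.

Lemma inv_qfact_pred (k : Z) : inv_qfact (k - 1) = (1 - Cexp (IZR k * T)) * inv_qfact k.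
Proof.
  unfold inv_qfact.
  destruct (Z_le_gt_dec 0 (k - 1)) as [H1 | H1], (Z_le_gt_dec 0 k) as [H2 | H2]; try lia.
  - replace (Z.to_nat k) with (S (Z.to_nat (k - 1))) by lia.
    set (n := Z.to_nat (k - 1)); replace k with (Z.of_nat (S n)) by lia.
    rewrite <- INR_IZR_INZ, Cexp_nat; unfold qp_partial; cbn [prodn].
    fold (qp_partial p p n); unfold qp_factor; fold p; rewrite Cpow_S.
    field; split; [apply (qp_factor_p_neq_0 n) | apply qp_partial_p_neq_0].
  - replace k with 0%Z by lia; replace (IZR 0 * T) with (RtoC 0) by (simpl; ring).
    rewrite Cexp_0; ring.
  - ring.
Qed.

Lemma inv_qfact_bounded : exists M, (0 < M)%R /\ forall k, (Cmod (inv_qfact k) <= M)%R.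
Proof.
  destruct (Cconv_bounded _ _ (Cconv_inv _ _ qp_p_neq_0 (qp_Cconv p Hp p))) as [M [HM H]].
  exists M; split; auto; intros k; unfold inv_qfact.
  destruct (Z_le_gt_dec 0 k); auto; rewrite Cmod_0; lra.
Qed.

Lemma inv_qfact_Cconv (s n : Z) : (s = 1 \/ s = -1)%Z ->
  Cconv (fun N => inv_qfact (Z.of_nat N + s * n)) (/ qp p p).
Proof.
  intros Hs; apply Cconv_eps; intros eps He.
  destruct (proj1 (Cconv_eps _ _) (Cconv_inv _ _ qp_p_neq_0 (qp_Cconv p Hp p)) eps He) as [N HN].
  exists (N + Z.to_nat (Z.abs n))%nat; intros m Hm; unfold inv_qfact.
  destruct (Z_le_gt_dec 0 (Z.of_nat m + s * n)) as [H | H]; [apply HN |]; destruct Hs; subst s; lia.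
Qed.

(* Laurent coefficients of the finite triple product [triple_partial]. *)
Definition triple_term (z : C) (N : nat) (n : Z) : C :=
  qp_partial p p (2 * N) * inv_qfact (Z.of_nat N + -1 * n) * inv_qfact (Z.of_nat N + 1 * n)
  * theta_term T z n.

Definition triple_partial (z : C) (N : nat) : C :=
  qp_partial p (- Cexp z) N * qp_partial p (- (p / Cexp z)) N.

(** The two new factors [1 + e^z * p ^ N] and [1 + p ^ (N + 1) / e^z] multiply out to
    [1 + p ^ (2 * N + 1)] plus two monomials that shift the Laurent index. Written with [A] and [B],
    the powers of [p] with exponents [N - n + 1] and [N + n + 1], the recursion of the Gaussian
    binomials is a rational identity. *)
Lemma triple_term_step (z : C) (N : nat) (n : Z) :
  triple_term z (S N) n =
  (1 + p ^ (2 * N + 1)) * triple_term z N n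
  + (Cexp z * p ^ N * triple_term z N (n - 1)
     + p ^ S N / Cexp z * triple_term z N (n + 1)).
Proof.
  unfold triple_term.
  set (a := (Z.of_nat N + -1 * n + 1)%Z); set (b := (Z.of_nat N + 1 * n + 1)%Z).
  replace (Z.of_nat (S N) + -1 * n)%Z with a by lia.
  replace (Z.of_nat (S N) + 1 * n)%Z with b by lia.
  replace (Z.of_nat N + -1 * n)%Z with (a - 1)%Z by lia.
  replace (Z.of_nat N + 1 * n)%Z with (b - 1)%Z by lia.
  replace (Z.of_nat N + -1 * (n - 1))%Z with a by lia.
  replace (Z.of_nat N + 1 * (n - 1))%Z with (b - 1 - 1)%Z by lia.
  replace (Z.of_nat N + -1 * (n + 1))%Z with (a - 1 - 1)%Z by lia.
  replace (Z.of_nat N + 1 * (n + 1))%Z with b by lia.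
  rewrite !inv_qfact_pred.
  assert (Hth1 : Cexp z * p ^ N * theta_term T z (n - 1) =
    Cexp (IZR a * T) * theta_term T z n).
  { unfold theta_term, p; rewrite <- Cexp_nat, <- !Cexp_plus; f_equal; unfold a.
    rewrite INR_IZR_INZ, minus_IZR, !plus_IZR, mult_IZR.
    rewrite RtoC_minus, !RtoC_plus, RtoC_mult; field. }
  assert (Hth2 : p ^ S N / Cexp z * theta_term T z (n + 1) =
    Cexp (IZR b * T) * theta_term T z n).
  { unfold theta_term, p; rewrite <- Cexp_nat; unfold Cdiv; rewrite <- Cexp_opp.
    rewrite <- !Cexp_plus; f_equal; unfold b.
    rewrite S_INR, INR_IZR_INZ, !plus_IZR, mult_IZR.
    rewrite !RtoC_plus, RtoC_mult; field. }
  set (A := Cexp (IZR a * T)) in *; set (B := Cexp (IZR b * T)) in *.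
  assert (Ha : Cexp (IZR (a - 1) * T) = A / p).
  { unfold A, p; rewrite <- Cexp_minus; f_equal; rewrite minus_IZR, RtoC_minus; ring. }
  assert (Hb : Cexp (IZR (b - 1) * T) = B / p).
  { unfold B, p; rewrite <- Cexp_minus; f_equal; rewrite minus_IZR, RtoC_minus; ring. }
  assert (HAB : p ^ (2 * N + 2) = A * B).
  { unfold A, B, p; rewrite <- Cexp_nat, <- Cexp_plus; f_equal; unfold a, b.
    rewrite INR_IZR_INZ, Nat2Z.inj_add, Nat2Z.inj_mul.
    rewrite !plus_IZR, !mult_IZR; simpl; rewrite !RtoC_plus, !RtoC_mult; ring. }
  assert (Hp0 : p <> 0) by apply Cexp_neq_0.
  assert (HAB1 : p ^ (2 * N + 1) = A * B / p).
  { rewrite <- HAB; replace (2 * N + 2)%nat with (S (2 * N + 1)) by lia.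
    rewrite Cpow_S; field; auto. }
  rewrite Ha, Hb.
  replace (qp_partial p p (2 * S N)) with
    (qp_partial p p (2 * N) * (1 - A * B / p) * (1 - A * B)).
  2:{ replace (2 * S N)%nat with (S (S (2 * N))) by lia; unfold qp_partial; cbn [prodn].
      change (qp_factor p p (2 * N)) with (1 - p ^ S (2 * N)).
      change (qp_factor p p (S (2 * N))) with (1 - p ^ S (S (2 * N))).
      replace (S (2 * N)) with (2 * N + 1)%nat by lia.
      replace (S (2 * N + 1)) with (2 * N + 2)%nat by lia; now rewrite HAB1, HAB. }
  set (R := inv_qfact a); set (S' := inv_qfact b); set (Q := qp_partial p p (2 * N)).
  set (t := theta_term T z n) in *.
  rewrite HAB1.
  transitivity ((1 + A * B / p) * (Q * ((1 - A) * R) * ((1 - B) * S') * t) +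
    ((Q * R * ((1 - B / p) * ((1 - B) * S'))) * (Cexp z * p ^ N * theta_term T z (n - 1))
    + (Q * ((1 - A / p) * ((1 - A) * R)) * S') * (p ^ S N / Cexp z * theta_term T z (n + 1)))).
  - rewrite Hth1, Hth2; field; auto.
  - set (w1 := theta_term T z (n - 1)); set (w2 := theta_term T z (n + 1)).
    field; split; [auto | apply Cexp_neq_0].
Qed.

Lemma triple_term_has_sum (z : C) (N : nat) : has_sum (triple_term z N) (triple_partial z N).
Proof.
  induction N as [| N IH].
  - replace (triple_partial z 0) with (triple_term z 0 0%Z).
    + apply has_sum_single; intros n Hn; unfold triple_term, inv_qfact; simpl Z.of_nat.
      destruct (Z_le_gt_dec 0 (0 + -1 * n)), (Z_le_gt_dec 0 (0 + 1 * n)); try lia; ring.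
    + unfold triple_term, triple_partial, inv_qfact, theta_term, qp_partial; simpl.
      replace ((0 * 0 - 0) / 2 * T + 0 * z) with (RtoC 0) by field; rewrite Cexp_0.
      field; apply C1_nz.
  - apply (has_sum_ext (fun n => (1 + p ^ (2 * N + 1)) * triple_term z N n
      + (Cexp z * p ^ N * triple_term z N (n - 1)
        + p ^ S N / Cexp z * triple_term z N (n + 1)))).
    { intros n; now rewrite triple_term_step. }
    replace (triple_partial z (S N)) with
      ((1 + p ^ (2 * N + 1)) * triple_partial z N
      + (Cexp z * p ^ N * triple_partial z N + p ^ S N / Cexp z * triple_partial z N)).
    + apply has_sum_plus; [| apply has_sum_plus]; apply has_sum_scal; auto.
      * apply (has_sum_reindex (fun n => n - 1)%Z (fun n => n + 1)%Z); auto; intros; lia.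
      * apply (has_sum_reindex (fun n => n + 1)%Z (fun n => n - 1)%Z); auto; intros; lia.
    + unfold triple_partial, qp_partial; cbn [prodn].
      change (qp_factor p (- Cexp z) N) with (1 - - Cexp z * p ^ N).
      change (qp_factor p (- (p / Cexp z)) N) with (1 - - (p / Cexp z) * p ^ N).
      replace (2 * N + 1)%nat with (S (N + N)) by lia; rewrite !Cpow_S, Cpow_add_r.
      field; apply Cexp_neq_0.
Qed.

(** As [N] grows, the Gaussian binomial in [triple_term] tends to [1 / qp p p] for each fixed [n]
    and stays bounded by [K * M * M], so that the finite identity passes to the limit by
    [has_sum_tannery]. *)
Lemma triple_product (z : C) :
  theta_sum T z = qp p p * (qp p (- Cexp z) * qp p (- (p / Cexp z))).
Proof.
  destruct inv_qfact_bounded as [M [HM Hb]].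
  destruct (Cconv_bounded _ _ (qp_Cconv p Hp p)) as [K [HK HKb]].
  assert (H : Cconv (triple_partial z) (/ qp p p * theta_sum T z)).
  { apply (has_sum_tannery (triple_term z) (fun n => / qp p p * theta_term T z n)
      (fun n => (K * M * M) * Cmod (theta_term T z n))%R).
    - apply bounded_sums_scal; [| now apply theta_summable].
      repeat apply Rmult_le_pos; lra.
    - intros n i; unfold triple_term; rewrite !Cmod_mult.
      apply Rmult_le_compat_r; [apply Cmod_ge_0 |].
      repeat apply Rmult_le_compat; auto using Cmod_ge_0; rewrite <- Cmod_mult; apply Cmod_ge_0.
    - intros n; unfold triple_term.
      replace (/ qp p p * theta_term T z n) with
        (qp p p * / qp p p * / qp p p * theta_term T z n) by (field; apply qp_p_neq_0).
      apply Cconv_mult; [| apply Cconv_const].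
      apply Cconv_mult; [apply Cconv_mult |].
      + apply Cconv_eps; intros eps He.
        destruct (proj1 (Cconv_eps _ _) (qp_Cconv p Hp p) eps He) as [N HN].
        exists N; intros m Hm; apply HN; lia.
      + apply inv_qfact_Cconv; auto.
      + apply inv_qfact_Cconv; auto.
    - intros N; apply triple_term_has_sum.
    - now apply has_sum_scal, theta_sum_has_sum. }
  assert (H' : Cconv (triple_partial z) (qp p (- Cexp z) * qp p (- (p / Cexp z))))
    by (apply Cconv_mult; now apply qp_Cconv).
  rewrite <- (Cconv_unique _ _ _ H H'); field; apply qp_p_neq_0.
Qed.

End TripleProduct.

(** The multiplicative theta function without the factor [qp p p]; for nonzero [x] it vanishes at
    the integral powers of [p]. *)
Definition th (p x : C) : C := qp p x * qp p (p / x).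

(** A shift by [PI * Ci] removes the signs in the triple product and gives
    [theta_sum = qp p p * th]. Every term of the relation has four theta factors, so [qp p p ^ 4]
    cancels. *)
Lemma th_three_term (T u v a : C) : (Re T < 0)%R ->
  let p := Cexp T in let U := Cexp u in let V := Cexp v in let A := Cexp a in
  th p (U * A) * th p (U / A) * th p V ^ 2 - th p (V * A) * th p (V / A) * th p U ^ 2 =
  th p A * th p (/ A) * U * th p (U * V) * th p (V / U).
Proof.
  intros HT p U V A.
  assert (H := theta_sum_three_term T HT (PI * Ci) u v a Cexp_PI).
  assert (K : forall z, theta_sum T (z + PI * Ci) = qp p p * th p (Cexp z)).
  { intros z; rewrite triple_product by auto; rewrite Cexp_plus, Cexp_PI; fold p; unfold th.
    replace (- (Cexp z * - (1))) with (Cexp z) by ring.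
    replace (- (p / (Cexp z * - (1)))) with (p / Cexp z); [ring |].
    field; repeat split; apply Cexp_neq_0 || (intros E; apply C1_nz; replace (RtoC 1) with (- - (1)) by ring; rewrite E; ring). }
  rewrite !K, !Cexp_plus, !Cexp_minus, ?Cexp_plus, Cexp_opp in H; fold U V A in H.
  assert (Hq : qp p p <> 0) by (apply qp_p_neq_0; auto).
  set (c := qp p p) in *.
  assert (Hc : c ^ 4 <> 0) by now apply Cpow_nz.
  match goal with |- ?l = ?r => assert (E : c ^ 4 * l = c ^ 4 * r) end.
  { match type of H with ?l = ?r => transitivity l; [ring | rewrite H; ring] end. }
  match goal with |- ?l = ?r => transitivity (c ^ 4 * l / c ^ 4); [now field | rewrite E; now field] end.
Qed.

(** * Differences of theta quotients *)

(** The Koebe function. Its invariance under [x -> 1 / x] merges the two halves of [th] into a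
    single two-sided sum. *)
Definition koebe (x : C) : C := x / (1 - x) ^ 2.

Fixpoint csumn (f : nat -> C) (n : nat) : C :=
  match n with
  | O => 0
  | S m => csumn f m + f m
  end.

Lemma sum_n_csumn (f : nat -> C) n : sum_n f n = csumn f (S n).
Proof.
  induction n as [| n IH].
  - rewrite sum_O; simpl; ring.
  - rewrite sum_Sn, IH; reflexivity.
Qed.

Lemma has_sum_csumn (f : nat -> C) l : has_sum f l -> Cconv (csumn f) l.
Proof.
  intros H; apply (proj1 (Cconv_incr _ _)), (Cconv_ext (sum_n f)).
  - apply sum_n_csumn.
  - now apply has_sum_Cconv.
Qed.

(** A first-order expansion with an error independent of [n]. The induction carries the bounds
    [2 * s] for the product minus [1] and [2 * s ^ 2] for the error; the hypothesis gives
    [2 * s <= 1], which closes the first. *)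
Lemma prodn_first_order (c : nat -> C) (e : C) (M : R) n :
  (forall n, rsumn (fun k => Cmod (c k)) n <= M)%R -> (Cmod e * M <= / 2)%R ->
  (Cmod (prodn (fun k => (1 - e * c k))%C n - 1 + e * csumn c n) <= 2 * (Cmod e * M) ^ 2)%R.
Proof.
  intros HM He.
  set (s := fun n => (Cmod e * rsumn (fun k => Cmod (c k)) n)%R).
  assert (Hs : forall n, (0 <= s n <= Cmod e * M)%R).
  { intros m; split; [apply Rmult_le_pos; [apply Cmod_ge_0 | apply rsumn_nonneg; intros; apply Cmod_ge_0]
      | apply Rmult_le_compat_l; [apply Cmod_ge_0 | auto]]. }
  assert (K : forall n, (Cmod (prodn (fun k => (1 - e * c k))%C n - 1) <= 2 * s n)%R /\
    (Cmod (prodn (fun k => (1 - e * c k))%C n - 1 + e * csumn c n) <= 2 * (s n) ^ 2)%R).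
  { clear n; induction n as [| n [IH1 IH2]]; cbn [prodn csumn].
    - replace (1 - 1) with (RtoC 0) by ring; replace (0 + e * 0) with (RtoC 0) by ring.
      rewrite Cmod_0; destruct (Hs O); split; nra.
    - set (P := prodn (fun k => (1 - e * c k)) n) in *.
      assert (Es : s (S n) = (s n + Cmod (e * c n))%R) by (unfold s; simpl; rewrite Cmod_mult; ring).
      destruct (Hs n) as [H0 H1]; generalize (Cmod_ge_0 (e * c n)); intros H2.
      destruct (Hs (S n)) as [H3 H4]; rewrite Es in *.
      set (d := Cmod (e * c n)) in *; split.
      + replace (P * (1 - e * c n) - 1) with ((P - 1) * (1 - e * c n) - e * c n) by ring.
        replace ((P - 1) * (1 - e * c n) - e * c n) with ((P - 1) - ((P - 1) * (e * c n) + e * c n)) by ring.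
        eapply Rle_trans; [apply Cmod_sub_triangle |].
        eapply Rle_trans; [apply Rplus_le_compat_l, Cmod_triangle |].
        rewrite (Cmod_mult (P - 1)); fold d; nra.
      + replace (P * (1 - e * c n) - 1 + e * (csumn c n + c n)) with
          ((P - 1 + e * csumn c n) - (P - 1) * (e * c n)) by ring.
        eapply Rle_trans; [apply Cmod_sub_triangle |].
        rewrite (Cmod_mult (P - 1)); fold d; nra. }
  eapply Rle_trans; [apply K |]; destruct (Hs n); nra.
Qed.

Section QPQuotient.
Variable p : C.
Hypothesis Hp : (Cmod p < 1)%R.

Lemma koebe_bound (u : C) : (forall k, u * p ^ k <> 1) ->
  exists M, (0 < M)%R /\ forall k, (Cmod (koebe (u * p ^ k)) <= M * Cmod p ^ k)%R.
Proof.
  intros Hu.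
  assert (H : Cconv (fun k => / (1 - u * p ^ k)) (/ (1 - 0))).
  { apply Cconv_inv; [replace (1 - 0) with (RtoC 1) by ring; apply C1_nz |].
    apply Cconv_minus; [apply Cconv_const | now apply Cconv_pow0]. }
  destruct (Cconv_bounded _ _ H) as [M [HM Hb]].
  exists ((Cmod u + 1) * M ^ 2)%R; split.
  { apply Rmult_lt_0_compat; [generalize (Cmod_ge_0 u); lra | now apply pow_lt]. }
  intros k; unfold koebe, Cdiv.
  assert (Hn : 1 - u * p ^ k <> 0) by now apply one_minus_neq_0.
  rewrite <- Cpow_inv by auto; rewrite !Cmod_mult, !Cmod_pow.
  specialize (Hb k).
  assert (Cmod (/ (1 - u * p ^ k)) ^ 2 <= M ^ 2)%R
    by (apply pow_incr; split; [apply Cmod_ge_0 | auto]).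
  generalize (pow_le (Cmod p) k (Cmod_ge_0 p)) (Cmod_ge_0 u); intros.
  assert (0 <= M ^ 2)%R by apply pow2_ge_0.
  apply Rle_trans with (Cmod u * Cmod p ^ k * M ^ 2)%R.
  - apply Rmult_le_compat_l; auto; now apply Rmult_le_pos.
  - assert (0 <= Cmod p ^ k * M ^ 2)%R by now apply Rmult_le_pos.
    nra.
Qed.

Lemma koebe_summable (u : C) : (forall k, u * p ^ k <> 1) -> summable (fun k => koebe (u * p ^ k)).
Proof.
  intros Hu; destruct (koebe_bound u Hu) as [M [HM Hb]].
  apply (summable_le _ _ Hb), bounded_sums_scal; [lra |].
  apply bounded_sums_geom; split; [apply Cmod_ge_0 | auto].
Qed.

(** The constant is chosen before [a], so the estimate is uniform as [a] tends to [1]; the same [M]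
    limits the admissible [e] and bounds the quadratic error. *)
Lemma qp_perturb (u s : C) : (forall k, u * p ^ k <> 1) ->
  has_sum (fun k => koebe (u * p ^ k)) s ->
  exists M, (0 < M)%R /\ forall a : C, a <> 0 -> let e := a + / a - 2 in
   (Cmod e * M <= / 2)%R ->
   (Cmod (qp p (u * a) * qp p (u / a) - qp p u ^ 2 * (1 - e * s)) <= M * Cmod e ^ 2)%R.
Proof.
  intros Hu Hs.
  destruct (koebe_bound u Hu) as [M0 [HM0 Hb]].
  set (M1 := (M0 * / (1 - Cmod p))%R).
  assert (HM1 : (0 < M1)%R) by (apply Rmult_lt_0_compat; auto; apply Rinv_0_lt_compat; lra).
  assert (Hsum : forall n, (rsumn (fun k => Cmod (koebe (u * p ^ k))) n <= M1)%R).
  { intros n; apply Rle_trans with (rsumn (fun k => M0 * Cmod p ^ k)%R n).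
    - induction n as [| n IH]; simpl; [lra | specialize (Hb n); lra].
    - rewrite (rsumn_scal M0 (fun k => Cmod p ^ k)%R); apply Rmult_le_compat_l; [lra |].
      now apply rsumn_geom_le. }
  set (B := qp_bound p (Cmod u)).
  assert (HB : (0 < B)%R) by apply qp_bound_pos.
  set (M := (M1 + B ^ 2 * (2 * M1 ^ 2))%R).
  assert (HM : (0 <= B ^ 2 * (2 * M1 ^ 2))%R)
    by (apply Rmult_le_pos; [apply pow2_ge_0 | generalize (pow2_ge_0 M1); lra]).
  exists M; split; [unfold M; lra |]; intros a Ha e He.
  assert (He1 : (Cmod e * M1 <= / 2)%R).
  { eapply Rle_trans; [| exact He]; apply Rmult_le_compat_l; [apply Cmod_ge_0 | unfold M; lra]. }
  set (c := fun k => koebe (u * p ^ k)) in *.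
  assert (Hfac : forall k, 1 - u * p ^ k <> 0) by (intros k; now apply one_minus_neq_0).
  apply (Cconv_bound_le (fun n => qp_partial p (u * a) n * qp_partial p (u / a) n
    - qp_partial p u n ^ 2 * (1 - e * csumn c n))).
  - apply Cconv_minus.
    + apply Cconv_mult; now apply qp_Cconv.
    + apply Cconv_mult; [apply Cconv_pow; now apply qp_Cconv |].
      apply Cconv_minus; [apply Cconv_const | apply Cconv_scal; now apply has_sum_csumn].
  - intros n.
    assert (E : qp_partial p (u * a) n * qp_partial p (u / a) n =
      qp_partial p u n ^ 2 * prodn (fun k => 1 - e * c k) n).
    { simpl; rewrite Cmult_1_r; unfold qp_partial; rewrite <- !prodn_mult.
      apply prodn_ext; intros k; unfold qp_factor, c, koebe, e; field; auto. }
    rewrite E.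
    replace (_ - _) with (qp_partial p u n ^ 2 *
      (prodn (fun k => 1 - e * c k) n - 1 + e * csumn c n)) by ring.
    rewrite Cmod_mult, Cmod_pow.
    apply Rle_trans with (B ^ 2 * (2 * (Cmod e * M1) ^ 2))%R.
    + apply Rmult_le_compat; [apply pow_le, Cmod_ge_0 | apply Cmod_ge_0 | |].
      * apply pow_incr; split; [apply Cmod_ge_0 | now apply Cmod_qp_partial].
      * now apply prodn_first_order.
    + replace (B ^ 2 * (2 * (Cmod e * M1) ^ 2))%R with ((B ^ 2 * (2 * M1 ^ 2)) * Cmod e ^ 2)%R by ring.
      apply Rmult_le_compat_r; [apply pow2_ge_0 | unfold M; lra].
Qed.

Lemma qp_perturb_Cconv (u s : C) (a : nat -> C) : (forall k, u * p ^ k <> 1) ->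
  has_sum (fun k => koebe (u * p ^ k)) s ->
  (forall n, a n <> 0) -> (forall n, a n + / a n - 2 <> 0) -> Cconv (fun n => a n + / a n - 2) 0 ->
  Cconv (fun n => (qp p (u * a n) * qp p (u / a n) - qp p u ^ 2) / (a n + / a n - 2))
    (- (qp p u ^ 2 * s)).
Proof.
  intros Hu Hs Ha He Hc.
  destruct (qp_perturb u s Hu Hs) as [M [HM H]].
  apply Cconv_eps; intros eps Heps.
  destruct (proj1 (Cconv_eps _ _) Hc (Rmin (/ (2 * M)) (eps / M))%R) as [N HN].
  { apply Rmin_pos; [apply Rinv_0_lt_compat; lra | now apply Rdiv_lt_0_compat]. }
  exists N; intros n Hn; specialize (HN n Hn).
  replace (a n + / a n - 2 - 0) with (a n + / a n - 2) in HN by ring.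
  specialize (H (a n) (Ha n)); specialize (He n); cbv zeta in H.
  set (e := a n + / a n - 2) in *.
  assert (H1 := Rlt_le_trans _ _ _ HN (Rmin_l _ _)).
  assert (H2 := Rlt_le_trans _ _ _ HN (Rmin_r _ _)).
  assert (He0 : (0 < Cmod e)%R) by now apply Cmod_gt_0.
  assert (H3 : (Cmod e * M <= / 2)%R).
  { apply (Rmult_lt_compat_r M) in H1; auto.
    replace (/ (2 * M) * M)%R with (/ 2)%R in H1 by (field; lra); lra. }
  specialize (H H3).
  match goal with |- (Cmod ?x < _)%R =>
    replace x with ((qp p (u * a n) * qp p (u / a n) - qp p u ^ 2 * (1 - e * s)) / e)
      by (field; auto) end.
  rewrite Cmod_div by auto.
  apply Rle_lt_trans with (M * Cmod e ^ 2 / Cmod e)%R.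
  - apply Rmult_le_compat_r; auto; left; now apply Rinv_0_lt_compat.
  - replace (M * Cmod e ^ 2 / Cmod e)%R with (Cmod e * M)%R by (field; lra).
    apply (Rmult_lt_compat_r M) in H2; auto.
    now replace (eps / M * M)%R with eps in H2 by (field; lra).
Qed.

(** A product rule for the two halves of [th]. In the second half [a] and [1 / a] exchange places,
    under which [a + 1 / a - 2] is symmetric. *)
Lemma th_perturb_Cconv (u s s' : C) (a : nat -> C) : u <> 0 ->
  (forall k, u * p ^ k <> 1) -> (forall k, p / u * p ^ k <> 1) ->
  has_sum (fun k => koebe (u * p ^ k)) s -> has_sum (fun k => koebe (p / u * p ^ k)) s' ->
  (forall n, a n <> 0) -> (forall n, a n + / a n - 2 <> 0) -> Cconv a 1 ->
  Cconv (fun n => (th p (u * a n) * th p (u / a n) - th p u ^ 2) / (a n + / a n - 2))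
    (- (th p u ^ 2 * (s + s'))).
Proof.
  intros Hu0 Hu Hu' Hs Hs' Ha He Hc.
  assert (Hi : Cconv (fun n => / a n) 1).
  { replace (RtoC 1) with (/ 1) by (field; apply C1_nz); apply Cconv_inv; [apply C1_nz | auto]. }
  assert (He0 : Cconv (fun n => a n + / a n - 2) 0).
  { replace (RtoC 0) with (1 + 1 - 2) by ring.
    apply Cconv_minus; [now apply Cconv_plus | apply Cconv_const]. }
  assert (H1 := qp_perturb_Cconv u s a Hu Hs Ha He He0).
  assert (H2 := qp_perturb_Cconv (p / u) s' a Hu' Hs' Ha He He0).
  assert (H3 : Cconv (fun n => qp p (u * a n) * qp p (u / a n)) (qp p (u * 1) * qp p (u * 1)))
    by (apply Cconv_mult; apply Cconv_qp; auto; now apply Cconv_scal).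
  replace (u * 1) with u in H3 by ring.
  replace (- (th p u ^ 2 * (s + s'))) with
    (qp p u * qp p u * - (qp p (p / u) ^ 2 * s') + qp p (p / u) ^ 2 * - (qp p u ^ 2 * s))
    by (unfold th; ring).
  eapply Cconv_ext; [| apply Cconv_plus; [apply Cconv_mult; [exact H3 | exact H2]
    | apply Cconv_mult; [apply Cconv_const | exact H1]]].
  intros n; cbv beta; unfold th.
  replace (p / (u * a n)) with (p / u / a n) by (field; auto).
  replace (p / (u / a n)) with (p / u * a n) by (field; auto).
  specialize (He n); set (e := a n + / a n - 2) in *.
  field; auto.
Qed.

End QPQuotient.

Lemma pow_Cexp_Z (U T : C) (n : nat) : Cexp U * Cexp T ^ n = Cexp (U + IZR (Z.of_nat n) * T).
Proof. rewrite <- Cexp_nat, <- Cexp_plus, INR_IZR_INZ; reflexivity. Qed.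

(** The factors of the half [qp p (p / u)] belong to the negative powers [u * p ^ (- n - 1)],
    inverted. *)
Lemma pow_Cexp_Z_neg (U T : C) (n : nat) :
  Cexp T / Cexp U * Cexp T ^ n = / Cexp (U + IZR (- Z.of_nat n - 1) * T).
Proof.
  rewrite <- Cexp_minus, <- Cexp_nat, <- Cexp_plus, <- Cexp_opp, INR_IZR_INZ; f_equal.
  rewrite minus_IZR, opp_IZR, RtoC_minus, RtoC_opp; ring.
Qed.

Lemma koebe_inv (x : C) : x <> 0 -> x <> 1 -> koebe (/ x) = koebe x.
Proof.
  intros H0 H1; unfold koebe; field; repeat split; auto.
  - now apply one_minus_neq_0.
  - intros E; apply H1; replace x with (1 + (x - 1)) by ring; rewrite E; ring.
Qed.

Lemma Cinv_eq_1 (x : C) : x <> 0 -> / x = 1 -> x = 1.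
Proof.
  intros Hx E; transitivity (/ / x); [field; auto | rewrite E; field; apply C1_nz].
Qed.

Lemma nome_powers_neq_1 (U T : C) : (forall n : Z, Cexp (U + IZR n * T) <> 1) ->
  (forall k, Cexp U * Cexp T ^ k <> 1) /\ (forall k, Cexp T / Cexp U * Cexp T ^ k <> 1).
Proof.
  intros H; split; intros k; [rewrite pow_Cexp_Z; apply H |].
  rewrite pow_Cexp_Z_neg; intros E; eapply H, Cinv_eq_1, E; apply Cexp_neq_0.
Qed.

Lemma th_neq_0 (U T : C) : (Re T < 0)%R -> (forall n : Z, Cexp (U + IZR n * T) <> 1) ->
  th (Cexp T) (Cexp U) <> 0.
Proof.
  intros HT H; assert (Hp := Cmod_Cexp_lt_1 T HT).
  apply Cmult_neq_0; apply qp_neq_0; auto; now apply nome_powers_neq_1.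
Qed.

Lemma koebe_Z_has_sum (U T : C) : (Re T < 0)%R -> (forall n : Z, Cexp (U + IZR n * T) <> 1) ->
  exists s s',
    has_sum (fun k => koebe (Cexp U * Cexp T ^ k)) s /\
    has_sum (fun k => koebe (Cexp T / Cexp U * Cexp T ^ k)) s' /\
    has_sum (fun n : Z => koebe (Cexp (U + IZR n * T))) (s + s').
Proof.
  intros HT H; assert (Hp := Cmod_Cexp_lt_1 T HT).
  destruct (summable_has_sum (fun k => koebe (Cexp U * Cexp T ^ k))) as [s Hs].
  { apply koebe_summable; auto; now apply nome_powers_neq_1. }
  destruct (summable_has_sum (fun k => koebe (Cexp T / Cexp U * Cexp T ^ k))) as [s' Hs'].
  { apply koebe_summable; auto; now apply nome_powers_neq_1. }
  exists s, s'; repeat split; auto; apply has_sum_Z.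
  - revert Hs; apply has_sum_ext; intros n; now rewrite pow_Cexp_Z.
  - revert Hs'; apply has_sum_ext; intros n; rewrite pow_Cexp_Z_neg.
    apply koebe_inv; [apply Cexp_neq_0 | apply H].
Qed.

(** Up to elementary factors, the sigma quotient [sigma (x + y) * sigma (y - x) / (sigma x ^ 2 *
    sigma y ^ 2)] in multiplicative coordinates. *)
Definition wp_kernel (p u v : C) : C :=
  u * th p (u * v) * th p (v / u) * qp p p ^ 4 / (th p u ^ 2 * th p v ^ 2).

(* Divide the three-term relation by [a + 1 / a - 2] and let [a] tend to [1]. *)
Lemma koebe_Z_diff (U V T : C) : (Re T < 0)%R ->
  (forall n : Z, Cexp (U + IZR n * T) <> 1) -> (forall n : Z, Cexp (V + IZR n * T) <> 1) ->
  has_sum (fun n : Z => koebe (Cexp (U + IZR n * T)) - koebe (Cexp (V + IZR n * T)))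
    (wp_kernel (Cexp T) (Cexp U) (Cexp V)).
Proof.
  intros HT HU HV; assert (Hp := Cmod_Cexp_lt_1 T HT).
  destruct (koebe_Z_has_sum U T HT HU) as [s1 [s2 [H1 [H2 H12]]]].
  destruct (koebe_Z_has_sum V T HT HV) as [s3 [s4 [H3 [H4 H34]]]].
  assert (HK : (s1 + s2) - (s3 + s4) = wp_kernel (Cexp T) (Cexp U) (Cexp V)).
  2:{ rewrite <- HK; now apply has_sum_minus. }
  set (t := fun n => (/ (INR n + 1))%R).
  assert (Ht : forall n, t n <> 0%R).
  { intros n; apply Rinv_neq_0_compat; generalize (pos_INR n); lra. }
  (* A real sequence greater than [1]: [a + 1 / a - 2 = (a - 1) ^ 2 / a] never vanishes along it. *)
  set (a := fun n => Cexp (t n * 1)).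
  assert (Ha0 : forall n, a n <> 0) by (intros; apply Cexp_neq_0).
  assert (Ha : Cconv a 1) by (apply Cconv_Cexp; auto; apply is_lim_seq_inv_S).
  assert (Ha1 : forall n, a n <> 1).
  { intros n E; assert (Hm : Cmod (a n) = 1%R) by (rewrite E; apply Cmod_1).
    unfold a in Hm; rewrite Cmod_Cexp in Hm.
    replace (Re (t n * 1)) with (t n) in Hm by (unfold Re, Cmult, RtoC; simpl; ring).
    rewrite <- exp_0 in Hm; apply exp_inv in Hm; now apply (Ht n). }
  assert (He : forall n, a n + / a n - 2 <> 0).
  { intros n E; apply (Ha1 n).
    assert (K : (a n - 1) * (a n - 1) = 0).
    { replace ((a n - 1) * (a n - 1)) with (a n * (a n + / a n - 2)) by (field; auto).
      rewrite E; ring. }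
    destruct (classic (a n - 1 = 0)) as [Z0 | Z0]; [| now destruct (Cmult_neq_0 _ _ Z0 Z0)].
    replace (a n) with (1 + (a n - 1)) by ring; rewrite Z0; ring. }
  set (p := Cexp T) in *; set (u := Cexp U) in *; set (v := Cexp V) in *.
  destruct (nome_powers_neq_1 U T HU) as [Huk Huk'], (nome_powers_neq_1 V T HV) as [Hvk Hvk'].
  fold p u v in Huk, Huk', Hvk, Hvk'.
  assert (Hu0 : u <> 0) by apply Cexp_neq_0.
  assert (Hv0 : v <> 0) by apply Cexp_neq_0.
  assert (L1 := th_perturb_Cconv p Hp u s1 s2 a Hu0 Huk Huk' H1 H2 Ha0 He Ha).
  assert (L2 := th_perturb_Cconv p Hp v s3 s4 a Hv0 Hvk Hvk' H3 H4 Ha0 He Ha).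
  assert (Lpa : Cconv (fun n => qp p (p * a n)) (qp p (p * 1)))
    by (apply Cconv_qp; auto; now apply Cconv_scal).
  assert (Lpi : Cconv (fun n => qp p (p / a n)) (qp p (p / 1)))
    by (apply Cconv_qp; auto; apply Cconv_div; auto using C1_nz, Cconv_const).
  replace (p * 1) with p in Lpa by ring; replace (p / 1) with p in Lpi by (field; apply C1_nz).
  assert (L : - (th p u ^ 2 * (s1 + s2)) * th p v ^ 2 - - (th p v ^ 2 * (s3 + s4)) * th p u ^ 2
    = - (qp p p * qp p p * (qp p p * qp p p)) * (u * th p (u * v) * th p (v / u))).
  { eapply Cconv_unique.
    - apply Cconv_minus; apply Cconv_mult; [exact L1 | apply Cconv_const | exact L2 | apply Cconv_const].
    - eapply Cconv_ext; [| apply Cconv_mult; [apply Cconv_opp, Cconv_mult; apply Cconv_mult;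
        [exact Lpa | exact Lpi | exact Lpa | exact Lpi] | apply Cconv_const]].
      intros n; cbv beta.
      assert (E := th_three_term T U V (t n * 1) HT); cbv zeta in E; fold p u v in E.
      change (Cexp (t n * 1)) with (a n) in E.
      specialize (He n); specialize (Ha0 n).
      (* The leading factors [(1 - a) * (1 - 1 / a)] are exactly [- (a + 1 / a - 2)], the quantity
         by which the relation is divided. *)
      assert (Eth : th p (a n) * th p (/ a n) =
        - (a n + / a n - 2) * (qp p (p * a n) * qp p (p / a n) * (qp p (p * a n) * qp p (p / a n)))).
      { unfold th; rewrite (qp_shift p Hp (a n)), (qp_shift p Hp (/ a n)).
        replace (p / / a n) with (p * a n) by (field; auto).
        replace (a n * p) with (p * a n) by ring.
        replace (/ a n * p) with (p / a n) by (field; auto).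
        field; auto. }
      rewrite Eth in E.
      transitivity ((- (a n + / a n - 2) * (qp p (p * a n) * qp p (p / a n) * (qp p (p * a n) * qp p (p / a n)))
        * u * th p (u * v) * th p (v / u)) / (a n + / a n - 2)).
      + set (e := a n + / a n - 2) in *; field; auto.
      + rewrite <- E; set (e := a n + / a n - 2) in *; field; auto. }
  assert (Ku : th p u <> 0) by now apply th_neq_0.
  assert (Kv : th p v <> 0) by now apply th_neq_0.
  unfold wp_kernel.
  transitivity (- (- (th p u ^ 2 * (s1 + s2)) * th p v ^ 2 - - (th p v ^ 2 * (s3 + s4)) * th p u ^ 2)
    / (th p u ^ 2 * th p v ^ 2)); [field; auto |].
  rewrite L; field; auto.
Qed.

(** * The lattice sum *)

(** The exponent [3/2] lets the cubic decay on the lattice be dominated by a product of two summable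
    sequences in one variable. *)
Definition pow32 (x : R) : R := (x * sqrt x)%R.

Lemma pow32_pos x : (0 < x -> 0 < pow32 x)%R.
Proof. intros H; apply Rmult_lt_0_compat; auto; now apply sqrt_lt_R0. Qed.

Lemma pow32_mono x y : (0 <= x <= y -> pow32 x <= pow32 y)%R.
Proof.
  intros [H1 H2]; apply Rmult_le_compat; auto; [apply sqrt_pos | now apply sqrt_le_1_alt].
Qed.

Lemma pow32_sqr x : (0 <= x -> pow32 x * pow32 x = x ^ 3)%R.
Proof.
  intros H; unfold pow32; replace (x * sqrt x * (x * sqrt x))%R with (x * x * (sqrt x * sqrt x))%R by ring.
  rewrite sqrt_sqrt by auto; ring.
Qed.

Lemma bounded_sums_pow32_nat : bounded_sums (fun n => / pow32 (INR n + 1))%R.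
Proof.
  apply (bounded_sums_nat _ 3).
  - intros n; left; apply Rinv_0_lt_compat, pow32_pos; generalize (pos_INR n); lra.
  (* A telescoping bound: [2 * (1 / sqrt k - 1 / sqrt (k + 1))] is at least [1 / pow32 (k + 1)]. At
     [n = 0] both sides are [1]. *)
  - assert (K : forall n, (sum_n (fun n => / pow32 (INR n + 1)) n <= 3 - 2 * / sqrt (INR n + 1))%R).
    2:{ intros n; specialize (K n); assert (0 < / sqrt (INR n + 1))%R; [| lra].
        apply Rinv_0_lt_compat, sqrt_lt_R0; generalize (pos_INR n); lra. }
    induction n as [| n IH].
    + rewrite sum_O; unfold pow32; simpl; rewrite Rplus_0_l, sqrt_1; lra.
    + rewrite sum_Sn; change (@plus R_AbelianMonoid) with Rplus.
      eapply Rle_trans; [apply Rplus_le_compat_r, IH |].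
      rewrite S_INR; set (k := (INR n + 1)%R) in *.
      assert (Hk : (0 < k)%R) by (unfold k; generalize (pos_INR n); lra).
      unfold pow32.
      assert (Hs : (0 < sqrt k)%R) by now apply sqrt_lt_R0.
      assert (Ht : (sqrt k <= sqrt (k + 1))%R) by (apply sqrt_le_1_alt; lra).
      assert (E1 := sqrt_sqrt k (Rlt_le _ _ Hk)).
      assert (Hk1 : (0 <= k + 1)%R) by lra.
      assert (zq_half := sqrt_sqrt (k + 1) Hk1).
      set (s := sqrt k) in *; set (t := sqrt (k + 1)) in *.
      replace ((k + 1) * t)%R with (t * t * t)%R by (rewrite zq_half; ring).
      assert (Hst : (/ s - / t = / (s * t * (s + t)))%R).
      { replace (/ s - / t)%R with ((t * t - s * s) / (s * t * (s + t)))%R by (field; lra).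
        rewrite E1, zq_half; field; lra. }
      assert (Hle : (/ (2 * (t * t * t)) <= / (s * t * (s + t)))%R).
      { apply Rinv_le_contravar; [repeat apply Rmult_lt_0_compat; lra |].
        replace (2 * (t * t * t))%R with (t * t * (t + t))%R by ring.
        apply Rmult_le_compat; try lra; [apply Rmult_le_pos; lra |].
        apply Rmult_le_compat_r; lra. }
      replace (/ (t * t * t))%R with (2 * / (2 * (t * t * t)))%R by (field; lra).
      lra.
Qed.

Lemma bounded_sums_pow32 : bounded_sums (fun m : Z => / pow32 (1 + Rabs (IZR m)))%R.
Proof.
  assert (H := bounded_sums_pow32_nat).
  apply bounded_sums_Z; refine (bounded_sums_le _ _ _ H); intros n;
    (apply Rinv_le_contravar; [apply pow32_pos; generalize (pos_INR n); lra |]);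
    apply pow32_mono; (split; [generalize (pos_INR n); lra |]); rewrite INR_IZR_INZ;
    assert (0 <= IZR (Z.of_nat n))%R by (apply IZR_le; lia).
  - rewrite Rabs_pos_eq; lra.
  - rewrite minus_IZR, opp_IZR, Rabs_left1; lra.
Qed.

Lemma list_positive_min {I : Type} (f : I -> R) (S : list I) :
  exists d, (0 < d)%R /\ forall i, In i S -> (0 < f i)%R -> (d <= f i)%R.
Proof.
  induction S as [| j S [d [Hd H]]].
  - exists 1%R; split; [lra | intros i []].
  - destruct (Rlt_dec 0 (f j)) as [Hj | Hj].
    + exists (Rmin d (f j)); split; [now apply Rmin_pos |].
      intros i [<- | Hi] Hf; [apply Rmin_r |].
      eapply Rle_trans; [apply Rmin_l | auto].
    + exists d; split; auto; intros i [<- | Hi] Hf; [contradiction | auto].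
Qed.

Definition Zrange (N : nat) : list Z := map (fun k => Z.of_nat k - Z.of_nat N)%Z (seq 0 (2 * N + 1)).

Lemma In_Zrange (N : nat) (m : Z) : (Z.abs m <= Z.of_nat N)%Z -> In m (Zrange N).
Proof.
  intros H; apply in_map_iff; exists (Z.to_nat (m + Z.of_nat N)); split; [lia |].
  apply in_seq; lia.
Qed.

Definition lattice_norm (p : Z * Z) : R := (1 + Rabs (IZR (fst p)) + Rabs (IZR (snd p)))%R.

Lemma lattice_norm_ge_1 p : (1 <= lattice_norm p)%R.
Proof.
  unfold lattice_norm; generalize (Rabs_pos (IZR (fst p))) (Rabs_pos (IZR (snd p))); lra.
Qed.

Definition lattice (w w' : C) (p : Z * Z) : C := IZR (fst p) * w + IZR (snd p) * w'.

(** With [z = m + n * tau], the imaginary part gives [|n| * Im tau <= |z|], and then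
    [|m| <= |z| + |n| * |tau|]. Adding the two yields the constant [k]. *)
Lemma lattice_far (tau : C) : (0 < Im tau)%R ->
  exists c, (0 < c)%R /\ forall p, (c * (lattice_norm p - 1) <= Cmod (lattice 1 tau p))%R.
Proof.
  intros Ht; set (y := Im tau) in *.
  set (k := (1 + (1 + Cmod tau) / y)%R).
  assert (Hk : (0 < k)%R).
  { unfold k; assert (0 < (1 + Cmod tau) / y)%R; [| lra].
    apply Rdiv_lt_0_compat; auto; generalize (Cmod_ge_0 tau); lra. }
  exists (/ k)%R; split; [now apply Rinv_0_lt_compat |]; intros [m n].
  unfold lattice, lattice_norm; cbn [fst snd].
  set (z := IZR m * 1 + IZR n * tau).
  assert (H1 : (Rabs (IZR n) * y <= Cmod z)%R).
  { eapply Rle_trans; [| apply im_le_Cmod]; unfold z.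
    replace (snd (IZR m * 1 + IZR n * tau)) with (IZR n * y)%R
      by (unfold y, Im; destruct tau; unfold Cplus, Cmult, RtoC; simpl; ring).
    rewrite Rabs_mult, (Rabs_pos_eq y); lra. }
  assert (H2 : (Rabs (IZR m) - Rabs (IZR n) * Cmod tau <= Cmod z)%R).
  { replace z with (IZR m - - (IZR n * tau)) by (unfold z; ring).
    eapply Rle_trans; [| apply Cmod_triangle_inv]; rewrite Cmod_opp, Cmod_mult, !Cmod_R; lra. }
  apply Rmult_le_reg_l with k; auto; rewrite <- Rmult_assoc, Rinv_r, Rmult_1_l by lra.
  unfold k.
  assert (H3 : ((1 + Cmod tau) * Rabs (IZR n) <= (1 + Cmod tau) / y * Cmod z)%R).
  { replace ((1 + Cmod tau) * Rabs (IZR n))%R with ((1 + Cmod tau) / y * (Rabs (IZR n) * y))%R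
      by (field; lra).
    apply Rmult_le_compat_l; auto; left; apply Rdiv_lt_0_compat; auto;
      generalize (Cmod_ge_0 tau); lra. }
  rewrite Rmult_plus_distr_r; nra.
Qed.

(** Outside a box of size [N], half of the bound of [lattice_far] absorbs [z]; inside it, finitely
    many positive quotients have a positive minimum, the lattice point that may equal [z] being
    excluded. *)
Lemma lattice_lower (tau z : C) : (0 < Im tau)%R ->
  exists d, (0 < d)%R /\ forall p, z - lattice 1 tau p <> 0 ->
    (d * lattice_norm p <= Cmod (z - lattice 1 tau p))%R.
Proof.
  intros Ht; destruct (lattice_far tau Ht) as [c [Hc H]].
  set (N := Z.to_nat (up (2 * (Cmod z + c) / c))).
  assert (HN : (2 * (Cmod z + c) / c <= INR N)%R).
  { assert (0 <= 2 * (Cmod z + c) / c)%R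
      by (apply Rmult_le_pos; [generalize (Cmod_ge_0 z); lra | left; now apply Rinv_0_lt_compat]).
    generalize (archimed (2 * (Cmod z + c) / c)); intros [Hu _].
    rewrite INR_IZR_INZ; unfold N; rewrite Z2Nat.id; [lra |].
    apply le_IZR; lra. }
  destruct (list_positive_min (fun p => (Cmod (z - lattice 1 tau p) / lattice_norm p)%R)
    (list_prod (Zrange N) (Zrange N))) as [d [Hd Hmin]].
  exists (Rmin d (c / 2)); split; [apply Rmin_pos; lra |]; intros p Hp.
  assert (Hn := lattice_norm_ge_1 p).
  destruct (classic (Z.abs (fst p) <= Z.of_nat N /\ Z.abs (snd p) <= Z.of_nat N)%Z) as [[K1 K2] | K].
  - assert (Hin : In p (list_prod (Zrange N) (Zrange N)))
      by (destruct p; apply in_prod_iff; split; now apply In_Zrange).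
    assert (Hpos : (0 < Cmod (z - lattice 1 tau p) / lattice_norm p)%R)
      by (apply Rdiv_lt_0_compat; [now apply Cmod_gt_0 | lra]).
    specialize (Hmin p Hin Hpos).
    apply Rle_trans with (d * lattice_norm p)%R.
    + apply Rmult_le_compat_r; [lra | apply Rmin_l].
    + apply (Rmult_le_compat_r (lattice_norm p)) in Hmin; [| lra].
      now replace (Cmod (z - lattice 1 tau p) / lattice_norm p * lattice_norm p)%R
        with (Cmod (z - lattice 1 tau p)) in Hmin by (field; lra).
  - apply Rle_trans with (c / 2 * lattice_norm p)%R;
      [apply Rmult_le_compat_r; [lra | apply Rmin_r] |].
    assert (Hbig : (INR N < lattice_norm p - 1)%R).
    { unfold lattice_norm; rewrite INR_IZR_INZ, <- !abs_IZR.
      assert (0 <= IZR (Z.abs (fst p)))%R by (apply IZR_le; lia).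
      assert (0 <= IZR (Z.abs (snd p)))%R by (apply IZR_le; lia).
      destruct (Z_le_gt_dec (Z.abs (fst p)) (Z.of_nat N)) as [K1 | K1].
      - assert (IZR (Z.of_nat N) < IZR (Z.abs (snd p)))%R by (apply IZR_lt; lia); lra.
      - assert (IZR (Z.of_nat N) < IZR (Z.abs (fst p)))%R by (apply IZR_lt; lia); lra. }
    specialize (H p).
    rewrite Cmod_sub_sym; generalize (Cmod_triangle_inv (lattice 1 tau p) z); intros Htr.
    assert (Hfar : (2 * (Cmod z + c) <= c * (lattice_norm p - 1))%R).
    { apply (Rmult_le_compat_l c) in HN; [| lra].
      replace (c * (2 * (Cmod z + c) / c))%R with (2 * (Cmod z + c))%R in HN by (field; lra).
      nra. }
    nra.
Qed.

Lemma bounded_sums_lattice : bounded_sums (fun p => / lattice_norm p ^ 3)%R.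
Proof.
  refine (bounded_sums_le _ _ _ (bounded_sums_prod _ _ _ _ bounded_sums_pow32 bounded_sums_pow32)).
  - intros p; rewrite <- Rinv_mult; assert (Hn := lattice_norm_ge_1 p).
    generalize (Rabs_pos (IZR (fst p))) (Rabs_pos (IZR (snd p))); intros H1 H2.
    apply Rinv_le_contravar; [apply Rmult_lt_0_compat; apply pow32_pos; lra |].
    rewrite <- pow32_sqr by lra.
    apply Rmult_le_compat; try (left; apply pow32_pos; lra); apply pow32_mono;
      unfold lattice_norm; lra.
  - intros m; left; apply Rinv_0_lt_compat, pow32_pos; generalize (Rabs_pos (IZR m)); lra.
  - intros m; left; apply Rinv_0_lt_compat, pow32_pos; generalize (Rabs_pos (IZR m)); lra.
Qed.

(** * Partial fractions of the squared cosecant *)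

(** The integers are treated as the real row of the Gaussian lattice, so that [lattice_lower] with
    [tau = Ci] applies. *)
Lemma bounded_sums_inv_sqr (z : C) : (forall m : Z, z + IZR m <> 0) ->
  bounded_sums (fun m : Z => / Cmod (z + IZR m) ^ 2)%R.
Proof.
  intros Hz.
  destruct (lattice_lower Ci z) as [d [Hd H]]; [unfold Ci, Im; simpl; lra |].
  apply (bounded_sums_le _ (fun m => / d ^ 2 * / pow32 (1 + Rabs (IZR m)))%R).
  - intros m; specialize (H (- m, 0)%Z); specialize (Hz m).
    replace (z - lattice 1 Ci (- m, 0)%Z) with (z + IZR m) in H
      by (unfold lattice; simpl; rewrite opp_IZR, RtoC_opp; ring).
    specialize (H Hz); unfold lattice_norm in H; cbn [fst snd] in H.
    rewrite opp_IZR, Rabs_Ropp, Rabs_R0, Rplus_0_r in H.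
    set (x := (1 + Rabs (IZR m))%R) in *.
    assert (Hx : (1 <= x)%R) by (unfold x; generalize (Rabs_pos (IZR m)); lra).
    rewrite <- Rinv_mult; apply Rinv_le_contravar.
    + apply Rmult_lt_0_compat; [now apply pow_lt | apply pow32_pos; lra].
    + apply Rle_trans with ((d * x) ^ 2)%R.
      * replace ((d * x) ^ 2)%R with (d ^ 2 * (x * x))%R by ring.
        apply Rmult_le_compat_l; [apply pow2_ge_0 |]; unfold pow32.
        apply Rmult_le_compat_l; [lra |].
        rewrite <- (sqrt_square x) at 2 by lra; apply sqrt_le_1_alt; nra.
      * apply pow_incr; split; [apply Rmult_le_pos; lra | exact H].
  - apply bounded_sums_scal; [| apply bounded_sums_pow32].
    left; apply Rinv_0_lt_compat; now apply pow_lt.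
Qed.

(* [pi ^ 2 / sin (pi z) ^ 2] *)
Definition csc2 (z : C) : C := - (4 * PI ^ 2) * koebe (Cexp (2 * PI * Ci * z)).

Lemma csc2_period (z : C) (m : Z) : csc2 (z + IZR m) = csc2 z.
Proof.
  unfold csc2; do 2 f_equal; rewrite <- (Cexp_2PI_Z m (2 * PI * Ci * z)); f_equal; ring.
Qed.

Lemma Cexp_half_neq (z : C) : Cexp (2 * PI * Ci * z) <> 1 ->
  Cexp (2 * PI * Ci * (z / 2)) <> 1 /\ Cexp (2 * PI * Ci * ((z + 1) / 2)) <> 1.
Proof.
  intros H; split; intros E; apply H.
  - replace (2 * PI * Ci * z) with (2 * PI * Ci * (z / 2) + 2 * PI * Ci * (z / 2)) by field.
    rewrite Cexp_plus, E; ring.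
  - rewrite <- (Cexp_2PI_Z 1); simpl.
    replace (2 * PI * Ci * z + 1 * (2 * PI * Ci)) with
      (2 * PI * Ci * ((z + 1) / 2) + 2 * PI * Ci * ((z + 1) / 2)) by field.
    rewrite Cexp_plus, E; ring.
Qed.

(** Replacing [z / 2] by [(z + 1) / 2] changes the sign of [w = Cexp (2 * PI * Ci * (z / 2))], and
    [koebe (w ^ 2) = (koebe w + koebe (- w)) / 4]. *)
Lemma csc2_half (z : C) : Cexp (2 * PI * Ci * z) <> 1 ->
  csc2 z = / 4 * (csc2 (z / 2) + csc2 ((z + 1) / 2)).
Proof.
  intros H; destruct (Cexp_half_neq z H) as [H1 H2]; unfold csc2.
  assert (E : Cexp (2 * PI * Ci * ((z + 1) / 2)) = - Cexp (2 * PI * Ci * (z / 2))).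
  { replace (2 * PI * Ci * ((z + 1) / 2)) with (2 * PI * Ci * (z / 2) + PI * Ci) by field.
    rewrite Cexp_plus, Cexp_PI; ring. }
  rewrite E in *.
  replace (2 * PI * Ci * z) with (2 * PI * Ci * (z / 2) + 2 * PI * Ci * (z / 2)) in * by field.
  rewrite Cexp_plus in *; set (w := Cexp (2 * PI * Ci * (z / 2))) in *.
  unfold koebe; field; auto using one_minus_neq_0.
Qed.

Lemma csumn_ext (f g : nat -> C) n : (forall k, (k < n)%nat -> f k = g k) -> csumn f n = csumn g n.
Proof.
  intros H; induction n as [| n IH]; simpl; auto; rewrite IH, H by (auto; lia); reflexivity.
Qed.

Lemma csumn_app (f : nat -> C) a b : csumn f (a + b) = csumn f a + csumn (fun k => f (a + k)%nat) b.
Proof.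
  induction b as [| b IH]; [rewrite Nat.add_0_r; simpl; ring |].
  rewrite Nat.add_succ_r; simpl; rewrite IH; ring.
Qed.

Lemma csumn_plus (f g : nat -> C) n : csumn (fun k => f k + g k) n = csumn f n + csumn g n.
Proof. induction n as [| n IH]; simpl; [ring | rewrite IH; ring]. Qed.

Lemma csumn_head (f : nat -> C) n : csumn f (S n) = f O + csumn (fun k => f (S k)) n.
Proof. induction n as [| n IH]; [simpl; ring |]. cbn [csumn] in *; rewrite IH; ring. Qed.

Lemma csumn_rev (f : nat -> C) n : csumn (fun k => f (n - 1 - k)%nat) n = csumn f n.
Proof.
  induction n as [| n IH]; auto.
  rewrite csumn_head; cbn [csumn]; rewrite <- IH, Cplus_comm; f_equal.
  - apply csumn_ext; intros k Hk; f_equal; lia.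
  - f_equal; lia.
Qed.

Lemma has_sum_trunc (f : nat -> C) n :
  has_sum (fun k => if Nat.ltb k n then f k else 0) (csumn f n).
Proof.
  induction n as [| n IH].
  - apply (has_sum_ext (fun _ => 0)); [intros k; reflexivity | apply has_sum_zero].
  - apply (has_sum_ext (fun k => (if Nat.ltb k n then f k else 0) + (if Nat.eqb k n then f n else 0))).
    + intros k; destruct (Nat.ltb_spec k n), (Nat.ltb_spec k (S n)), (Nat.eqb_spec k n);
        try lia; subst; ring.
    + cbn [csumn]; apply has_sum_plus; auto.
      assert (H := has_sum_single (fun k => if Nat.eqb k n then f n else 0) n).
      cbv beta in H; rewrite Nat.eqb_refl in H; apply H.
      intros i Hi; now destruct (Nat.eqb_spec i n).
Qed.

(* Iterating [csc2_half] writes [csc2] as finite sums that tend termwise to the sum of [1 / (z + m) ^ 2]. *)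
Lemma csc2_dyadic (z : C) (n : nat) : Cexp (2 * PI * Ci * z) <> 1 ->
  csc2 z = csumn (fun k => csc2 ((z + INR k) / 2 ^ n) / (2 ^ n) ^ 2) (2 ^ n).
Proof.
  assert (P2 : forall n, (2 : C) ^ n <> 0).
  { intros m; apply Cpow_nz; intros E; apply (f_equal fst) in E; simpl in E; lra. }
  intros H; induction n as [| n IH].
  - simpl; replace ((z + 0) / 1) with z by (field; apply C1_nz); field; apply C1_nz.
  - rewrite IH.
    replace (2 ^ S n)%nat with (2 ^ n + 2 ^ n)%nat by (simpl; lia).
    rewrite csumn_app, <- csumn_plus; apply csumn_ext; intros k Hk.
    rewrite csc2_half.
    + rewrite plus_INR, pow_INR, RtoC_plus, RtoC_pow; simpl INR.
      replace (1 + 1)%R with 2%R by ring.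
      replace ((z + INR k) / 2 ^ n / 2) with ((z + INR k) / 2 ^ S n)
        by (rewrite Cpow_S; field; auto).
      replace (((z + INR k) / 2 ^ n + 1) / 2) with ((z + (2 ^ n + INR k)) / 2 ^ S n)
        by (rewrite Cpow_S; field; auto).
      rewrite Cpow_S; field; auto.
    + intros E; apply H; rewrite <- (Cexp_2PI_Z (Z.of_nat k)), <- INR_IZR_INZ.
      replace (2 * PI * Ci * z + INR k * (2 * PI * Ci)) with
        (INR (2 ^ n) * (2 * PI * Ci * ((z + INR k) / 2 ^ n))).
      * rewrite Cexp_nat, E; apply Cpow_1_l.
      * rewrite pow_INR, RtoC_pow; simpl INR; replace (1 + 1)%R with 2%R by ring; field; auto.
Qed.

(** The dyadic sum of level [n + 1], with its [2 ^ (n + 1)] indices centred about [0]: the argument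
    then keeps a real part close to the interval from [-1/2] to [1/2], as [csc2_bound] requires. *)
Definition csc2_term (z : C) (n : nat) (m : Z) : C :=
  if andb (- 2 ^ Z.of_nat n <=? m)%Z (m <? 2 ^ Z.of_nat n)%Z
  then csc2 ((z + IZR m) / 2 ^ S n) / (2 ^ S n) ^ 2 else 0.

Lemma csc2_term_has_sum (z : C) (n : nat) : Cexp (2 * PI * Ci * z) <> 1 ->
  has_sum (csc2_term z n) (csc2 z).
Proof.
  intros H; rewrite (csc2_dyadic z (S n) H).
  assert (HZ : (2 ^ Z.of_nat n)%Z = Z.of_nat (2 ^ n)) by (rewrite Nat2Z.inj_pow; reflexivity).
  assert (P2 : (2 : C) ^ S n <> 0).
  { apply Cpow_nz; intros E; apply (f_equal fst) in E; simpl in E; lra. }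
  replace (2 ^ S n)%nat with (2 ^ n + 2 ^ n)%nat by (simpl; lia).
  rewrite csumn_app; apply has_sum_Z.
  - generalize (has_sum_trunc (fun k => csc2 ((z + INR k) / 2 ^ S n) / (2 ^ S n) ^ 2) (2 ^ n)).
    apply has_sum_ext; intros k; unfold csc2_term; rewrite HZ.
    destruct (Nat.ltb_spec k (2 ^ n)), (Z.leb_spec (- Z.of_nat (2 ^ n)) (Z.of_nat k)),
      (Z.ltb_spec (Z.of_nat k) (Z.of_nat (2 ^ n))); try lia; simpl andb; cbv iota; auto.
    now rewrite INR_IZR_INZ.
  - rewrite <- csumn_rev.
    match goal with |- has_sum _ (csumn ?g _) => generalize (has_sum_trunc g (2 ^ n)) end.
    apply has_sum_ext; intros k; unfold csc2_term; rewrite HZ.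
    destruct (Nat.ltb_spec k (2 ^ n)), (Z.leb_spec (- Z.of_nat (2 ^ n)) (- Z.of_nat k - 1)),
      (Z.ltb_spec (- Z.of_nat k - 1) (Z.of_nat (2 ^ n))); try lia; simpl andb; cbv iota; auto.
    (* One period moves the index [2 ^ (n + 1) - 1 - k] to [- k - 1]. *)
    f_equal; rewrite <- (csc2_period _ (-1)); f_equal.
    rewrite INR_IZR_INZ.
    replace (Z.of_nat (2 ^ n + (2 ^ n - 1 - k))) with (2 ^ Z.of_nat (S n) + (- Z.of_nat k - 1))%Z.
    + rewrite plus_IZR, <- pow_IZR, RtoC_plus, RtoC_pow; field; auto.
    + rewrite Nat2Z.inj_succ, Z.pow_succ_r, HZ by lia; lia.
Qed.

(** From [sin x >= x - x ^ 3 / 6], where [1 - (9/4) ^ 2 / 6 = 15/96]. The range covers [PI * a] for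
    [a <= 9/16] through the crude bound [PI <= 4]. *)
Lemma sin_lower (x : R) : (0 <= x <= 9 / 4)%R -> (15 / 100 * x <= sin x)%R.
Proof.
  intros Hx; destruct (pre_sin_bound x 0) as [H _]; [lra | lra |].
  unfold sin_approx, sin_term in H; simpl in H.
  replace (1 + 1 + 1)%R with 3%R in H by ring.
  assert (x * (1 - x * x / 6) <= sin x)%R by (eapply Rle_trans; [| exact H]; right; field).
  assert (x * x <= 81 / 16)%R by nra.
  nra.
Qed.

Lemma exp_diff_sqr (x : R) : (x ^ 2 <= (exp x - exp (- x)) ^ 2)%R.
Proof.
  assert (H : forall x, (0 <= x -> x <= exp x - exp (- x))%R).
  { intros y Hy; generalize (exp_ineq1_le y).
    assert (exp (- y) <= 1)%R by (rewrite <- exp_0; apply exp_le; lra); lra. }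
  destruct (Rle_dec 0 x) as [Hx | Hx].
  - apply pow_incr; auto.
  - replace (x ^ 2)%R with ((- x) ^ 2)%R by ring.
    replace ((exp x - exp (- x)) ^ 2)%R with ((exp (- x) - exp (- - x)) ^ 2)%R
      by (rewrite Ropp_involutive; ring).
    apply pow_incr; split; [lra | apply H; lra].
Qed.

(** With [w] the exponential and [z = a + b * i], the quotient [|1 - w| ^ 2 / |w|] equals [4 * sin
    (PI * a) ^ 2 + (exp (PI * b) - exp (- PI * b)) ^ 2]. The two terms are at least [0.36 * a ^ 2]
    and [b ^ 2], hence the factor [1/3]. *)
Lemma Cexp_sub_1_lower (z : C) : (Rabs (Re z) <= 9 / 16)%R ->
  (/ 3 * Cmod z ^ 2 * Cmod (Cexp (2 * PI * Ci * z)) <= Cmod (1 - Cexp (2 * PI * Ci * z)) ^ 2)%R.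
Proof.
  intros Hz.
  destruct z as [a b]; unfold Re in Hz; simpl in Hz.
  replace (2 * PI * Ci * (a, b)) with ((- (2 * (PI * b)), 2 * (PI * a))%R : C)
    by (unfold Ci, RtoC, Cmult; simpl; f_equal; ring).
  rewrite Cmod_Cexp, !Cmod2_alt; unfold Cexp, Cminus, Cplus, Copp, RtoC, Re, Im; simpl fst; simpl snd.
  set (x := (PI * a)%R); set (y := (PI * b)%R).
  assert (HPI : (2 < PI <= 4)%R) by (generalize PI2_1 PI_4; lra).
  assert (Hsin : (9 / 100 * a ^ 2 <= sin x ^ 2)%R).
  { assert (K : (3 / 10 * Rabs a <= Rabs (sin x))%R).
    { assert (Hs : forall t, (0 <= t <= 9 / 16 -> 3 / 10 * t <= sin (PI * t))%R).
      { intros t Ht; eapply Rle_trans; [| apply sin_lower]; [nra |]; split; nra. }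
      unfold Rabs at 1; destruct (Rcase_abs a) as [Ha | Ha].
      - rewrite Rabs_left in Hz by auto.
        replace (sin x) with (- sin (PI * - a))%R.
        + rewrite Rabs_Ropp; eapply Rle_trans; [apply Hs; lra | apply Rle_abs].
        + unfold x; replace (PI * - a)%R with (- (PI * a))%R by ring; rewrite sin_neg; ring.
      - rewrite Rabs_right in Hz by auto.
        eapply Rle_trans; [apply Hs; lra | apply Rle_abs]. }
    replace (sin x ^ 2)%R with (Rabs (sin x) ^ 2)%R by (rewrite RPow_abs, Rabs_pos_eq; [auto | apply pow2_ge_0]).
    replace (9 / 100 * a ^ 2)%R with ((3 / 10 * Rabs a) ^ 2)%R.
    - apply pow_incr; split; auto; generalize (Rabs_pos a); lra.
    - rewrite Rpow_mult_distr, RPow_abs, (Rabs_pos_eq (a ^ 2)) by apply pow2_ge_0; lra. }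
  assert (Hb : (b ^ 2 <= (exp y - exp (- y)) ^ 2)%R).
  { eapply Rle_trans; [| apply exp_diff_sqr]; unfold y; rewrite Rpow_mult_distr.
    assert (1 <= PI ^ 2)%R by nra; generalize (pow2_ge_0 b); nra. }
  assert (Ee : exp (- (2 * y)) = (exp (- y) * exp (- y))%R) by (rewrite <- exp_plus; f_equal; ring).
  assert (E1 : (exp y * exp (- y) = 1)%R) by (rewrite <- exp_plus, <- exp_0; f_equal; ring).
  rewrite Ee, sin_2a, cos_2a_sin.
  set (u := exp (- y)) in *; set (v := exp y) in *; set (s := sin x) in *; set (c := cos x) in *.
  assert (Ec : (c * c = 1 - s * s)%R).
  { generalize (sin2_cos2 x); unfold Rsqr; fold s c; lra. }
  assert (Hu : (0 < u)%R) by apply exp_pos.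
  replace ((1 + - (u * u * (1 - 2 * s * s))) ^ 2 + (0 + - (u * u * (2 * s * c))) ^ 2)%R
    with ((u * u) * ((v - u) ^ 2 + 4 * s ^ 2))%R.
  - rewrite (Rmult_comm (u * u)); apply Rmult_le_compat_r; [nra |]; generalize (pow2_ge_0 a) (pow2_ge_0 b); lra.
  - transitivity ((1 + - (u * u * (1 - 2 * s * s))) ^ 2 + (u * u) ^ 2 * 4 * s ^ 2 * (c * c))%R; [| ring].
    rewrite Ec.
    replace ((u * u) * ((v - u) ^ 2 + 4 * s ^ 2))%R with
      ((v * u) * (v * u) - 2 * (v * u) * (u * u) + (u * u) ^ 2 + 4 * (u * u) * s ^ 2)%R by ring.
    rewrite E1; ring.
Qed.

Lemma csc2_bound (z : C) : (Rabs (Re z) <= 9 / 16)%R -> z <> 0 -> Cexp (2 * PI * Ci * z) <> 1 ->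
  (Cmod (csc2 z) <= 12 * PI ^ 2 / Cmod z ^ 2)%R.
Proof.
  intros Hz H0 H1; assert (H := Cexp_sub_1_lower z Hz).
  unfold csc2, koebe; set (w := Cexp (2 * PI * Ci * z)) in *.
  assert (Hw : 1 - w <> 0) by now apply one_minus_neq_0.
  rewrite Cmod_mult, Cmod_opp, Cmod_div, Cmod_pow by now apply Cpow_nz.
  rewrite <- RtoC_pow, <- RtoC_mult, Cmod_R, Rabs_pos_eq
    by (apply Rmult_le_pos; [lra | apply pow2_ge_0]).
  assert (Hz0 : (0 < Cmod z ^ 2)%R) by (apply pow_lt; now apply Cmod_gt_0).
  assert (Hw0 : (0 < Cmod (1 - w) ^ 2)%R) by (apply pow_lt; now apply Cmod_gt_0).
  set (z2 := (Cmod z ^ 2)%R) in *; set (w2 := (Cmod (1 - w) ^ 2)%R) in *.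
  replace (12 * PI ^ 2 / z2)%R with (4 * PI ^ 2 * (3 / z2))%R by (field; lra).
  apply Rmult_le_compat_l; [apply Rmult_le_pos; [lra | apply pow2_ge_0] |].
  apply Rmult_le_reg_r with (w2)%R; auto.
  replace (Cmod w / w2 * w2)%R with (Cmod w) by (field; lra).
  apply Rmult_le_reg_l with (/ 3 * z2)%R; [lra |].
  replace (/ 3 * z2 * (3 / z2 * w2))%R with (w2)%R
    by (field; lra).
  exact H.
Qed.

Lemma csc2_small (z : C) (t : nat -> R) : z <> 0 ->
  (forall n, t n <> 0%R) -> is_lim_seq t 0 ->
  Cconv (fun n => csc2 (t n * z) * t n ^ 2) (/ z ^ 2).
Proof.
  intros Hz Ht Hl.
  set (c := 2 * PI * Ci * z).
  assert (HPI : RtoC PI <> 0) by (intros E; apply RtoC_inj in E; generalize PI_RGT_0; lra).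
  assert (HCi : Ci <> 0) by (intros E; apply (f_equal snd) in E; simpl in E; lra).
  assert (H2 : RtoC 2 <> 0) by (intros E; apply RtoC_inj in E; lra).
  assert (Hc : c <> 0) by (unfold c; repeat apply Cmult_neq_0; auto).
  assert (H := Cexp_diff_quotient c t Ht Hl).
  assert (H' := Cconv_Cexp c t Ht Hl).
  replace (/ z ^ 2) with (- (4 * PI ^ 2) * (1 / (c * c))).
  - eapply Cconv_ext; [| apply Cconv_scal, Cconv_div; [| exact H' | apply Cconv_mult; exact H]].
    + intros n; cbv beta; unfold csc2, koebe.
      replace (2 * PI * Ci * (t n * z)) with (t n * c) by (unfold c; ring).
      set (w := Cexp (t n * c)).
      assert (Htn : RtoC (t n) <> 0) by (intros E; apply (Ht n); now apply RtoC_inj).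
      (* If [w = 1], both sides are [0] because [/ 0] is [0]. *)
      destruct (classic (w = 1)) as [-> | Hw].
      * replace ((1 - 1) ^ 2) with (RtoC 0) by ring.
        replace ((1 - 1) / t n * ((1 - 1) / t n)) with (RtoC 0) by (field; auto).
        unfold Cdiv; replace (/ 0) with (RtoC 0); [ring |].
        unfold Cinv, RtoC; simpl; f_equal; unfold Rdiv; ring.
      * assert (w - 1 <> 0) by (intros E; apply Hw; replace w with (1 + (w - 1)) by ring; rewrite E; ring).
        assert (1 - w <> 0) by now apply one_minus_neq_0.
        field; auto.
    + now apply Cmult_neq_0.
  - assert (E : c * c = - (4 * PI ^ 2) * z ^ 2).
    { unfold c; transitivity (4 * PI ^ 2 * z ^ 2 * (Ci * Ci)); [ring |].
      replace (Ci * Ci) with (RtoC (-1)) by (unfold Ci, Cmult, RtoC; simpl; f_equal; ring).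
      replace (RtoC (-1)) with (- (1)) by (now rewrite <- RtoC_opp); ring. }
    rewrite E; field; auto.
Qed.

(** Every dyadic level has the same sum [csc2 z]. Its terms tend to [1 / (z + m) ^ 2] by
    [csc2_small] and are dominated through [csc2_bound], so [has_sum_tannery] identifies the
    constant sequence with the sum of the series. *)
Lemma has_sum_inv_sqr (z : C) : Cexp (2 * PI * Ci * z) <> 1 ->
  has_sum (fun m : Z => / (z + IZR m) ^ 2) (csc2 z).
Proof.
  intros H.
  assert (Hm : forall m : Z, z + IZR m <> 0).
  { intros m E; apply H; rewrite <- (Cexp_2PI_Z m).
    replace (2 * PI * Ci * z + IZR m * (2 * PI * Ci)) with (2 * PI * Ci * (z + IZR m)) by ring.
    rewrite E, Cmult_0_r; apply Cexp_0. }
  assert (Hs : summable (fun m : Z => / (z + IZR m) ^ 2)).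
  { apply (summable_le _ (fun m : Z => / Cmod (z + IZR m) ^ 2)%R).
    - intros m; rewrite Cmod_inv, Cmod_pow by (apply Cpow_nz; auto); lra.
    - now apply bounded_sums_inv_sqr. }
  destruct (summable_has_sum _ Hs) as [l Hl]; replace (csc2 z) with l; auto.
  (* From level [n0] on, [16 * |z| <= 2 ^ k]; for [|m| <= 2 ^ k] the real part of
     [(z + m) / 2 ^ (k + 1)] is then at most [1/2 + 1/32], below [9/16]. *)
  set (n0 := Z.to_nat (up (16 * Cmod z))).
  assert (Hn0 : (16 * Cmod z <= 2 ^ n0)%R).
  { generalize (archimed (16 * Cmod z)); intros [Hu _].
    assert (0 <= up (16 * Cmod z))%Z by (apply le_IZR; generalize (Cmod_ge_0 z); lra).
    apply Rle_trans with (INR n0).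
    - rewrite INR_IZR_INZ; unfold n0; rewrite Z2Nat.id by auto; lra.
    - assert (K : (n0 <= 2 ^ n0)%nat) by (apply Nat.lt_le_incl, Nat.pow_gt_lin_r; lia).
      apply le_INR in K; rewrite pow_INR in K; simpl in K.
      now replace (1 + 1)%R with 2%R in K by ring. }
  assert (P2 : forall n, (2 : C) ^ n <> 0).
  { intros k; apply Cpow_nz; intros E; apply RtoC_inj in E; lra. }
  assert (R2 : forall n, (0 < 2 ^ n)%R) by (intros; apply pow_lt; lra).
  assert (K : Cconv (fun _ : nat => csc2 z) l); [| now apply (Cconv_unique _ _ _ K), Cconv_const].
  apply (has_sum_tannery (fun n => csc2_term z (n + n0)) (fun m : Z => / (z + IZR m) ^ 2)
    (fun m => 12 * PI ^ 2 * / Cmod (z + IZR m) ^ 2)%R); auto.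
  - apply bounded_sums_scal; [apply Rmult_le_pos; [lra | apply pow2_ge_0] |].
    now apply bounded_sums_inv_sqr.
  - intros n m; unfold csc2_term.
    assert (Hpos : (0 < Cmod (z + IZR m) ^ 2)%R) by (apply pow_lt; now apply Cmod_gt_0).
    assert (HPI : (0 <= PI ^ 2)%R) by apply pow2_ge_0.
    destruct (Z.leb_spec (- 2 ^ Z.of_nat (n + n0)) m), (Z.ltb_spec m (2 ^ Z.of_nat (n + n0)));
      simpl andb; cbv iota;
      try (rewrite Cmod_0; apply Rmult_le_pos; [lra | left; now apply Rinv_0_lt_compat]).
    set (k := (n + n0)%nat) in *.
    assert (HmR : (Rabs (IZR m) <= 2 ^ k)%R).
    { rewrite pow_IZR; apply Rabs_le; rewrite <- opp_IZR; split; apply IZR_le; lia. }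
    assert (Hk : (16 * Cmod z <= 2 ^ k)%R).
    { eapply Rle_trans; [exact Hn0 |]; apply Rle_pow; [lra | unfold k; lia]. }
    assert (zq_half : RtoC (2 ^ S k) = 2 ^ S k) by apply RtoC_pow.
    rewrite Cmod_div, Cmod_pow by (apply Cpow_nz; auto).
    eapply Rle_trans.
    + apply Rmult_le_compat_r; [left; apply Rinv_0_lt_compat, pow_lt, Cmod_gt_0; auto |].
      apply csc2_bound.
      * rewrite <- zq_half, Cdiv_R by (apply Rgt_not_eq; apply (R2 (S k))); simpl fst.
        unfold Re; simpl fst.
        unfold Rdiv; rewrite Rabs_mult, (Rabs_pos_eq (/ _)) by (left; apply Rinv_0_lt_compat; apply (R2 (S k))).
        apply Rmult_le_reg_r with (2 ^ S k)%R; auto.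
        rewrite Rmult_assoc, Rinv_l, Rmult_1_r by (apply Rgt_not_eq; apply (R2 (S k))).
        eapply Rle_trans; [apply Rabs_triang |].
        generalize (re_le_Cmod' z); simpl; specialize (R2 k); lra.
      * apply Cmult_neq_0; auto; intros E; apply (P2 (S k)).
        transitivity (2 ^ S k * (2 ^ S k * / 2 ^ S k)); [field; auto | rewrite E; ring].
      * intros E; apply H; rewrite <- (Cexp_2PI_Z m).
        replace (2 * PI * Ci * z + IZR m * (2 * PI * Ci)) with
          (INR (2 ^ S k) * (2 * PI * Ci * ((z + IZR m) / 2 ^ S k))).
        -- rewrite Cexp_nat, E; apply Cpow_1_l.
        -- rewrite pow_INR, RtoC_pow; simpl INR; replace (1 + 1)%R with 2%R by ring; field; auto.
    + rewrite Cmod_div, <- zq_half, Cmod_R, Rabs_pos_eq by (auto; left; auto).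
      right; field; split; apply Rgt_not_eq; [apply Cmod_gt_0; auto | apply (R2 (S k))].
  - intros m.
    set (t := fun n => (/ 2 ^ S (n + n0))%R).
    assert (Ht : forall n, t n <> 0%R) by (intros n; apply Rinv_neq_0_compat, Rgt_not_eq, R2).
    assert (Hlt : is_lim_seq t 0).
    { apply is_lim_seq_ext with (fun n => (/ 2) ^ (n + S n0))%R.
      - intros n; unfold t; rewrite pow_inv; do 2 f_equal; lia.
      - apply (is_lim_seq_incr_n (fun n => (/ 2) ^ n)%R (S n0)).
        apply is_lim_seq_geom; rewrite Rabs_pos_eq; lra. }
    assert (L := csc2_small (z + IZR m) t (Hm m) Ht Hlt).
    apply Cconv_eps; intros eps He.
    destruct (proj1 (Cconv_eps _ _) L eps He) as [N HN].
    exists (N + Z.to_nat (Z.abs m) + 1)%nat; intros n Hn.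
    specialize (HN n ltac:(lia)); unfold csc2_term.
    assert (Hpow : (Z.abs m < 2 ^ Z.of_nat (n + n0))%Z).
    { apply Z.lt_le_trans with (Z.of_nat (n + n0)); [lia |].
      apply Z.lt_le_incl, Z.pow_gt_lin_r; lia. }
    destruct (Z.leb_spec (- 2 ^ Z.of_nat (n + n0)) m), (Z.ltb_spec m (2 ^ Z.of_nat (n + n0)));
      try lia; simpl andb; cbv iota.
    replace (csc2 ((z + IZR m) / 2 ^ S (n + n0)) / (2 ^ S (n + n0)) ^ 2) with
      (csc2 (t n * (z + IZR m)) * t n ^ 2); auto.
    unfold t; rewrite RtoC_inv, RtoC_pow by (apply Rgt_not_eq, R2).
    rewrite Cpow_inv by auto; unfold Cdiv; f_equal; f_equal; ring.
  - intros n; now apply csc2_term_has_sum.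
Qed.

Lemma Cconv_ext_eventually (u v : nat -> C) (l : C) (N : nat) :
  (forall n, (N <= n)%nat -> u n = v n) -> Cconv u l -> Cconv v l.
Proof.
  intros H Hu; apply Cconv_eps; intros eps He.
  destruct (proj1 (Cconv_eps _ _) Hu eps He) as [N' HN].
  exists (N + N')%nat; intros n Hn; rewrite <- H by lia; apply HN; lia.
Qed.

Lemma Cconv_neq_0 (u : nat -> C) (l : C) : Cconv u l -> l <> 0 ->
  exists N, forall n, (N <= n)%nat -> u n <> 0.
Proof.
  intros H Hl; destruct (proj1 (Cconv_eps _ _) H (Cmod l)) as [N HN]; [now apply Cmod_gt_0 |].
  exists N; intros n Hn E; specialize (HN n Hn); rewrite E in HN.
  replace (0 - l) with (- l) in HN by ring; rewrite Cmod_opp in HN; lra.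
Qed.

Lemma qp_eq_0 (p x : C) (k : nat) : (Cmod p < 1)%R -> x * p ^ k = 1 -> qp p x = 0.
Proof.
  intros Hp H; rewrite (qp_split p Hp x (S k)); unfold qp_partial; cbn [prodn].
  unfold qp_factor at 2; rewrite H; ring.
Qed.

(** Recovers regularity where the nonvanishing of [th] is known beforehand: at the half points, and
    by continuity near a regular point. *)
Lemma th_neq_0_inv (U T : C) (n : Z) : (Re T < 0)%R ->
  th (Cexp T) (Cexp U) <> 0 -> Cexp (U + IZR n * T) <> 1.
Proof.
  intros HT H E; assert (Hp := Cmod_Cexp_lt_1 T HT); apply H; unfold th.
  destruct (Z_le_gt_dec 0 n) as [Hn | Hn].
  - rewrite (qp_eq_0 _ (Cexp U) (Z.to_nat n) Hp); [ring |].
    rewrite pow_Cexp_Z, Z2Nat.id; auto.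
  - rewrite (qp_eq_0 _ (Cexp T / Cexp U) (Z.to_nat (- n - 1)) Hp); [ring |].
    rewrite pow_Cexp_Z_neg; replace (- Z.of_nat (Z.to_nat (- n - 1)) - 1)%Z with n by lia.
    rewrite E; field; apply C1_nz.
Qed.

(** * The Weierstrass function in an arbitrary basis of its lattice *)

Section Wp.
Variable tau : C.
Hypothesis Htau : (0 < Im tau)%R.

Definition off_lattice (z : C) : Prop := forall p, z - 4 * lattice 1 tau p <> 0.

Lemma lattice_point_eq p : lattice_point 2 (2 * tau) p = 4 * lattice 1 tau p.
Proof. unfold lattice_point, lattice; ring. Qed.

Lemma lattice_lower4 (z : C) : exists d, (0 < d)%R /\ forall p, z - 4 * lattice 1 tau p <> 0 ->
  (d * lattice_norm p <= Cmod (z - 4 * lattice 1 tau p))%R.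
Proof.
  destruct (lattice_lower tau (z / 4) Htau) as [d [Hd H]].
  exists (4 * d)%R; split; [lra |]; intros p Hp.
  assert (E : z - 4 * lattice 1 tau p = 4 * (z / 4 - lattice 1 tau p)) by field.
  rewrite E in *; rewrite Cmod_mult, Cmod_R, Rabs_pos_eq by lra.
  assert (z / 4 - lattice 1 tau p <> 0) by (intros K; apply Hp; rewrite K; ring).
  specialize (H p H0); lra.
Qed.

Lemma lattice_eq_0 p : lattice 1 tau p = 0 -> p = (0, 0)%Z.
Proof.
  intros E; destruct p as [m n]; unfold lattice in E; destruct tau as [x y].
  unfold Im in Htau; simpl in Htau.
  assert (zq_half := f_equal snd E); assert (E1 := f_equal fst E).
  unfold RtoC, Cmult, Cplus in E1, zq_half; simpl in E1, zq_half.
  assert (Hn : IZR n = 0%R).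
  { destruct (Req_dec (IZR n) 0); auto; exfalso; apply (Rmult_integral_contrapositive_currified _ y H); lra. }
  rewrite Hn in E1; assert (Hm : IZR m = 0%R) by lra.
  apply eq_IZR in Hn; apply eq_IZR in Hm; now subst.
Qed.

(** At the origin [/ 0 ^ 2] is [0], so this term is [/ z ^ 2] and the isolated summand of [wp] joins
    a sum over the whole lattice. *)
Definition wp_term (z : C) (p : Z * Z) : C :=
  / (z - lattice_point 2 (2 * tau) p) ^ 2 - / lattice_point 2 (2 * tau) p ^ 2.

(** The difference equals [- z * (z - 2 * L) / ((z - L) ^ 2 * L ^ 2)] and decays like the inverse
    cube of [lattice_norm]. *)
Lemma wp_term_summable (z : C) : off_lattice z -> summable (wp_term z).
Proof.
  intros Hz.
  destruct (lattice_lower4 z) as [d1 [Hd1 H1]].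
  destruct (lattice_lower4 0) as [d2 [Hd2 H2]].
  assert (Hq : (0 <= Cmod z / d2)%R)
    by (apply Rmult_le_pos; [apply Cmod_ge_0 | left; now apply Rinv_0_lt_compat]).
  assert (Hc : (0 <= Cmod z * (Cmod z / d2 + 2))%R)
    by (apply Rmult_le_pos; [apply Cmod_ge_0 | lra]).
  set (K := (Cmod z * (Cmod z / d2 + 2) * / (d1 ^ 2 * d2))%R).
  assert (HK : (0 <= K)%R).
  { apply Rmult_le_pos; auto.
    left; apply Rinv_0_lt_compat, Rmult_lt_0_compat; auto; now apply pow_lt. }
  (* The origin, where [L = 0], is majorized by its own value, since [lattice_norm] is [1] there. *)
  set (K0 := Cmod (wp_term z (0, 0)%Z)).
  apply (summable_le _ (fun p => (K + K0) * / lattice_norm p ^ 3)%R).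
  2:{ apply bounded_sums_scal; [unfold K0; generalize (Cmod_ge_0 (wp_term z (0, 0)%Z)); lra
      | apply bounded_sums_lattice]. }
  intros p; destruct (classic (p = (0, 0)%Z)) as [-> | Hp].
  - replace (lattice_norm (0, 0)%Z) with 1%R
      by (unfold lattice_norm; simpl; rewrite Rabs_R0; ring).
    fold K0; rewrite pow1, Rinv_1; lra.
  - assert (Hl : 0 - 4 * lattice 1 tau p <> 0).
    { intros E; apply Hp, lattice_eq_0.
      replace (lattice 1 tau p) with (- (0 - 4 * lattice 1 tau p) / 4) by field; rewrite E; field. }
    specialize (H1 p (Hz p)); specialize (H2 p Hl); specialize (Hz p).
    unfold wp_term; rewrite lattice_point_eq; set (L := 4 * lattice 1 tau p) in *.
    assert (HL : L <> 0) by (intros E; apply Hl; rewrite E; ring).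
    replace (0 - L) with (- L) in H2 by ring; rewrite Cmod_opp in H2.
    assert (HN := lattice_norm_ge_1 p); set (N := lattice_norm p) in *.
    replace (/ (z - L) ^ 2 - / L ^ 2) with (- (z * (z - 2 * L)) / ((z - L) ^ 2 * L ^ 2))
      by (field; auto).
    rewrite Cmod_div, Cmod_opp, !Cmod_mult, !Cmod_pow by (apply Cmult_neq_0; now apply Cpow_nz).
    assert (HLp : (0 < Cmod L)%R) by now apply Cmod_gt_0.
    assert (Hnum : (Cmod (z - 2 * L) <= (Cmod z / d2 + 2) * Cmod L)%R).
    { eapply Rle_trans; [apply Cmod_sub_triangle |].
      rewrite Cmod_mult, Cmod_R, Rabs_pos_eq by lra.
      assert (d2 <= Cmod L)%R by (eapply Rle_trans; [| exact H2]; nra).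
      assert (Cmod z <= Cmod z / d2 * Cmod L)%R; [| lra].
      replace (Cmod z) with (Cmod z / d2 * d2)%R at 1 by (field; lra).
      now apply Rmult_le_compat_l. }
    apply Rle_trans with (K * / N ^ 3)%R.
    2:{ apply Rmult_le_compat_r; [left; apply Rinv_0_lt_compat, pow_lt; lra |].
        unfold K0; generalize (Cmod_ge_0 (wp_term z (0, 0)%Z)); lra. }
    apply Rle_trans with (Cmod z * ((Cmod z / d2 + 2) * Cmod L) / (Cmod (z - L) ^ 2 * Cmod L ^ 2))%R.
    + apply Rmult_le_compat_r; [left; apply Rinv_0_lt_compat, Rmult_lt_0_compat; apply pow_lt; auto;
        now apply Cmod_gt_0 |].
      apply Rmult_le_compat_l; auto using Cmod_ge_0.
    + assert (Hzl : (0 < Cmod (z - L))%R) by now apply Cmod_gt_0.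
      replace (Cmod z * ((Cmod z / d2 + 2) * Cmod L) / (Cmod (z - L) ^ 2 * Cmod L ^ 2))%R
        with (Cmod z * (Cmod z / d2 + 2) * / (Cmod (z - L) ^ 2 * Cmod L))%R by (field; lra).
      unfold K; rewrite (Rmult_assoc _ (/ (d1 ^ 2 * d2))), <- Rinv_mult.
      apply Rmult_le_compat_l, Rinv_le_contravar; auto.
      * repeat apply Rmult_lt_0_compat; auto; lra.
      * replace (d1 ^ 2 * d2 * N ^ 3)%R with ((d1 * N) ^ 2 * (d2 * N))%R by ring.
        apply Rmult_le_compat; auto; [apply pow2_ge_0 | apply Rmult_le_pos; lra |].
        apply pow_incr; split; auto; apply Rmult_le_pos; lra.
Qed.

Lemma wp_has_sum (z : C) : off_lattice z -> has_sum (wp_term z) (wp 2 (2 * tau) z).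
Proof.
  intros Hz; destruct (summable_has_sum _ (wp_term_summable z Hz)) as [l Hl].
  assert (K := has_sum_except _ _ (0, 0)%Z Hl).
  replace (wp 2 (2 * tau) z) with l; auto; unfold wp, sum_over.
  transitivity (/ z ^ 2 + (l - wp_term z (0, 0)%Z)).
  - unfold wp_term; rewrite lattice_point_eq; unfold lattice; simpl fst; simpl snd.
    replace (4 * (0 * 1 + 0 * tau)) with (RtoC 0) by ring.
    replace (/ 0 ^ 2) with (RtoC 0).
    + replace (z - 0) with z by ring; ring.
    + replace (0 ^ 2) with (RtoC 0) by ring.
      unfold Cinv, RtoC; simpl; f_equal; unfold Rdiv; ring.
  - f_equal; symmetry.
    apply (iota_filterlim_locally (V := C_CompleteNormedModule)
      (FF := Proper_StrongProper _ (finite_subsets_filter (fun p : Z * Z => p <> (0%Z, 0%Z))))).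
    exact K.
Qed.

Variables a b c d : Z.
Hypothesis Hdet : (a * d - b * c = 1)%Z.

Definition mden : C := IZR c * tau + IZR d.
Definition moebius : C := (IZR a * tau + IZR b) / mden.
Definition log_nome : C := 2 * PI * Ci * moebius.
(** The period lattice is [4 * mden] times the lattice of [1] and [moebius]; the exponential of this
    removes the first period and turns the second into multiplication by the nome. *)
Definition log_pt (z : C) : C := 2 * PI * Ci * (z / (4 * mden)).

Lemma mden_neq_0 : mden <> 0.
Proof.
  intros E.
  assert (H : lattice 1 tau (d, c) = 0) by (unfold lattice; simpl; rewrite <- E; unfold mden; ring).
  apply lattice_eq_0 in H; injection H as -> ->; lia.
Qed.

Lemma Im_moebius_pos : (0 < Im moebius)%R.
Proof.
  assert (H := mden_neq_0); unfold moebius, mden in *; revert H Htau.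
  destruct tau as [x y]; intros H Hy; unfold Im in *; cbn [snd] in Hy.
  set (X := (IZR c * x + IZR d)%R); set (Y := (IZR c * y)%R).
  assert (E : IZR c * (x, y) + IZR d = (X, Y))
    by (unfold X, Y, Cmult, Cplus, RtoC; simpl; f_equal; ring).
  assert (HXY : (0 < X ^ 2 + Y ^ 2)%R).
  { rewrite E in H; destruct (Req_dec X 0) as [HX | HX]; [destruct (Req_dec Y 0) as [HY | HY] |].
    - exfalso; apply H; rewrite HX, HY; reflexivity.
    - generalize (pow2_ge_0 X) (pow2_gt_0 Y HY); lra.
    - generalize (pow2_gt_0 X HX) (pow2_ge_0 Y); lra. }
  rewrite E.
  replace (snd _) with (y / (X ^ 2 + Y ^ 2))%R; [now apply Rdiv_lt_0_compat |].
  assert (Hd : (IZR a * IZR d - IZR b * IZR c = 1)%R) by (rewrite <- !mult_IZR, <- minus_IZR; now apply IZR_eq).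
  unfold Cdiv, Cinv, Cmult, Cplus, RtoC; simpl.
  replace (Rdiv y (X * (X * 1) + Y * (Y * 1)))
    with ((IZR a * IZR d - IZR b * IZR c) * y / (X * (X * 1) + Y * (Y * 1)))%R by (rewrite Hd; field; simpl in HXY; lra).
  unfold X, Y in *; field; simpl in HXY; lra.
Qed.

Lemma Re_log_nome_neg : (Re log_nome < 0)%R.
Proof.
  assert (H := Im_moebius_pos); unfold log_nome; destruct moebius as [x y]; unfold Im in H; simpl in H.
  unfold Re, Ci, RtoC, Cmult; simpl.
  replace _ with (- (2 * PI * y))%R by ring.
  generalize (Rmult_lt_0_compat _ _ PI_RGT_0 H); lra.
Qed.

(** Avoidance of the lattice, stated through exponentials because the zeros of [th] are described in
    that form. *)
Definition regular_pt (z : C) : Prop := forall n : Z, Cexp (log_pt z + IZR n * log_nome) <> 1.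

(** Old coordinates of [m * mden + n * (a * tau + b)] for the pair [(n, m)]. The row index comes
    first because [has_sum_fubini] sums over the second index within each row. *)
Definition unimod (p : Z * Z) : Z * Z := (snd p * d + fst p * b, snd p * c + fst p * a)%Z.
Definition unimod_inv (p : Z * Z) : Z * Z := (- c * fst p + d * snd p, a * fst p - b * snd p)%Z.

Lemma unimod_K p : unimod (unimod_inv p) = p.
Proof.
  destruct p as [x y]; unfold unimod, unimod_inv; cbn [fst snd]; f_equal;
    [transitivity ((a * d - b * c) * x)%Z | transitivity ((a * d - b * c) * y)%Z];
    solve [ring | rewrite Hdet; ring].
Qed.

Lemma unimod_inv_K p : unimod_inv (unimod p) = p.
Proof.
  destruct p as [x y]; unfold unimod, unimod_inv; cbn [fst snd]; f_equal;
    [transitivity ((a * d - b * c) * x)%Z | transitivity ((a * d - b * c) * y)%Z];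
    solve [ring | rewrite Hdet; ring].
Qed.

Lemma lattice_unimod n m : lattice 1 tau (unimod (n, m)) = mden * (IZR m + IZR n * moebius).
Proof.
  unfold lattice, unimod, moebius; simpl fst; simpl snd.
  rewrite !plus_IZR, !mult_IZR, !RtoC_plus, !RtoC_mult.
  transitivity (IZR m * mden + IZR n * (IZR a * tau + IZR b)); [unfold mden; ring |].
  field; apply mden_neq_0.
Qed.

Lemma off_lattice_of_regular z : regular_pt z -> off_lattice z.
Proof.
  intros H p E; rewrite <- (unimod_K p) in E; destruct (unimod_inv p) as [n m].
  rewrite lattice_unimod in E; apply (H (- n)%Z).
  assert (Ez : z = 4 * mden * (IZR m + IZR n * moebius)).
  { transitivity (z - 4 * (mden * (IZR m + IZR n * moebius)) + 4 * (mden * (IZR m + IZR n * moebius)));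
      [ring | rewrite E; ring]. }
  rewrite opp_IZR, RtoC_opp; unfold log_pt, log_nome; rewrite Ez.
  replace (_ + _) with (0 + IZR m * (2 * PI * Ci)) by (field; apply mden_neq_0).
  rewrite Cexp_2PI_Z; apply Cexp_0.
Qed.

(* Sum over the rows [m + n * moebius] of the lattice in the basis [mden], [mden * moebius]. *)
Lemma wp_diff (z1 z2 : C) : regular_pt z1 -> regular_pt z2 ->
  wp 2 (2 * tau) z1 - wp 2 (2 * tau) z2 =
  - (PI / (2 * mden)) ^ 2 * wp_kernel (Cexp log_nome) (Cexp (log_pt z1)) (Cexp (log_pt z2)).
Proof.
  intros H1 H2.
  assert (Hl := mden_neq_0).
  assert (O1 := off_lattice_of_regular z1 H1); assert (O2 := off_lattice_of_regular z2 H2).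
  assert (K := has_sum_minus _ _ _ _ (wp_has_sum z1 O1) (wp_has_sum z2 O2)).
  apply (has_sum_reindex unimod unimod_inv) in K; auto using unimod_K, unimod_inv_K.
  assert (csc_row : forall z n, regular_pt z ->
    has_sum (fun m : Z => / (z - 4 * (mden * (IZR m + IZR n * moebius))) ^ 2)
      (/ (4 * mden) ^ 2 * csc2 (z / (4 * mden) - IZR n * moebius))).
  { intros z n Hz.
    apply (has_sum_ext (fun m : Z => / (4 * mden) ^ 2 *
      / ((z / (4 * mden) - IZR n * moebius) + IZR (- m)) ^ 2)).
    - intros m; rewrite opp_IZR, RtoC_opp.
      assert (Hw := off_lattice_of_regular z Hz (unimod (n, m))); rewrite lattice_unimod in Hw.
      replace (z / (4 * mden) - IZR n * moebius + - IZR m) with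
        ((z - 4 * (mden * (IZR m + IZR n * moebius))) / (4 * mden)) by (field; auto).
      set (w := z - _) in *; field; auto.
    - apply has_sum_scal.
      apply (has_sum_reindex Z.opp Z.opp (fun m => / ((z / (4 * mden) - IZR n * moebius) + IZR m) ^ 2));
        try (intros; lia).
      apply has_sum_inv_sqr; intros E; apply (Hz (- n)%Z); rewrite <- E; f_equal.
      unfold log_pt, log_nome; rewrite opp_IZR, RtoC_opp; ring. }
  assert (F := has_sum_fubini _ (fun n => / (4 * mden) ^ 2 * csc2 (z1 / (4 * mden) - IZR n * moebius)
     - / (4 * mden) ^ 2 * csc2 (z2 / (4 * mden) - IZR n * moebius)) _ K).
  assert (G : has_sum (fun n => / (4 * mden) ^ 2 * csc2 (z1 / (4 * mden) - IZR n * moebius)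
     - / (4 * mden) ^ 2 * csc2 (z2 / (4 * mden) - IZR n * moebius)) (wp 2 (2 * tau) z1 - wp 2 (2 * tau) z2)).
  { apply F; intros n; eapply has_sum_ext;
      [| apply has_sum_minus; [apply (csc_row z1 n H1) | apply (csc_row z2 n H2)]].
    intros m; cbv beta; unfold wp_term; rewrite lattice_point_eq, lattice_unimod; ring. }
  (* The rows carry [- n * moebius], the Koebe sum [+ n * log_nome]. *)
  apply (has_sum_reindex Z.opp Z.opp) in G; try (intros; lia).
  apply (has_sum_unique _ _ _ G).
  assert (L := koebe_Z_diff (log_pt z1) (log_pt z2) log_nome Re_log_nome_neg H1 H2).
  apply (has_sum_scal (- (PI / (2 * mden)) ^ 2)) in L.
  revert L; apply has_sum_ext; intros n.
  unfold csc2, log_pt, log_nome; rewrite opp_IZR, RtoC_opp.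
  replace (2 * PI * Ci * (z1 / (4 * mden) - - IZR n * moebius)) with
    (2 * PI * Ci * (z1 / (4 * mden)) + IZR n * (2 * PI * Ci * moebius)) by ring.
  replace (2 * PI * Ci * (z2 / (4 * mden) - - IZR n * moebius)) with
    (2 * PI * Ci * (z2 / (4 * mden)) + IZR n * (2 * PI * Ci * moebius)) by ring.
  field; auto.
Qed.

(** The multiplicative form of [- sigma (2 * z) / sigma z ^ 4]. In [wp_diff] at [z + t] and [z], the
    factor [th p (1 / r)] contains [1 - 1 / r], whose quotient by [t] tends to [mu]. *)
Lemma wp'_eq (z : C) : regular_pt z ->
  wp' 2 (2 * tau) z = - (PI / (2 * mden)) ^ 2 * (PI * Ci / (2 * mden)) *
    (let p := Cexp log_nome in let u := Cexp (log_pt z) in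
     u * th p (u * u) * qp p p ^ 6 / th p u ^ 4).
Proof.
  intros Hz; cbv zeta; set (p := Cexp log_nome); set (u := Cexp (log_pt z)).
  assert (HT := Re_log_nome_neg); assert (Hl := mden_neq_0).
  assert (Hp : (Cmod p < 1)%R) by now apply Cmod_Cexp_lt_1.
  assert (Hu : u <> 0) by apply Cexp_neq_0.
  assert (Hth : th p u <> 0) by now apply th_neq_0.
  set (t := fun n => (/ (INR n + 1))%R).
  assert (Ht : forall n, t n <> 0%R).
  { intros n; apply Rinv_neq_0_compat; generalize (pos_INR n); lra. }
  assert (Hl0 := is_lim_seq_inv_S).
  set (mu := PI * Ci / (2 * mden)).
  set (r := fun n => Cexp (t n * mu)).
  assert (Hr0 : forall n, r n <> 0) by (intros; apply Cexp_neq_0).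
  assert (Hr : Cconv r 1) by (now apply Cconv_Cexp).
  assert (Hri : Cconv (fun n => / r n) 1).
  { replace (RtoC 1) with (/ 1) by (field; apply C1_nz); apply Cconv_inv; auto using C1_nz. }
  assert (Hmz : forall n, Cexp (log_pt (z + t n)) = u * r n).
  { intros n; unfold u, r; rewrite <- Cexp_plus; f_equal; unfold log_pt, mu; field; auto. }
  assert (Hthr : forall x : C, x <> 0 -> Cconv (fun n => th p (x * r n)) (th p x)).
  { intros x Hx; unfold th; apply Cconv_mult; apply Cconv_qp; auto.
    - assert (H := Cconv_scal x _ _ Hr); replace (x * 1) with x in H by ring; exact H.
    - apply (Cconv_ext (fun n => p / x * / r n)); [intros; field; auto |].
      assert (H := Cconv_scal (p / x) _ _ Hri); replace (p / x * 1) with (p / x) in H by ring; exact H. }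
  (* [wp_diff] needs regular points; [z + t n] is one for [n >= N], as [th] does not vanish at
     [u]. *)
  destruct (Cconv_neq_0 _ _ (Hthr u Hu) Hth) as [N HN].
  (* [C_derive] is by definition the limit along [z + 1 / (n + 1)]. *)
  unfold wp', C_derive.
  transitivity (Clim (fun n => (wp 2 (2 * tau) (z + t n) - wp 2 (2 * tau) z) / (z + t n - z))).
  { unfold C_lim, Clim, Lim, Rbar_loc_seq.
    assert (E : forall n, (fst z + / (INR n + 1), snd z)%R = z + t n)
      by (intros n; destruct z; unfold t, RtoC, Cplus; simpl; f_equal; ring).
    f_equal; f_equal; apply Lim_seq_ext; intros n; now rewrite E. }
  apply Cconv_Clim.
  apply (Cconv_ext_eventually (fun n => - (PI / (2 * mden)) ^ 2 *
    ((r n - 1) / t n * (u * th p (u * u * r n) * (qp p (p * / r n) * qp p (p * r n) * qp p p ^ 4)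
      / (th p (u * r n) ^ 2 * th p u ^ 2)))) _ _ N).
  - intros n Hn.
    assert (Hoff : regular_pt (z + t n)).
    { intros k; apply th_neq_0_inv; auto; rewrite Hmz; now apply HN. }
    rewrite (wp_diff _ _ Hoff Hz), Hmz; fold p u; unfold wp_kernel.
    replace (th p (u / (u * r n))) with ((1 - / r n) * (qp p (p * / r n) * qp p (p * r n))).
    + replace (u * r n * u) with (u * u * r n) by ring.
      assert (Htn : RtoC (t n) <> 0) by (intros E; apply (Ht n); now apply RtoC_inj).
      replace (z + t n - z) with (RtoC (t n)) by ring.
      specialize (HN n Hn); specialize (Hr0 n).
      set (A := th p (u * r n)) in *; set (B := th p (u * u * r n)).
      set (C1 := qp p (p * / r n)); set (C2 := qp p (p * r n)).
      field; repeat split; auto.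
    + unfold th; replace (u / (u * r n)) with (/ r n) by (field; auto).
      rewrite (qp_shift p Hp (/ r n)).
      replace (p / / r n) with (p * r n) by (field; auto).
      replace (/ r n * p) with (p * / r n) by ring; ring.
  - fold mu.
    replace (- (PI / (2 * mden)) ^ 2 * mu * (u * th p (u * u) * qp p p ^ 6 / th p u ^ 4)) with
      (- (PI / (2 * mden)) ^ 2 * (mu * (u * th p (u * u) * (qp p (p * 1) * qp p (p * 1) * qp p p ^ 4)
        / (th p u ^ 2 * th p u ^ 2)))).
    + apply Cconv_scal, Cconv_mult; [now apply Cexp_diff_quotient |].
      apply Cconv_div; [apply Cmult_neq_0; now apply Cpow_nz | |].
      * apply Cconv_mult; [apply Cconv_scal, Hthr; now apply Cmult_neq_0 |].
        apply Cconv_mult; [| apply Cconv_const].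
        apply Cconv_mult; apply Cconv_qp; auto; now apply Cconv_scal.
      * apply Cconv_mult; [now apply Cconv_pow, Hthr | apply Cconv_const].
    + replace (p * 1) with p by ring; field; auto.
Qed.

End Wp.

(** * Reduction to eta quotients *)

Lemma Ci_sqr : Ci * Ci = - (1).
Proof. unfold Ci, Cmult, Copp, RtoC; simpl; f_equal; ring. Qed.

Lemma RtoC_neq_0 (x : R) : x <> 0%R -> RtoC x <> 0.
Proof. intros H E; apply H; now apply RtoC_inj. Qed.

Section EighthRoots.
Variable t : C.
Hypothesis Ht : (0 < Im t)%R.

(* [zeta ^ m * q ^ j] with [zeta] a primitive eighth root of unity and [q = zq 0 1]. *)
Definition zq (m j : Z) : C := Cexp (PI * Ci / 4 * (IZR m + IZR j * t)).

Lemma zq_plus m j m' j' : zq (m + m') (j + j') = zq m j * zq m' j'.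
Proof. unfold zq; rewrite <- Cexp_plus, !plus_IZR, !RtoC_plus; f_equal; field. Qed.

Lemma zq_neq_0 m j : zq m j <> 0.
Proof. apply Cexp_neq_0. Qed.

Lemma zq_0_0 : zq 0 0 = 1.
Proof. unfold zq; rewrite <- Cexp_0; f_equal; simpl; ring. Qed.

Lemma zq_minus m j m' j' : zq (m - m') (j - j') = zq m j / zq m' j'.
Proof.
  transitivity (zq (m - m') (j - j') * zq m' j' / zq m' j'); [field; apply zq_neq_0 |].
  rewrite <- zq_plus; do 2 f_equal; lia.
Qed.

Lemma zq_period m j k : zq (m + 8 * k) j = zq m j.
Proof.
  unfold zq; rewrite <- (Cexp_2PI_Z k (PI * Ci / 4 * (IZR m + IZR j * t))); f_equal.
  rewrite plus_IZR, mult_IZR, RtoC_plus, RtoC_mult; field.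
Qed.

Lemma zq_4_0 : zq 4 0 = - (1).
Proof. rewrite <- Cexp_PI; unfold zq; f_equal; simpl; field. Qed.

Lemma zq_2_0 : zq 2 0 = Ci.
Proof. rewrite <- Cexp_PI_half; unfold zq; f_equal; simpl; field. Qed.

Lemma zq_0_pow j n : zq 0 j ^ n = zq 0 (Z.of_nat n * j).
Proof.
  unfold zq; rewrite <- Cexp_nat, INR_IZR_INZ, mult_IZR, RtoC_mult; f_equal; ring.
Qed.

Lemma Cmod_zq m j : Cmod (zq m j) = exp (- (PI / 4 * IZR j * Im t)).
Proof.
  unfold zq; rewrite Cmod_Cexp; f_equal; destruct t as [x y].
  replace (PI * Ci / 4 * (IZR m + IZR j * (x, y))) with
    ((- (PI / 4 * IZR j * y), PI / 4 * (IZR m + IZR j * x))%R : C).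
  - reflexivity.
  - rewrite Cdiv_R by lra; unfold Ci, Cmult, Cplus, RtoC; simpl; f_equal; field.
Qed.

(** Every nonzero residue modulo [8] becomes [4] after at most two doublings, and
    [zq 4 0 = - (1)]. *)
Lemma zq_unit_0 m : zq m 0 = 1 -> exists k, m = (8 * k)%Z.
Proof.
  intros H; exists (m / 8)%Z.
  assert (Hm := Z_div_mod_eq_full m 8); assert (Hr := Z.mod_pos_bound m 8 ltac:(lia)).
  set (r := (m mod 8)%Z) in *; set (k := (m / 8)%Z) in *.
  replace m with (r + 8 * k)%Z in H by lia; rewrite zq_period in H.
  assert (Hdbl : forall n, zq n 0 = 1 -> zq (n + n) 0 = 1)
    by (intros n Hn; replace 0%Z with (0 + 0)%Z at 1 by lia; rewrite zq_plus, Hn; ring).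
  assert (Hs : forall l, zq (4 + 8 * l) 0 <> 1).
  { intros l E; rewrite zq_period, zq_4_0 in E; apply (f_equal fst) in E; simpl in E; lra. }
  assert (H2 := Hdbl r H); assert (H4 := Hdbl _ H2).
  assert (Hc : (r = 0 \/ r = 1 \/ r = 2 \/ r = 3 \/ r = 4 \/ r = 5 \/ r = 6 \/ r = 7)%Z) by lia.
  repeat destruct Hc as [E | Hc]; try lia; exfalso; rewrite ?E, ?Hc in *;
    first [ exact (Hs 0%Z H) | exact (Hs 0%Z H2) | exact (Hs 1%Z H2) | exact (Hs 0%Z H4)
          | exact (Hs 1%Z H4) | exact (Hs 2%Z H4) | exact (Hs 3%Z H4) ].
Qed.

Lemma zq_unit m j : zq m j = 1 -> j = 0%Z /\ exists k, m = (8 * k)%Z.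
Proof.
  intros H.
  assert (Hj : j = 0%Z).
  { assert (E : Cmod (zq m j) = 1%R) by (rewrite H; apply Cmod_1).
    rewrite Cmod_zq, <- exp_0 in E; apply exp_inv in E.
    apply eq_IZR; simpl; destruct (Req_dec (IZR j) 0); auto; exfalso.
    assert (K : (PI / 4 * IZR j * Im t)%R <> 0%R); [| lra].
    apply Rmult_integral_contrapositive_currified; [| lra].
    apply Rmult_integral_contrapositive_currified; auto; generalize PI_RGT_0; lra. }
  subst j; split; auto; now apply zq_unit_0.
Qed.

Definition nome : C := zq 0 8.

Lemma nome_Cexp : nome = Cexp (2 * PI * Ci * t).
Proof. unfold nome, zq; f_equal; simpl; field. Qed.

Lemma Re_2PI_Ci_neg : (Re (2 * PI * Ci * t) < 0)%R.
Proof.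
  destruct t as [x y]; unfold Im in Ht; simpl in Ht; unfold Re, Ci, RtoC, Cmult; simpl.
  replace _ with (- (2 * PI * y))%R by ring.
  generalize (Rmult_lt_0_compat _ _ PI_RGT_0 Ht); lra.
Qed.

Lemma Cmod_nome : (Cmod nome < 1)%R.
Proof. rewrite nome_Cexp; apply Cmod_Cexp_lt_1, Re_2PI_Ci_neg. Qed.

Lemma th_zq_neq_0 m j : ~ ((8 | m) /\ (8 | j))%Z -> th nome (zq m j) <> 0.
Proof.
  intros H; rewrite nome_Cexp; apply th_neq_0; [apply Re_2PI_Ci_neg |].
  intros n E; apply H.
  assert (K : zq m (j + 8 * n) = 1).
  { rewrite <- E; unfold zq; f_equal; rewrite plus_IZR, mult_IZR, RtoC_plus, RtoC_mult; field. }
  apply zq_unit in K; destruct K as [K1 [k K2]]; split; [exists k | exists (- n)%Z]; lia.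
Qed.

End EighthRoots.

(** * Burnside's functions as quotients of theta products *)

Section Burnside.
Variable tau : C.
Hypothesis Htau : (0 < Im tau)%R.
Variables a b c d : Z.
Hypothesis Hdet : (a * d - b * c = 1)%Z.

Let t : C := moebius tau a b c d.
Let p : C := nome t.

(* The exponential coordinate of the point [(k + l * tau) / 2]. *)
Definition zq_half (k l : Z) : C := zq t (k * a - l * b) (- k * c + l * d).
Definition th_half (k l : Z) : C := th p (zq_half k l).

Let Ht : (0 < Im t)%R := Im_moebius_pos tau Htau a b c d Hdet.

Lemma zq_half_neq_0 k l : zq_half k l <> 0.
Proof. apply zq_neq_0. Qed.

Lemma zq_half_mult k l k' l' : zq_half k l * zq_half k' l' = zq_half (k + k') (l + l').
Proof. unfold zq_half; rewrite <- zq_plus; f_equal; ring. Qed.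

Lemma zq_half_div k l k' l' : zq_half k l / zq_half k' l' = zq_half (k - k') (l - l').
Proof. unfold zq_half; rewrite <- zq_minus; f_equal; ring. Qed.

(** Divisibility of both coordinates by [8] is invariant under a unimodular matrix; the witnesses
    apply its inverse. *)
Lemma th_half_neq_0 k l : ~ ((8 | k) /\ (8 | l))%Z -> th_half k l <> 0.
Proof.
  intros H; apply th_zq_neq_0; [exact Ht |]; intros [[x Hx] [y Hy]]; apply H; split.
  - exists (d * x + b * y)%Z.
    transitivity (d * (k * a - l * b) + b * (- k * c + l * d))%Z; [| rewrite Hx, Hy; ring].
    transitivity (k * (a * d - b * c))%Z; [rewrite Hdet; ring | ring].
  - exists (c * x + a * y)%Z.
    transitivity (c * (k * a - l * b) + a * (- k * c + l * d))%Z; [| rewrite Hx, Hy; ring].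
    transitivity (l * (a * d - b * c))%Z; [rewrite Hdet; ring | ring].
Qed.

(** Expand [k + l * tau] in the basis [mden], [a * tau + b]; division by [2 * 4 * mden] turns
    [2 * PI * Ci] into the unit [PI * Ci / 4] of [zq]. *)
Lemma Cexp_log_pt k l z : z = IZR k / 2 + IZR l / 2 * tau -> Cexp (log_pt tau c d z) = zq_half k l.
Proof.
  intros ->; assert (Hl := mden_neq_0 tau Htau a b c d Hdet).
  assert (Hd : IZR a * IZR d - IZR b * IZR c = 1).
  { rewrite <- !RtoC_mult, <- RtoC_minus, <- !mult_IZR, <- minus_IZR, Hdet; reflexivity. }
  unfold zq_half, zq, log_pt, t, moebius; f_equal.
  rewrite !minus_IZR, !plus_IZR, !mult_IZR, opp_IZR.
  rewrite !RtoC_minus, !RtoC_plus, !RtoC_mult, RtoC_opp.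
  assert (E : IZR k + IZR l * tau = (IZR k * IZR a - IZR l * IZR b) * mden tau c d +
     (- IZR k * IZR c + IZR l * IZR d) * (IZR a * tau + IZR b)).
  { unfold mden.
    transitivity ((IZR k + IZR l * tau) * (IZR a * IZR d - IZR b * IZR c)); [rewrite Hd; ring | ring]. }
  transitivity (PI * Ci / 4 * (IZR k + IZR l * tau) / mden tau c d); [field; auto |].
  rewrite E; field; auto.
Qed.

Lemma p_Cexp_log_nome : Cexp (log_nome tau a b c d) = p.
Proof. unfold p; now rewrite nome_Cexp. Qed.

Lemma regular_half k l z : z = IZR k / 2 + IZR l / 2 * tau -> ~ ((8 | k) /\ (8 | l))%Z ->
  regular_pt tau a b c d z.
Proof.
  intros Hz H n; apply th_neq_0_inv; [now apply Re_log_nome_neg |].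
  rewrite p_Cexp_log_nome, (Cexp_log_pt k l z Hz); now apply th_half_neq_0.
Qed.

Definition kernel2 (k l k' l' : Z) : C :=
  zq_half k l * th_half (k + k') (l + l') * th_half (k' - k) (l' - l) / (th_half k l ^ 2 * th_half k' l' ^ 2).

(** The factor common to all differences of values. It is the square of the extra factor in
    [wp'_zq_half], in accordance with the weights [2] and [3] of the function and its derivative. *)
Definition wp_const : C := - (PI / (2 * mden tau c d)) ^ 2 * qp p p ^ 4.

Lemma wp_diff_zq_half k l k' l' z z' :
  z = IZR k / 2 + IZR l / 2 * tau -> z' = IZR k' / 2 + IZR l' / 2 * tau ->
  ~ ((8 | k) /\ (8 | l))%Z -> ~ ((8 | k') /\ (8 | l'))%Z ->
  wp 2 (2 * tau) z - wp 2 (2 * tau) z' = wp_const * kernel2 k l k' l'.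
Proof.
  intros Hz Hz' H H'.
  rewrite (wp_diff tau Htau a b c d Hdet z z')
    by (eapply regular_half; eauto).
  rewrite p_Cexp_log_nome, (Cexp_log_pt k l z Hz), (Cexp_log_pt k' l' z' Hz').
  unfold wp_kernel, kernel2, wp_const, th_half; rewrite zq_half_mult, zq_half_div.
  assert (K := th_half_neq_0 _ _ H); assert (K' := th_half_neq_0 _ _ H'); unfold th_half in K, K'.
  assert (Hl := mden_neq_0 tau Htau a b c d Hdet); field; auto.
Qed.

Lemma wp'_zq_half k l z : z = IZR k / 2 + IZR l / 2 * tau -> ~ ((8 | k) /\ (8 | l))%Z ->
  wp' 2 (2 * tau) z = wp_const * (PI * Ci / (2 * mden tau c d) * qp p p ^ 2) *
    (zq_half k l * th_half (k + k) (l + l) / th_half k l ^ 4).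
Proof.
  intros Hz H.
  rewrite (wp'_eq tau Htau a b c d Hdet z) by (eapply regular_half; eauto).
  cbv zeta; rewrite p_Cexp_log_nome, (Cexp_log_pt k l z Hz), zq_half_mult; fold (th_half k l) (th_half (k + k) (l + l)).
  unfold wp_const; assert (K := th_half_neq_0 _ _ H).
  assert (Hl := mden_neq_0 tau Htau a b c d Hdet); field; auto.
Qed.

Lemma qp_p_neq : qp p p <> 0.
Proof. apply qp_neq_0_small; apply Cmod_nome; exact Ht. Qed.

Lemma wp_const_neq_0 : wp_const <> 0.
Proof.
  assert (Hl := mden_neq_0 tau Htau a b c d Hdet).
  assert (HPI : RtoC PI <> 0) by (apply RtoC_neq_0; generalize PI_RGT_0; lra).
  unfold wp_const; intros E.
  assert (K : (PI / (2 * mden tau c d)) ^ 2 * qp p p ^ 4 <> 0).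
  { apply Cmult_neq_0; apply Cpow_nz; [| apply qp_p_neq].
    intros E'; apply HPI.
    transitivity (PI / (2 * mden tau c d) * (2 * mden tau c d)); [field; auto | rewrite E'; ring]. }
  apply K; transitivity (- (- (PI / (2 * mden tau c d)) ^ 2 * qp p p ^ 4)); [ring | rewrite E; ring].
Qed.

Ltac nodiv := intros [[?x ?Hx] [?y ?Hy]]; lia.

(** The pairs count half-units: [1], [2] and [tau] are [(2, 0)], [(4, 0)] and [(0, 2)]. Two
    differences cancel [wp_const]. *)
Lemma burnside_x_theta : burnside_x tau =
  (zq_half 2 0 * th_half 6 0 * th_half 0 2 ^ 2) / (zq_half 0 2 * th_half 2 0 * th_half 4 2 * th_half 4 (-2)).
Proof.
  unfold burnside_x; cbv zeta.
  rewrite (wp_diff_zq_half 2 0 4 0 1 2), (wp_diff_zq_half 0 2 4 0 tau 2);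
    try nodiv; try (simpl; field).
  unfold kernel2; simpl Z.add; simpl Z.sub.
  field; repeat split; first [apply zq_half_neq_0 | apply wp_const_neq_0 | apply th_half_neq_0; nodiv].
Qed.

Lemma burnside_y_theta : burnside_y tau =
  4 * Ci * (zq_half 1 0 * (th_half 0 6 * th_half 0 2 * th_half 0 3 * th_half 0 1 * th_half 4 3 * th_half 4 1)
     * (th_half 3 4 * th_half 1 4 * th_half 3 0 * th_half 1 0))
  / (th_half 2 1 * th_half 2 (-1) * th_half 2 5 * th_half 2 3 * th_half 2 0 * th_half 0 4 ^ 3 * th_half 4 2 ^ 2).
Proof.
  unfold burnside_y; cbv zeta.
  rewrite (wp_diff_zq_half 0 2 0 4 tau (2 * tau)), (wp_diff_zq_half 0 1 0 2 (tau / 2) tau),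
    (wp_diff_zq_half 0 1 4 2 (tau / 2) (tau + 2)), (wp_diff_zq_half 1 0 2 4 (1 / 2) (2 * tau + 1)),
    (wp_diff_zq_half 1 0 2 0 (1 / 2) 1), (wp_diff_zq_half 0 1 2 0 (tau / 2) 1),
    (wp_diff_zq_half 0 1 2 4 (tau / 2) (2 * tau + 1)), (wp'_zq_half 1 0 (1 / 2)), (wp'_zq_half 0 2 tau);
    try nodiv; try (simpl; field).
  unfold kernel2; simpl Z.add; simpl Z.sub.
  assert (Hl := mden_neq_0 tau Htau a b c d Hdet).
  assert (HPI : RtoC PI <> 0) by (apply RtoC_neq_0; generalize PI_RGT_0; lra).
  assert (HE : zq_half 0 2 = zq_half 0 1 * zq_half 0 1) by (now rewrite zq_half_mult).
  rewrite HE.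
  assert (Hq := qp_p_neq); assert (HE0 := zq_half_neq_0 1 0); assert (HE1 := zq_half_neq_0 0 1).
  (* This encodes [wp_const = g ^ 2]; the sign comes from [Ci * Ci = - (1)]. *)
  assert (HC : wp_const * ((PI * Ci / (2 * mden tau c d) * qp p p ^ 2)
      * (PI * Ci / (2 * mden tau c d) * qp p p ^ 2)) = wp_const ^ 2).
  { unfold wp_const.
    transitivity ((PI / (2 * mden tau c d)) ^ 2 * qp p p ^ 4 * (Ci * Ci) * - (PI / (2 * mden tau c d)) ^ 2 * qp p p ^ 4);
      [field; auto | rewrite Ci_sqr; field; auto]. }
  assert (HK := wp_const_neq_0).
  set (g := PI * Ci / (2 * mden tau c d) * qp p p ^ 2) in *.
  assert (Hg : g <> 0).
  { intros E; rewrite E in HC; apply (Cpow_nz _ 2 HK); rewrite <- HC; ring. }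
  set (K := wp_const) in *.
  assert (HK1 : K = g * g).
  { transitivity (K ^ 2 / K); [field; auto | rewrite <- HC; field; auto]. }
  rewrite HK1.
  field; repeat split; first [assumption | apply th_half_neq_0; nodiv].
Qed.

End Burnside.

(** * Relations among the products at [zeta ^ m * q ^ j] *)

Section EtaProducts.
Variable t : C.
Hypothesis Ht : (0 < Im t)%R.

Let q : C := zq t 0 1.

Definition qpz (m j : Z) : C := qp (nome t) (zq t m j).

Lemma qpz_period m j k : qpz (m + 8 * k) j = qpz m j.
Proof. unfold qpz; now rewrite zq_period. Qed.

Lemma qpz_shift m j : qpz m j = (1 - zq t m j) * qpz m (j + 8).
Proof.
  unfold qpz; rewrite qp_shift by now apply Cmod_nome.
  do 2 f_equal; unfold nome; rewrite <- zq_plus; f_equal; lia.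
Qed.

Lemma qpz_neq_0 m j : (0 < j)%Z -> qpz m j <> 0.
Proof.
  intros Hj; apply qp_neq_0_small; [now apply Cmod_nome |].
  rewrite (Cmod_zq t Ht), <- exp_0; apply exp_increasing.
  assert (0 < IZR j)%R by (now apply IZR_lt).
  assert (0 < PI / 4 * IZR j * Im t)%R; [| lra].
  generalize PI_RGT_0; intros HPI; apply Rmult_lt_0_compat; auto; apply Rmult_lt_0_compat; auto; lra.
Qed.

Lemma th_zq m j : th (nome t) (zq t m j) = qpz m j * qpz (- m) (8 - j).
Proof. unfold th, qpz; do 2 f_equal; unfold nome; rewrite <- zq_minus; f_equal; lia. Qed.

Lemma th_zq_S m j : th (nome t) (zq t m (j + 8)) = zq t (4 - m) (- j) * th (nome t) (zq t m j).
Proof.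
  rewrite !th_zq, (qpz_shift m j), (qpz_shift (- m) (8 - (j + 8))).
  replace (8 - (j + 8) + 8)%Z with (8 - j)%Z by lia.
  replace (8 - (j + 8))%Z with (0 - j)%Z by lia.
  replace (- j)%Z with (0 - j)%Z by lia; replace (- m)%Z with (0 - m)%Z by lia.
  rewrite !zq_minus, zq_4_0, zq_0_0.
  assert (H : zq t 4 0 / zq t m j = - (1) / zq t m j) by (now rewrite zq_4_0).
  field; apply zq_neq_0.
Qed.

(** Iterates [th (p * x) = - th x / x] in both directions. In the prefactor [4 * k] codes the sign
    [(-1) ^ k], and [4 * k * (k - 1)] is [8] times the triangular number of the accumulated
    nomes. *)
Lemma th_zq_quasi_period m j k :
  th (nome t) (zq t m (j + 8 * k)) =
  zq t (4 * k - k * m) (- k * j - 4 * k * (k - 1)) * th (nome t) (zq t m j).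
Proof.
  assert (Hstep : forall k, th (nome t) (zq t m (j + 8 * (k + 1))) =
    zq t (4 - m) (- (j + 8 * k)) * th (nome t) (zq t m (j + 8 * k))).
  { intros l; rewrite <- th_zq_S; do 2 f_equal; lia. }
  assert (Hpre : forall k, zq t (4 * (k + 1) - (k + 1) * m) (- (k + 1) * j - 4 * (k + 1) * (k + 1 - 1)) =
    zq t (4 - m) (- (j + 8 * k)) * zq t (4 * k - k * m) (- k * j - 4 * k * (k - 1))).
  { intros l; rewrite <- zq_plus; f_equal; ring. }
  revert k; apply Z.bi_induction.
  - intros x y ->; tauto.
  - replace (j + 8 * 0)%Z with j by lia.
    replace (4 * 0 - 0 * m)%Z with 0%Z by ring.
    replace (- 0 * j - 4 * 0 * (0 - 1))%Z with 0%Z by ring.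
    rewrite zq_0_0; ring.
  - intros k; change (Z.succ k) with (k + 1)%Z.
    rewrite Hstep, Hpre; split; intros H; [rewrite H; ring |].
    assert (K := zq_neq_0 t (4 - m) (- (j + 8 * k))); set (e := zq t (4 - m) (- (j + 8 * k))) in *.
    match goal with |- ?x = ?y => transitivity (e * x / e); [field; auto | rewrite H; field; auto] end.
Qed.

(* Split the product by the parity of its index, after pairing [x] with [- x]. *)
Lemma qpz_distribution m j :
  qpz m j * qpz m (j + 4) * (qpz (m + 4) j * qpz (m + 4) (j + 4)) = qpz (2 * m) (2 * j).
Proof.
  assert (Hn : nome t = zq t 0 4 ^ 2).
  { unfold nome; simpl; rewrite Cmult_1_r, <- zq_plus; reflexivity. }
  assert (H4 : (Cmod (zq t 0 4) < 1)%R).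
  { assert (K := Cmod_nome t Ht); rewrite Hn, Cmod_pow in K.
    set (x := Cmod (zq t 0 4)) in *; destruct (Rlt_dec x 1); auto; exfalso.
    assert (1 <= x)%R by lra; simpl in K; nra. }
  assert (Hneg : zq t (m + 4) j = - zq t m j).
  { replace j with (j + 0)%Z at 1 by lia; rewrite zq_plus, zq_4_0; ring. }
  assert (Hsh : forall k, zq t k (j + 4) = zq t k j * zq t 0 4)
    by (intros k; rewrite <- zq_plus; f_equal; lia).
  unfold qpz; rewrite Hn, !Hsh, Hneg, <- !qp_base_sqr, <- qp_sqr by auto.
  f_equal; transitivity (zq t m j * zq t m j); [ring | rewrite <- zq_plus; f_equal; lia].
Qed.

(** Turns [zq] into a monomial with natural exponents in two atoms, which [field] can handle. *)
Lemma zq_red m j m' k n : (m = Z.of_nat m' + 8 * k)%Z -> (j = Z.of_nat n)%Z ->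
  zq t m j = zq t 1 0 ^ m' * q ^ n.
Proof.
  intros -> ->; rewrite zq_period; unfold q.
  rewrite zq_0_pow; replace (Z.of_nat m') with (Z.of_nat m' + 0)%Z by lia.
  replace (Z.of_nat n) with (0 + Z.of_nat n)%Z at 1 by lia; rewrite zq_plus.
  f_equal; [| f_equal; lia].
  unfold zq; rewrite <- Cexp_nat, INR_IZR_INZ; f_equal; ring.
Qed.

Lemma zq_red_neg m j m' k n : (m = Z.of_nat m' + 8 * k)%Z -> (j = - Z.of_nat n)%Z ->
  zq t m j = zq t 1 0 ^ m' / q ^ n.
Proof.
  intros Hm Hj; transitivity (zq t m (j + Z.of_nat n) / q ^ n).
  - unfold q; rewrite zq_0_pow, <- zq_minus; f_equal; lia.
  - rewrite (zq_red m (j + Z.of_nat n) m' k 0); auto; [| lia].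
    change (q ^ 0) with (RtoC 1); now rewrite Cmult_1_r.
Qed.

Lemma q_norm : (Cmod q < 1)%R.
Proof.
  unfold q; rewrite (Cmod_zq t Ht).
  apply Rlt_le_trans with (exp 0); [apply exp_increasing | rewrite exp_0; lra].
  assert (0 < PI / 4 * 1 * Im t)%R; [| lra].
  generalize PI_RGT_0; intros HPI; apply Rmult_lt_0_compat; auto; apply Rmult_lt_0_compat; auto; lra.
Qed.

Lemma nome_q : nome t = (q ^ 4) ^ 2.
Proof. unfold nome, q; rewrite <- Cpow_mult_r, zq_0_pow; reflexivity. Qed.

Lemma qpz_4 j : qpz 4 j = qp ((q ^ 4) ^ 2) (- zq t 0 j).
Proof.
  unfold qpz; rewrite nome_q; f_equal.
  replace 4%Z with (4 + 0)%Z by lia; replace j with (0 + j)%Z at 1 by lia.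
  rewrite zq_plus, zq_4_0; ring.
Qed.

Lemma qp_q4_q4 : qp (q ^ 4) (- q ^ 4) = qpz 4 4 * qpz 4 8.
Proof.
  rewrite qp_base_sqr, !qpz_4 by (apply Cmod_pow_lt_1; [apply q_norm | lia]).
  f_equal; f_equal; unfold q; rewrite !zq_0_pow; [reflexivity |].
  transitivity (- (zq t 0 (Z.of_nat 4 * 1) * zq t 0 (Z.of_nat 4 * 1))); [ring |].
  rewrite <- zq_plus; reflexivity.
Qed.

Lemma qp_q4_q2 : qp (q ^ 4) (- q ^ 2) = qpz 4 2 * qpz 4 6.
Proof.
  rewrite qp_base_sqr, !qpz_4 by (apply Cmod_pow_lt_1; [apply q_norm | lia]).
  f_equal; f_equal; unfold q; rewrite !zq_0_pow; [reflexivity |].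
  transitivity (- (zq t 0 (Z.of_nat 2 * 1) * zq t 0 (Z.of_nat 4 * 1))); [ring |].
  rewrite <- zq_plus; reflexivity.
Qed.

Lemma qp_q2_q2 : qp (q ^ 2) (- q ^ 2) = (qpz 4 2 * qpz 4 6) * (qpz 4 4 * qpz 4 8).
Proof.
  rewrite <- qp_q4_q4, <- qp_q4_q2, qp_base_sqr by (apply Cmod_pow_lt_1; [apply q_norm | lia]).
  rewrite <- Cpow_mult_r; simpl Nat.mul; f_equal; f_equal; ring.
Qed.

Definition X_value : C := qp (q ^ 4) (- q ^ 4) ^ 2 * qp (q ^ 4) (- q ^ 2) ^ 4.
Definition Y_value : C := qp (q ^ 4) (- q ^ 4) ^ 3 * qp (q ^ 2) (- q ^ 2) ^ 6.

Ltac qpz_nonzero := repeat split; apply qpz_neq_0; reflexivity.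

Lemma qpz_dist_0_2 : qpz 0 2 * qpz 0 6 * (qpz 4 2 * qpz 4 6) = qpz 0 4.
Proof. exact (qpz_distribution 0 2). Qed.

(** Euler's identity between partitions into distinct and into odd parts, in the variable [q ^ 4]:
    the distribution relation at [(0, 4)] after cancelling [qpz 0 8]. *)
Lemma qpz_dist_0_4 : qpz 0 4 * (qpz 4 4 * qpz 4 8) = 1.
Proof.
  assert (H := qpz_distribution 0 4); simpl in H.
  assert (K : qpz 0 8 <> 0) by (apply qpz_neq_0; lia).
  transitivity (qpz 0 4 * qpz 0 8 * (qpz 4 4 * qpz 4 8) / qpz 0 8); [field; auto | rewrite H; field; auto].
Qed.

(** The products [qpz 4 4] and [qpz 4 8] are eliminated by Euler's identity, which leaves the atoms
    that the theta quotient for [x] produces. *)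
Lemma X_value_qpz : X_value = (qpz 4 2 * qpz 4 6) ^ 2 / (qpz 0 2 * qpz 0 6) ^ 2.
Proof.
  unfold X_value; rewrite qp_q4_q4, qp_q4_q2.
  assert (H2 := qpz_dist_0_2); assert (H4 := qpz_dist_0_4); rewrite <- H2 in H4.
  set (A := qpz 4 4 * qpz 4 8) in *.
  assert (HA : A = 1 / (qpz 0 2 * qpz 0 6 * (qpz 4 2 * qpz 4 6)))
    by (rewrite <- H4; field; qpz_nonzero).
  rewrite HA; field; qpz_nonzero.
Qed.

Lemma Y_value_qpz : Y_value =
  (qpz 4 2 * qpz 4 6) ^ 3 / (qpz 0 4 ^ 6 * (qpz 0 2 * qpz 0 6) ^ 3).
Proof.
  unfold Y_value; rewrite qp_q4_q4, qp_q2_q2.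
  assert (H2 := qpz_dist_0_2); assert (H4 := qpz_dist_0_4); rewrite <- H2 in *.
  set (A := qpz 4 4 * qpz 4 8) in *.
  assert (HA : A = 1 / (qpz 0 2 * qpz 0 6 * (qpz 4 2 * qpz 4 6)))
    by (rewrite <- H4; field; qpz_nonzero).
  rewrite HA; field; qpz_nonzero.
Qed.

End EtaProducts.

(** * Normal forms at a cusp *)

Section Reduction.
Variable tau : C.
Hypothesis Htau : (0 < Im tau)%R.
Variables a b c d : Z.
Hypothesis Hdet : (a * d - b * c = 1)%Z.
Let t : C := moebius tau a b c d.

(** Root exponents are reduced modulo [8] by periodicity and powers of [q] by quasi-periodicity, so
    that equal theta values acquire equal [qpz] atoms. *)
Lemma th_half_red k l m1 m2 j j2 k1 k2 k3 :
  (k * a - l * b = m1 + 8 * k1)%Z -> (- m1 = m2 + 8 * k2)%Z ->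
  (- k * c + l * d = j + 8 * k3)%Z -> (8 - j = j2)%Z ->
  th_half tau a b c d k l =
  zq t (4 * k3 - k3 * m1) (- k3 * j - 4 * k3 * (k3 - 1)) * (qpz t m1 j * qpz t m2 j2).
Proof.
  intros H1 H2 H3 H4; unfold th_half, zq_half; fold t.
  assert (Ht : (0 < Im t)%R) by now apply Im_moebius_pos.
  rewrite H1, H3, zq_period, th_zq_quasi_period, th_zq, H2, H4 by auto.
  now rewrite qpz_period.
Qed.

End Reduction.

(** Isolates the leading factor, a constant depending only on [zeta]; the rest has positive [j] and
    falls under [qpz_neq_0]. *)
Lemma qpz_0 (t : C) (Ht : (0 < Im t)%R) m : qpz t m 0 = (1 - zq t m 0) * qpz t m 8.
Proof. exact (qpz_shift t Ht m 0). Qed.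

Ltac nonzero Ht :=
  repeat split; first [ assumption | apply qpz_neq_0; [exact Ht | reflexivity] ].

Ltac reduce_th_half Htau Hdet :=
  repeat match goal with |- context [th_half ?tau ?a ?b ?c ?d ?k ?l] =>
    let m := eval vm_compute in (k * a - l * b)%Z in
    let j0 := eval vm_compute in (- k * c + l * d)%Z in
    let m1 := eval vm_compute in (m mod 8)%Z in
    let k1 := eval vm_compute in (m / 8)%Z in
    let m2 := eval vm_compute in ((- m1) mod 8)%Z in
    let k2 := eval vm_compute in ((- m1) / 8)%Z in
    let j := eval vm_compute in (j0 mod 8)%Z in
    let k3 := eval vm_compute in (j0 / 8)%Z in
    let j2 := eval vm_compute in (8 - j)%Z in
    rewrite (th_half_red tau Htau a b c d Hdet k l m1 m2 j j2 k1 k2 k3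
      eq_refl eq_refl eq_refl eq_refl)
  end.

Ltac reduce_qpz_0 t Ht :=
  repeat match goal with |- context [qpz t ?m 0%Z] => rewrite (qpz_0 t Ht m) end.

Ltac reduce_zq t z q :=
  repeat match goal with |- context [zq t ?m ?j] =>
    let m1 := eval vm_compute in (Z.to_nat (m mod 8)) in
    let k := eval vm_compute in (m / 8)%Z in
    let j1 := eval vm_compute in (Z.to_nat j) in
    let j2 := eval vm_compute in (Z.to_nat (- j)) in
    let E := fresh in
    match j2 with
    | O => assert (E : zq t m j = z ^ m1 * q ^ j1) by exact (zq_red t m j m1 k j1 eq_refl eq_refl)
    | _ => assert (E : zq t m j = z ^ m1 / q ^ j2) by exact (zq_red_neg t m j m1 k j2 eq_refl eq_refl)
    end; rewrite E; clear E
  end.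

Lemma z8_pow4 (t : C) : zq t 1 0 ^ 4 = - (1).
Proof. rewrite <- (zq_4_0 t), (zq_red t 4 0 4 0 0); auto; simpl; ring. Qed.

Lemma one_minus_root (t : C) n : (0 < n < 8)%nat -> 1 - zq t 1 0 ^ n <> 0.
Proof.
  intros Hn E.
  assert (K : zq t (Z.of_nat n) 0 = 1).
  { rewrite (zq_red t (Z.of_nat n) 0 n 0 0) by lia.
    replace (zq t 1 0 ^ n) with (1 - (1 - zq t 1 0 ^ n)) by ring; rewrite E; simpl; ring. }
  apply zq_unit_0 in K; destruct K; lia.
Qed.


(** What remains is a rational identity in [q], the [qpz] atoms and [z] modulo [z ^ 4 = - (1)]. The
    asserted inequalities provide the constants [1 - z ^ n] that can occur in denominators. *)
Ltac reduce_theta Htau Hdet t Ht z q Hz :=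
  reduce_th_half Htau Hdet; unfold zq_half; fold t; reduce_qpz_0 t Ht;
  set (z := zq t 1 0); set (q := zq t 0 1);
  assert (Hz : z ^ 4 = - (1)) by apply z8_pow4;
  assert (z <> 0) by apply zq_neq_0; assert (q <> 0) by apply zq_neq_0;
  assert (1 - z ^ 1 <> 0) by (apply one_minus_root; lia);
  assert (1 - z ^ 2 <> 0) by (apply one_minus_root; lia);
  assert (1 - z ^ 3 <> 0) by (apply one_minus_root; lia);
  assert (1 - z ^ 4 <> 0) by (apply one_minus_root; lia);
  assert (1 - z ^ 6 <> 0) by (apply one_minus_root; lia);
  reduce_zq t z q.

Lemma Ci_zq (t : C) : Ci = zq t 1 0 ^ 2.
Proof. rewrite <- (zq_2_0 t), (zq_red t 2 0 2 0 0); auto; simpl; ring. Qed.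

(** Used from right to left: it inserts into [Y_value] the products with odd [j] that occur at every
    cusp, together with two distribution relations [H = G], [H' = G'] for odd powers of [zeta].
    Their [q]-exponents depend on the cusp and are the arguments [j], [j'] of [branch_y]. After this
    the two sides are compared atom by atom. *)
Lemma Y_value_grouped (t : C) (Ht : (0 < Im t)%R) (H H' G G' : C) :
  H = G -> H' = G' -> G <> 0 -> G' <> 0 ->
  (qpz t 4 2 * qpz t 4 6) ^ 2
    * (qpz t 2 1 * qpz t 2 5 * (qpz t 6 1 * qpz t 6 5)) * (qpz t 2 3 * qpz t 2 7 * (qpz t 6 3 * qpz t 6 7))
    * H * H'
    / (qpz t 0 4 ^ 6 * (qpz t 0 2 * qpz t 0 6) ^ 2
    * (qpz t 0 1 * qpz t 0 5 * (qpz t 4 1 * qpz t 4 5)) * (qpz t 0 3 * qpz t 0 7 * (qpz t 4 3 * qpz t 4 7))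
    * (G * G')) = Y_value t.
Proof.
  intros -> -> HG HG'; rewrite Y_value_qpz by auto.
  assert (D1 : qpz t 2 1 * qpz t 2 5 * (qpz t 6 1 * qpz t 6 5) = qpz t 4 2) by exact (qpz_distribution t Ht 2 1).
  assert (D2 : qpz t 2 3 * qpz t 2 7 * (qpz t 6 3 * qpz t 6 7) = qpz t 4 6) by exact (qpz_distribution t Ht 2 3).
  assert (D3 : qpz t 0 1 * qpz t 0 5 * (qpz t 4 1 * qpz t 4 5) = qpz t 0 2) by exact (qpz_distribution t Ht 0 1).
  assert (D4 : qpz t 0 3 * qpz t 0 7 * (qpz t 4 3 * qpz t 4 7) = qpz t 0 6) by exact (qpz_distribution t Ht 0 3).
  rewrite D1, D2, D3, D4; field; nonzero Ht.
Qed.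

(** * Evaluation at the four cusps *)

Ltac branch_x tau Htau a b c d :=
  let t := fresh "t" in let Ht := fresh "Ht" in let z := fresh "z" in let q := fresh "q" in
  let Hz := fresh "Hz" in
  rewrite (burnside_x_theta tau Htau a b c d eq_refl); set (t := moebius tau a b c d);
  assert (Ht : (0 < Im t)%R) by (now apply Im_moebius_pos); try rewrite (Ci_zq t);
  reduce_theta Htau (eq_refl 1%Z) t Ht z q Hz; rewrite X_value_qpz by auto;
  field [Hz]; nonzero Ht.

Ltac branch_y tau Htau a b c d j j' :=
  let t := fresh "t" in let Ht := fresh "Ht" in let z := fresh "z" in let q := fresh "q" in
  let Hz := fresh "Hz" in
  rewrite (burnside_y_theta tau Htau a b c d eq_refl); set (t := moebius tau a b c d);
  assert (Ht : (0 < Im t)%R) by (now apply Im_moebius_pos);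
  rewrite <- (Y_value_grouped t Ht _ _ _ _ (qpz_distribution t Ht 1 j) (qpz_distribution t Ht 3 j'))
    by (apply qpz_neq_0; [exact Ht | reflexivity]);
  cbn [Z.add Pos.add Pos.succ Z.mul Pos.mul];
  rewrite (Ci_zq t);
  reduce_theta Htau (eq_refl 1%Z) t Ht z q Hz; field [Hz]; nonzero Ht.

Lemma burnside_x_one (tau : C) : (0 < Im tau)%R ->
  burnside_x tau = 1 * X_value (moebius tau (-3) 2 (-2) 1).
Proof. intros H; branch_x tau H (-3)%Z 2%Z (-2)%Z 1%Z. Qed.

Lemma burnside_y_one (tau : C) : (0 < Im tau)%R ->
  burnside_y tau = 4 * 1 * zq (moebius tau (-3) 2 (-2) 1) 0 1 * Y_value (moebius tau (-3) 2 (-2) 1).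
Proof. intros H; branch_y tau H (-3)%Z 2%Z (-2)%Z 1%Z 2%Z 2%Z. Qed.

Lemma burnside_x_mone (tau : C) : (0 < Im tau)%R ->
  burnside_x tau = - (1) * X_value (moebius tau 1 (-2) 0 1).
Proof. intros H; branch_x tau H 1%Z (-2)%Z 0%Z 1%Z. Qed.

Lemma burnside_y_mone (tau : C) : (0 < Im tau)%R ->
  burnside_y tau = 4 * - Ci * zq (moebius tau 1 (-2) 0 1) 0 1 * Y_value (moebius tau 1 (-2) 0 1).
Proof. intros H; branch_y tau H 1%Z (-2)%Z 0%Z 1%Z 4%Z 4%Z. Qed.

Lemma burnside_x_i (tau : C) : (0 < Im tau)%R ->
  burnside_x tau = Ci * X_value (moebius tau (-1) 2 (-1) 1).
Proof. intros H; branch_x tau H (-1)%Z 2%Z (-1)%Z 1%Z. Qed.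

Lemma burnside_y_i (tau : C) : (0 < Im tau)%R ->
  burnside_y tau = 4 * zq (moebius tau (-1) 2 (-1) 1) 1 0 * zq (moebius tau (-1) 2 (-1) 1) 0 1 * Y_value (moebius tau (-1) 2 (-1) 1).
Proof. intros H; branch_y tau H (-1)%Z 2%Z (-1)%Z 1%Z 3%Z 1%Z. Qed.

Lemma burnside_x_mi (tau : C) : (0 < Im tau)%R ->
  burnside_x tau = - Ci * X_value (moebius tau (-1) (-2) 1 1).
Proof. intros H; branch_x tau H (-1)%Z (-2)%Z 1%Z 1%Z. Qed.

Lemma burnside_y_mi (tau : C) : (0 < Im tau)%R ->
  burnside_y tau = 4 * (- Ci * zq (moebius tau (-1) (-2) 1 1) 1 0) * zq (moebius tau (-1) (-2) 1 1) 0 1 * Y_value (moebius tau (-1) (-2) 1 1).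
Proof. intros H; branch_y tau H (-1)%Z (-2)%Z 1%Z 1%Z 1%Z 3%Z. Qed.

(** * Integer coefficients *)

Definition mul_one_plus (j : nat) (f : nat -> Z) (n : nat) : Z :=
  (f n + if Nat.leb j n then f (n - j)%nat else 0)%Z.

Section ProductCoefficients.
(* Coefficients of the product of [1 + Q ^ j] over [k >= 1] and [j] in [E k]. *)
Variable E : nat -> list nat.

Fixpoint prod_coef (N : nat) : nat -> Z :=
  match N with
  | O => fun n => if Nat.eqb n 0 then 1%Z else 0%Z
  | S N' => fold_right mul_one_plus (prod_coef N') (E N)
  end.

(* The coefficient of [Q ^ n] no longer changes after the [n]-th factor ([prod_coef_stable]). *)
Definition diag_coef (n : nat) : Z := prod_coef n n.

Definition list_prod1p (Q : C) (js : list nat) : C := fold_right (fun j P => (1 + Q ^ j) * P) 1 js.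

Fixpoint poly_prod (Q : C) (N : nat) : C :=
  match N with
  | O => 1
  | S N' => list_prod1p Q (E N) * poly_prod Q N'
  end.

Lemma has_sum_shift1 (g : nat -> C) (l : C) : has_sum g l ->
  has_sum (fun n => match n with O => RtoC 0 | S m => g m end) l.
Proof.
  intros H; replace l with (0 + l) by ring.
  apply (has_sum_ext (fun n => (fun s : unit + nat => match s with inl _ => RtoC 0 | inr m => g m end)
    (match n with O => inl tt | S m => inr m end))).
  { intros [| n]; reflexivity. }
  apply (has_sum_reindex (fun n => match n with O => inl tt | S m => inr m end)
    (fun s : unit + nat => match s with inl _ => O | inr m => S m end)
    (fun s : unit + nat => match s with inl _ => RtoC 0 | inr m => g m end)).
  - intros [[] | m]; reflexivity.
  - intros [| n]; reflexivity.
  - apply has_sum_sum; auto; apply has_sum_zero.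
Qed.

Lemma has_sum_shift (g : nat -> C) (l : C) j : has_sum g l ->
  has_sum (fun n => if Nat.leb j n then g (n - j)%nat else RtoC 0) l.
Proof.
  intros H; induction j as [| j IH].
  - revert H; apply has_sum_ext; intros n; simpl; now rewrite Nat.sub_0_r.
  - apply has_sum_shift1 in IH; revert IH; apply has_sum_ext; intros [| n]; reflexivity.
Qed.

Lemma mul_one_plus_has_sum (Q : C) j f l :
  has_sum (fun n => IZR (f n) * Q ^ n) l ->
  has_sum (fun n => IZR (mul_one_plus j f n) * Q ^ n) ((1 + Q ^ j) * l).
Proof.
  intros H; replace ((1 + Q ^ j) * l) with (l + Q ^ j * l) by ring.
  eapply has_sum_ext; [| apply has_sum_plus; [exact H | apply has_sum_scal, (has_sum_shift _ _ j H)]].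
  intros n; cbv beta; unfold mul_one_plus; rewrite plus_IZR, RtoC_plus.
  destruct (Nat.leb_spec j n) as [Hj | Hj]; [| ring].
  replace (Q ^ n) with (Q ^ j * Q ^ (n - j)) by (rewrite <- Cpow_add_r; f_equal; lia).
  ring.
Qed.

Lemma prod_coef_has_sum (Q : C) N :
  has_sum (fun n => IZR (prod_coef N n) * Q ^ n) (poly_prod Q N).
Proof.
  induction N as [| N IH].
  - assert (H := has_sum_single (fun n => IZR (prod_coef 0 n) * Q ^ n) O); simpl in H.
    replace (1 * 1) with (RtoC 1) in H by ring; apply H.
    intros [| n] Hn; [congruence | simpl; ring].
  - cbn [prod_coef poly_prod]; induction (E (S N)) as [| j js IHj]; simpl.
    + now rewrite Cmult_1_l.
    + rewrite <- Cmult_assoc; now apply mul_one_plus_has_sum.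
Qed.

Lemma fold_mul_one_plus_nonneg js f : (forall n, 0 <= f n)%Z -> forall n, (0 <= fold_right mul_one_plus f js n)%Z.
Proof.
  intros H; induction js as [| j js IH]; auto; intros n; cbn [fold_right]; unfold mul_one_plus at 1.
  generalize (IH n) (IH (n - j)%nat); destruct (Nat.leb j n); lia.
Qed.

Lemma prod_coef_nonneg N n : (0 <= prod_coef N n)%Z.
Proof.
  revert n; induction N as [| N IH]; intros n; [simpl; destruct (Nat.eqb n 0); lia |].
  now apply fold_mul_one_plus_nonneg.
Qed.

Lemma fold_mul_one_plus_ge js f : (forall n, 0 <= f n)%Z -> forall n, (f n <= fold_right mul_one_plus f js n)%Z.
Proof.
  intros H; induction js as [| j js IH]; intros n; [simpl; lia |].
  cbn [fold_right]; unfold mul_one_plus at 1; generalize (IH n) (fold_mul_one_plus_nonneg js f H (n - j)%nat).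
  destruct (Nat.leb j n); lia.
Qed.

Lemma prod_coef_mono N M n : (N <= M)%nat -> (prod_coef N n <= prod_coef M n)%Z.
Proof.
  induction 1 as [| M _ IH]; [lia |].
  eapply Z.le_trans; [exact IH |]; simpl; apply fold_mul_one_plus_ge, prod_coef_nonneg.
Qed.

Hypothesis HE : forall k j, In j (E k) -> (k <= j)%nat.

(** The factors of stage [k] have exponents at least [k] and leave all coefficients of lower index
    unchanged. *)
Lemma prod_coef_stable N n : (n <= N)%nat -> prod_coef N n = diag_coef n.
Proof.
  induction 1 as [| N HN IH]; [reflexivity |].
  rewrite <- IH; cbn [prod_coef].
  assert (K : forall j, In j (E (S N)) -> (n < j)%nat) by (intros j Hj; apply HE in Hj; lia).
  induction (E (S N)) as [| j js IHj]; auto; cbn [fold_right]; unfold mul_one_plus at 1.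
  rewrite IHj by (intros i Hi; apply K; now right).
  destruct (Nat.leb_spec j n); [specialize (K j (or_introl eq_refl)); lia | lia].
Qed.

Lemma prod_coef_le_diag N n : (prod_coef N n <= diag_coef n)%Z.
Proof.
  destruct (Nat.le_gt_cases n N) as [H | H].
  - rewrite prod_coef_stable by auto; lia.
  - apply prod_coef_mono; lia.
Qed.

Variable L : nat.
Hypothesis HL : forall k, (length (E k) <= L)%nat.

Lemma rsumn_shift (g : nat -> R) j M : (forall n, 0 <= g n)%R ->
  (rsumn (fun n => if Nat.leb j n then g (n - j)%nat else 0) M <= rsumn g M)%R.
Proof.
  intros Hg.
  assert (H : rsumn (fun n => if Nat.leb j n then g (n - j)%nat else 0%R) M = rsumn g (M - j)).
  { induction M as [| M IH]; auto; cbn [rsumn]; rewrite IH.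
    destruct (Nat.leb_spec j M) as [Hj | Hj].
    - replace (S M - j)%nat with (S (M - j)) by lia; reflexivity.
    - replace (S M - j)%nat with (M - j)%nat by lia; ring. }
  rewrite H; clear H; assert (K : (M - j <= M)%nat) by lia; revert K.
  generalize (M - j)%nat; intros m; induction 1; simpl; [lra |]; specialize (Hg m0); lra.
Qed.

Section RealBound.
Variable r : R.
Hypothesis Hr : (0 <= r < 1)%R.

Lemma mul_one_plus_rsumn_le j f M : (forall n, 0 <= f n)%Z ->
  (rsumn (fun n => IZR (mul_one_plus j f n) * r ^ n) M <=
   (1 + r ^ j) * rsumn (fun n => IZR (f n) * r ^ n) M)%R.
Proof.
  intros Hf.
  assert (Hg : forall n, (0 <= IZR (f n) * r ^ n)%R).
  { intros n; apply Rmult_le_pos; [apply IZR_le, Hf | apply pow_le; lra]. }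
  assert (K := rsumn_shift _ j M Hg).
  assert (Eq : rsumn (fun n => IZR (mul_one_plus j f n) * r ^ n)%R M =
    (rsumn (fun n => IZR (f n) * r ^ n)%R M + r ^ j *
     rsumn (fun n => if Nat.leb j n then IZR (f (n - j)%nat) * r ^ (n - j) else 0)%R M)%R).
  { clear K; induction M as [| M IH]; simpl; [ring |].
    rewrite IH; unfold mul_one_plus; rewrite plus_IZR.
    destruct (Nat.leb_spec j M) as [Hj | Hj]; [| ring].
    replace (r ^ M)%R with (r ^ j * r ^ (M - j))%R by (rewrite <- pow_add; f_equal; lia).
    ring. }
  rewrite Eq, Rmult_plus_distr_r, Rmult_1_l; apply Rplus_le_compat_l, Rmult_le_compat_l; auto.
  apply pow_le; lra.
Qed.

(** Coefficients are nonnegative, so truncation only decreases the sum, and each of the at most [L]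
    factors of stage [k] is bounded by [exp (r ^ k)]. The bound is uniform in [M], and in [N] once
    the geometric sum is estimated. *)
Lemma prod_coef_rsumn_le N M :
  (rsumn (fun n => IZR (prod_coef N n) * r ^ n) M <= exp (INR L * rsumn (fun k => r ^ S k) N))%R.
Proof.
  induction N as [| N IH].
  - simpl rsumn at 2; rewrite Rmult_0_r, exp_0.
    assert (K : (rsumn (fun n => IZR (prod_coef 0 n) * r ^ n)%R M <= 1)%R /\
      (rsumn (fun n => IZR (prod_coef 0 n) * r ^ n)%R (S M) = 1)%R).
    { induction M as [| M [_ IH]]; [simpl; lra |]; split; [lra |].
      cbn [rsumn] in *; rewrite IH; simpl; ring. }
    apply K.
  - assert (Hr1 : (0 <= r ^ S N <= 1)%R).
    { split; [apply pow_le; lra |]; rewrite <- (pow1 (S N)); apply pow_incr; lra. }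
    assert (K : forall js, (forall j, In j js -> (S N <= j)%nat) ->
      (rsumn (fun n => IZR (fold_right mul_one_plus (prod_coef N) js n) * r ^ n) M <=
       exp (INR (length js) * r ^ S N) * exp (INR L * rsumn (fun k => r ^ S k) N))%R).
    { induction js as [| j js IHj]; intros Hjs.
      - simpl length; rewrite Rmult_0_l, exp_0, Rmult_1_l; exact IH.
      - simpl fold_right; eapply Rle_trans.
        { apply mul_one_plus_rsumn_le, fold_mul_one_plus_nonneg, prod_coef_nonneg. }
        simpl length; rewrite S_INR, (Rmult_plus_distr_r (INR (length js))), Rmult_1_l, exp_plus.
        rewrite (Rmult_comm (exp (INR (length js) * r ^ S N))), Rmult_assoc.
        apply Rmult_le_compat.
        + generalize (pow_le r j (proj1 Hr)); lra.
        + apply rsumn_nonneg; intros n; apply Rmult_le_pos; [| apply pow_le; lra].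
          apply IZR_le, fold_mul_one_plus_nonneg, prod_coef_nonneg.
        + eapply Rle_trans; [| apply exp_ineq1_le]; apply Rplus_le_compat_l.
          assert (Hj := Hjs j (or_introl eq_refl)).
          replace j with (S N + (j - S N))%nat by lia; rewrite pow_add.
          assert (0 <= r ^ (j - S N) <= 1)%R; [| nra].
          split; [apply pow_le; lra |]; rewrite <- (pow1 (j - S N)); apply pow_incr; lra.
        + apply IHj; intros i Hi; apply Hjs; now right. }
    cbn [prod_coef]; eapply Rle_trans; [apply K; intros j; apply HE |].
    cbn [rsumn]; rewrite <- exp_plus; apply exp_le.
    rewrite Rmult_plus_distr_l, Rplus_comm; apply Rplus_le_compat_l.
    apply Rmult_le_compat_r; [apply Hr1 | apply le_INR, HL].
Qed.

Lemma diag_coef_bounded_sums : bounded_sums (fun n => IZR (diag_coef n) * r ^ n)%R.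
Proof.
  apply (bounded_sums_nat _ (exp (INR L * / (1 - r)))).
  - intros n; apply Rmult_le_pos; [apply IZR_le, prod_coef_nonneg | apply pow_le; lra].
  - intros M; rewrite sum_n_rsumn.
    replace (rsumn _ (S M)) with (rsumn (fun n => IZR (prod_coef M n) * r ^ n)%R (S M)).
    + eapply Rle_trans; [apply prod_coef_rsumn_le |]; apply exp_le, Rmult_le_compat_l;
        [apply pos_INR |].
      assert (K : (rsumn (fun k => r ^ S k) M * (1 - r) = r - r ^ S M)%R).
      { induction M as [| M IH]; [simpl; ring |].
        cbn [rsumn]; rewrite Rmult_plus_distr_r, IH; simpl; ring. }
      apply Rmult_le_reg_r with (1 - r)%R; [lra |]; rewrite K, Rinv_l by lra.
      generalize (pow_le r (S M) (proj1 Hr)); lra.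
    + assert (G : forall m, (m <= S M)%nat -> rsumn (fun n => IZR (prod_coef M n) * r ^ n)%R m
        = rsumn (fun n => IZR (diag_coef n) * r ^ n)%R m).
      { induction m as [| m IH]; intros Hm; auto; cbn [rsumn].
        rewrite IH, prod_coef_stable by lia; reflexivity. }
      now apply G.
Qed.
End RealBound.

(** For fixed [n] the coefficients are nondecreasing in [N] and eventually equal to [diag_coef n],
    which therefore serves both as limit and as majorant in [has_sum_tannery]. *)
Lemma diag_coef_is_series (Q l : C) : (Cmod Q < 1)%R -> Cconv (poly_prod Q) l ->
  is_series (fun n => IZR (diag_coef n) * Q ^ n) l.
Proof.
  intros HQ Hl; apply has_sum_is_series.
  assert (Hb : bounded_sums (fun n => IZR (diag_coef n) * Cmod Q ^ n)%R)
    by (apply diag_coef_bounded_sums; split; [apply Cmod_ge_0 | auto]).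
  assert (Hm : forall N n, (Cmod (IZR (prod_coef N n) * Q ^ n) <= IZR (diag_coef n) * Cmod Q ^ n)%R).
  { intros N n; rewrite Cmod_mult, Cmod_pow, Cmod_R, Rabs_pos_eq by apply IZR_le, prod_coef_nonneg.
    apply Rmult_le_compat_r; [apply pow_le, Cmod_ge_0 | apply IZR_le, prod_coef_le_diag]. }
  destruct (summable_has_sum (fun n => IZR (diag_coef n) * Q ^ n)) as [l' Hl'].
  { apply (summable_le _ _ (fun n => Hm n n) Hb). }
  replace l with l'; auto; apply (Cconv_unique (poly_prod Q)); auto.
  apply (has_sum_tannery (fun N n => IZR (prod_coef N n) * Q ^ n)
    (fun n => IZR (diag_coef n) * Q ^ n) _ (poly_prod Q) l' Hb Hm); auto.
  - intros n; apply (Cconv_ext_eventually (fun _ => IZR (diag_coef n) * Q ^ n) _ _ n);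
      [| apply Cconv_const].
    intros N HN; now rewrite prod_coef_stable.
  - intros N; apply prod_coef_has_sum.
Qed.

End ProductCoefficients.

(** Exponents of [Q = q ^ 2]: two factors [1 + q ^ (4 * k)] and four factors [1 + q ^ (4 * k - 2)].
    Only [k >= 1] enters the product, so the truncated subtraction is harmless. *)
Definition X_exponents (k : nat) : list nat :=
  [2 * k; 2 * k; 2 * k - 1; 2 * k - 1; 2 * k - 1; 2 * k - 1]%nat.

Definition Y_exponents (k : nat) : list nat :=
  [2 * k; 2 * k; 2 * k; k; k; k; k; k; k]%nat.

Lemma prodn_pow (f : nat -> C) m n : prodn (fun k => f k ^ m) n = prodn f n ^ m.
Proof. induction n as [| n IH]; simpl; [now rewrite Cpow_1_l | rewrite IH, Cpow_mult_l; ring]. Qed.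

(** * The stated products and their expansions *)

Section Products.
Variable q : C.
Hypothesis Hq : (Cmod q < 1)%R.

Definition X_factor (k : nat) : C := (1 + q ^ (4 * k)) ^ 2 * (1 + q ^ (4 * k - 2)) ^ 4.
Definition Y_factor (k : nat) : C := (1 + q ^ (4 * k)) ^ 3 * (1 + q ^ (2 * k)) ^ 6.

Lemma X_product : Cconv (partial_prod X_factor) (qp (q ^ 4) (- q ^ 4) ^ 2 * qp (q ^ 4) (- q ^ 2) ^ 4).
Proof.
  assert (Hq4 : (Cmod (q ^ 4) < 1)%R) by (apply Cmod_pow_lt_1; auto; lia).
  apply (Cconv_ext (fun n => qp_partial (q ^ 4) (- q ^ 4) n ^ 2 * qp_partial (q ^ 4) (- q ^ 2) n ^ 4)).
  - intros n; rewrite partial_prod_prodn; unfold qp_partial; rewrite <- !prodn_pow, <- prodn_mult.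
    apply prodn_ext; intros k; unfold X_factor, qp_factor; rewrite <- Cpow_mult_r.
    f_equal; f_equal.
    + replace (4 * S k)%nat with (4 + 4 * k)%nat by lia; rewrite Cpow_add_r; ring.
    + replace (4 * S k - 2)%nat with (2 + 4 * k)%nat by lia; rewrite Cpow_add_r; ring.
  - apply Cconv_mult; apply Cconv_pow; now apply qp_Cconv.
Qed.

Lemma Y_product : Cconv (partial_prod Y_factor) (qp (q ^ 4) (- q ^ 4) ^ 3 * qp (q ^ 2) (- q ^ 2) ^ 6).
Proof.
  assert (Hq4 : (Cmod (q ^ 4) < 1)%R) by (apply Cmod_pow_lt_1; auto; lia).
  assert (Hq2 : (Cmod (q ^ 2) < 1)%R) by (apply Cmod_pow_lt_1; auto; lia).
  apply (Cconv_ext (fun n => qp_partial (q ^ 4) (- q ^ 4) n ^ 3 * qp_partial (q ^ 2) (- q ^ 2) n ^ 6)).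
  - intros n; rewrite partial_prod_prodn; unfold qp_partial; rewrite <- !prodn_pow, <- prodn_mult.
    apply prodn_ext; intros k; unfold Y_factor, qp_factor; rewrite <- !Cpow_mult_r.
    f_equal; f_equal.
    + replace (4 * S k)%nat with (4 + 4 * k)%nat by lia; rewrite Cpow_add_r; ring.
    + replace (2 * S k)%nat with (2 + 2 * k)%nat by lia; rewrite Cpow_add_r; ring.
  - apply Cconv_mult; apply Cconv_pow; now apply qp_Cconv.
Qed.

Lemma product_series (E : nat -> list nat) (L : nat) (f : nat -> C) (l : C) :
  (forall k j, In j (E k) -> (k <= j)%nat) -> (forall k, (length (E k) <= L)%nat) ->
  (forall k, list_prod1p (q ^ 2) (E (S k)) = f (S k)) -> Cconv (partial_prod f) l ->
  is_series (fun n => IZR (diag_coef E n) * q ^ (2 * n)) l.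
Proof.
  intros HE HL Hf Hl.
  apply (is_series_ext (fun n => IZR (diag_coef E n) * (q ^ 2) ^ n)).
  { intros n; now rewrite Cpow_mult_r. }
  apply (diag_coef_is_series E HE L HL); [apply Cmod_pow_lt_1; auto; lia |].
  apply (Cconv_ext (partial_prod f)); auto.
  induction n as [| n IH]; auto; cbn [poly_prod partial_prod]; rewrite <- IH, Hf; ring.
Qed.

Lemma X_series : is_series (fun n => IZR (diag_coef X_exponents n) * q ^ (2 * n))
  (qp (q ^ 4) (- q ^ 4) ^ 2 * qp (q ^ 4) (- q ^ 2) ^ 4).
Proof.
  apply (product_series X_exponents 6 X_factor); unfold X_exponents; try (simpl; lia).
  - intros k; unfold X_factor; cbn [list_prod1p fold_right]; rewrite <- !Cpow_mult_r.
    replace (2 * (2 * S k))%nat with (4 * S k)%nat by lia.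
    replace (2 * (2 * S k - 1))%nat with (4 * S k - 2)%nat by lia; ring.
  - apply X_product.
Qed.

Lemma Y_series : is_series (fun n => IZR (diag_coef Y_exponents n) * q ^ (2 * n))
  (qp (q ^ 4) (- q ^ 4) ^ 3 * qp (q ^ 2) (- q ^ 2) ^ 6).
Proof.
  apply (product_series Y_exponents 9 Y_factor); unfold Y_exponents; try (simpl; lia).
  - intros k; unfold Y_factor; cbn [list_prod1p fold_right]; rewrite <- !Cpow_mult_r.
    replace (2 * (2 * S k))%nat with (4 * S k)%nat by lia; ring.
  - apply Y_product.
Qed.

End Products.

(** * The four branch points together *)

(** The square root of [e] that the expansion of [burnside_y] produces at each cusp; it does not
    depend on [tau]. *)
Definition branch_root (b : branch_point) : C :=
  match b with
  | e_one => 1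
  | e_mone => - Ci
  | e_i => Cexp (PI * Ci / 4)
  | e_mi => - Ci * Cexp (PI * Ci / 4)
  end.

(* The matrices of [branch_moebius], up to a sign that makes most exponents of [q] positive. *)
Definition branch_tau (b : branch_point) (tau : C) : C :=
  match b with
  | e_one => moebius tau (-3) 2 (-2) 1
  | e_mone => moebius tau 1 (-2) 0 1
  | e_i => moebius tau (-1) 2 (-1) 1
  | e_mi => moebius tau (-1) (-2) 1 1
  end.

Lemma zq_1_0 (t : C) : zq t 1 0 = Cexp (PI * Ci / 4).
Proof. unfold zq; f_equal; ring. Qed.

Lemma branch_root_sqr (b : branch_point) : branch_root b ^ 2 = branch_value b.
Proof.
  assert (H8 : Cexp (PI * Ci / 4) * Cexp (PI * Ci / 4) = Ci).
  { rewrite <- Cexp_plus; transitivity (Cexp (PI * Ci / 2)); [f_equal; field | apply Cexp_PI_half]. }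
  destruct b; simpl; rewrite Cmult_1_r.
  - ring.
  - transitivity (Ci * Ci); [ring | apply Ci_sqr].
  - exact H8.
  - transitivity (Ci * Ci * (Cexp (PI * Ci / 4) * Cexp (PI * Ci / 4))); [ring |].
    rewrite H8, Ci_sqr; ring.
Qed.

Lemma Im_branch_tau_pos (b : branch_point) (tau : C) : (0 < Im tau)%R -> (0 < Im (branch_tau b tau))%R.
Proof. intros H; destruct b; now apply Im_moebius_pos. Qed.

Lemma branch_q_zq (b : branch_point) (tau : C) : (0 < Im tau)%R ->
  branch_q b tau = zq (branch_tau b tau) 0 1.
Proof.
  intros H; unfold branch_q, zq; f_equal; f_equal.
  assert (H1 := mden_neq_0 tau H (-3) 2 (-2) 1 eq_refl).
  assert (H2 := mden_neq_0 tau H (-1) 2 (-1) 1 eq_refl).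
  assert (H3 := mden_neq_0 tau H (-1) (-2) 1 1 eq_refl).
  unfold mden in *.
  assert (K1 : 2 * tau - 1 <> 0) by (intros E; apply H1; transitivity (- (2 * tau - 1)); [ring | rewrite E; ring]).
  assert (K2 : tau - 1 <> 0) by (intros E; apply H2; transitivity (- (tau - 1)); [ring | rewrite E; ring]).
  assert (K3 : tau + 1 <> 0) by (intros E; apply H3; rewrite <- E; ring).
  destruct b; unfold branch_moebius, branch_tau, moebius, mden; field; auto using C1_nz.
Qed.

Lemma burnside_x_branch (b : branch_point) (tau : C) : (0 < Im tau)%R ->
  burnside_x tau = branch_value b * X_value (branch_tau b tau).
Proof.
  intros H; destruct b.
  - now apply burnside_x_one.
  - now apply burnside_x_mone.
  - now apply burnside_x_i.
  - now apply burnside_x_mi.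
Qed.

Lemma burnside_y_branch (b : branch_point) (tau : C) : (0 < Im tau)%R ->
  burnside_y tau = 4 * branch_root b * branch_q b tau * Y_value (branch_tau b tau).
Proof.
  intros H; rewrite (branch_q_zq b tau H); destruct b; unfold branch_root.
  - now apply burnside_y_one.
  - now apply burnside_y_mone.
  - rewrite <- (zq_1_0 (branch_tau e_i tau)); now apply burnside_y_i.
  - rewrite <- (zq_1_0 (branch_tau e_mi tau)); now apply burnside_y_mi.
Qed.

Theorem proposition6 :
  exists a c : nat -> Z,
    map a [0; 1; 2; 3; 4; 5; 6]%nat = [1; 4; 8; 16; 32; 56; 96]%Z /\
    map c [0; 1; 2; 3; 4; 5]%nat = [1; 6; 24; 80; 231; 606]%Z /\
    forall b : branch_point,
      exists s : C, s ^ 2 = branch_value b /\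
        forall tau : C, (0 < Im tau)%R ->
          (exists X : C,
             is_series (fun n : nat => IZR (a n) * branch_q b tau ^ (2 * n)) X /\
             is_infinite_prod
               (fun k : nat => (1 + branch_q b tau ^ (4 * k)) ^ 2 *
                               (1 + branch_q b tau ^ (4 * k - 2)) ^ 4) X /\
             burnside_x tau = branch_value b * X) /\
          (exists Y : C,
             is_series (fun n : nat => IZR (c n) * branch_q b tau ^ (2 * n)) Y /\
             is_infinite_prod
               (fun k : nat => (1 + branch_q b tau ^ (4 * k)) ^ 3 *
                               (1 + branch_q b tau ^ (2 * k)) ^ 6) Y /\
             burnside_y tau = 4 * s * branch_q b tau * Y).
Proof.
  exists (diag_coef X_exponents), (diag_coef Y_exponents).
  (* Each listed coefficient is a finite integer computation with the first few factors. *)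
  split; [vm_compute; reflexivity |]; split; [vm_compute; reflexivity |].
  intros b; exists (branch_root b); split; [apply branch_root_sqr |]; intros tau Htau.
  assert (Hq : (Cmod (branch_q b tau) < 1)%R).
  { rewrite branch_q_zq by auto; now apply q_norm, Im_branch_tau_pos. }
  assert (HX : X_value (branch_tau b tau) = qp (branch_q b tau ^ 4) (- branch_q b tau ^ 4) ^ 2
    * qp (branch_q b tau ^ 4) (- branch_q b tau ^ 2) ^ 4) by (now rewrite branch_q_zq).
  assert (HY : Y_value (branch_tau b tau) = qp (branch_q b tau ^ 4) (- branch_q b tau ^ 4) ^ 3
    * qp (branch_q b tau ^ 2) (- branch_q b tau ^ 2) ^ 6) by (now rewrite branch_q_zq).
  split.
  - exists (X_value (branch_tau b tau)); split; [| split].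
    + rewrite HX; now apply X_series.
    + apply Cconv_filterlim; rewrite HX; now apply X_product.
    + now apply burnside_x_branch.
  - exists (Y_value (branch_tau b tau)); split; [| split].
    + rewrite HY; now apply Y_series.
    + apply Cconv_filterlim; rewrite HY; now apply Y_product.
    + now apply burnside_y_branch.
Qed.
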